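(* Fix a real number $\sigma>1/2$. There exists a continuous non-negative function $\mathcal{M}_{\sigma}:\mathbb{R}\to\mathbb{R}$ such that \[ \lim_{\substack{q\to\infty\\ q\text{ prime}}}\frac{1}{|X(q)|}\sum_{\chi\in X'(q,\sigma)}\Phi\big(2\log|L(\sigma,\chi)|\big)=\int_{\mathbb{R}}\mathcal{M}_{\sigma}(u)\Phi(u)\,\frac{du}{\sqrt{2\pi}} \] for every test function $\Phi:\mathbb{R}\to\mathbb{C}$ that is either bounded and continuous, or compactly supported and Riemann integrable.
   Context: For a prime $q$, $X(q)$ denotes the set of all primitive Dirichlet characters of conductor $q$ (so $|X(q)|=q-2$), and $L(s,\chi)$ is the Dirichlet $L$-function of $\chi$. For $\chi\in X(q)$ let $G_\chi=\{z\in\mathbb{C}:\Re z>1/2\}\setminus\bigcup_\rho B_\rho(\chi)$, where $\rho$ runs over the zeros of $L(z,\chi)$ with $\Re\rho>1/2$ and $B_\rho(\chi)=\{z: 1/2<\Re z\le \Re\rho,\ \Im z=\Im\rho\}$. For $s\in\mathbb{C}$ put $X'(q,s)=\{\chi\in X(q): s\in G_\chi\}$. For $z=u+iv\in G_\chi$ with $1/2<u\le 1$, $\log L(z,\chi)$ is defined by analytic continuation from the half-plane $\Re z>1$ (where it is given by the Euler product) along the horizontal path $u'+iv$, $u'\ge u$. The class of test functions $\Phi$ (bounded continuous, or compactly supported Riemann integrable) is the one the paper specifies in its introduction for such averages. *)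

(* Defs.v *)
From Stdlib Require Export Reals ZArith Znumtheory List.
From Stdlib Require Import ClassicalEpsilon.
From Coquelicot Require Export Coquelicot.

Open Scope R_scope.

(** ** Finite sums and cardinalities *)

Definition enumerates {T : Type} (A : T -> Prop) (l : list T) : Prop :=
  NoDup l /\ forall x, In x l <-> A x.

(** Meaningful for finite [A] only; otherwise an unspecified list. *)
Definition enum {T : Type} (A : T -> Prop) : list T :=
  epsilon (inhabits nil) (enumerates A).

Definition card {T : Type} (A : T -> Prop) : nat := length (enum A).

Definition Csum_over {T : Type} (A : T -> Prop) (F : T -> C) : C :=
  fold_right Cplus (RtoC 0) (map F (enum A)).

(** ** Dirichlet characters *)

Definition dirichlet_character (q : nat) (chi : Z -> C) : Prop :=
  (forall a b : Z, chi (a * b)%Z = Cmult (chi a) (chi b)) /\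
  (forall a : Z, chi (a + Z.of_nat q)%Z = chi a) /\
  (forall a : Z, chi a <> RtoC 0 <-> rel_prime a (Z.of_nat q)).

Definition induced_from (q d : nat) (chi : Z -> C) : Prop :=
  Nat.divide d q /\
  exists psi : Z -> C, dirichlet_character d psi /\
    forall a : Z, rel_prime a (Z.of_nat q) -> chi a = psi a.

Definition is_conductor (q : nat) (chi : Z -> C) (f : nat) : Prop :=
  induced_from q f chi /\
  forall d : nat, induced_from q d chi -> (f <= d)%nat.

Definition X (q : nat) (chi : Z -> C) : Prop :=
  dirichlet_character q chi /\ is_conductor q chi q.

(** ** Dirichlet L-functions *)

Definition Cexp (z : C) : C := (exp (Re z) * cos (Im z), exp (Re z) * sin (Im z)).

(** [x ^ (-s)] for real [x > 0]. *)
Definition Rpow_opp (x : R) (s : C) : C := Cexp (Cmult (Copp s) (RtoC (ln x))).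

Definition CSeries (a : nat -> C) : C :=
  (Series (fun n => Re (a n)), Series (fun n => Im (a n))).

(** For a non-principal character the Dirichlet series converges (in order of
    summation, conditionally if [Re s <= 1]) to a holomorphic function on the
    whole half-plane [Re s > 0], so there its sum is the value of the
    analytically continued L-function. It is only used below for characters in
    [X q], [q] prime (hence non-principal), and for [Re s > 1/2]. *)
Definition dirichlet_L (chi : Z -> C) (s : C) : C :=
  CSeries (fun n => Cmult (chi (Z.of_nat (S n))) (Rpow_opp (INR (S n)) s)).

Definition B (rho z : C) : Prop :=
  1 / 2 < Re z <= Re rho /\ Im z = Im rho.

Definition G (chi : Z -> C) (z : C) : Prop :=
  1 / 2 < Re z /\
  forall rho : C, dirichlet_L chi rho = RtoC 0 -> 1 / 2 < Re rho -> ~ B rho z.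

Definition X' (q : nat) (s : C) (chi : Z -> C) : Prop :=
  X q chi /\ G chi s.

(** ** Test functions *)

Definition bounded_continuous (Phi : R -> C) : Prop :=
  (forall x : R, continuous Phi x) /\
  exists K : R, forall x : R, Cmod (Phi x) <= K.

Definition compactly_supported_Riemann_integrable (Phi : R -> C) : Prop :=
  exists a b : R, a <= b /\
    (forall x : R, x < a \/ b < x -> Phi x = RtoC 0) /\
    @ex_RInt C_R_NormedModule Phi a b.

Definition test_function (Phi : R -> C) : Prop :=
  bounded_continuous Phi \/ compactly_supported_Riemann_integrable Phi.

(** ** The average and its limit *)

Definition average (sigma : R) (Phi : R -> C) (q : nat) : C :=
  Cdiv (Csum_over (X' q (RtoC sigma))
          (fun chi => Phi (2 * ln (Cmod (dirichlet_L chi (RtoC sigma))))))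
       (RtoC (INR (card (X q)))).

Definition along_primes : (nat -> Prop) -> Prop :=
  within (fun q : nat => prime (Z.of_nat q)) eventually.

(** Integrals over the line are improper Riemann integrals. When [M] is
    continuous, non-negative and has a convergent integral, and [Phi] is a test
    function, they converge absolutely and agree with Lebesgue integrals. *)
Definition is_integral_against (M : R -> R) (Phi : R -> C) (I : C) : Prop :=
  @is_RInt_gen C_R_NormedModule
    (fun u => Cmult (RtoC (M u / sqrt (2 * PI))) (Phi u))
    (Rbar_locally m_infty) (Rbar_locally p_infty) I.

(* Main.v *)
(** For [sigma > 1/2], orthogonality of the characters and summation by parts bound the mean over
    [chi] of [sup |L(rho, chi) P_y(rho, chi) - 1|], where [rho] is real, [rho >= sigma], and [P_y]
    is the inverse of the Euler product over the primes up to [y]. The bound tends to [0] as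
    [q -> oo] and then [y -> oo], so all but a small proportion of the [chi] have no real zero to
    the right of [sigma] and satisfy [2 log |L| = sum_(p <= y) local_log (chi p) + o(1)]. By
    Fejer kernels and unique factorisation, the [chi p] become independent and uniform on the circle.

    The law of [local_log r] is singular at the critical points [1] and [-1] of the circle. The
    partition [1 = sum_k (bad k - bad (S k))] of the circle cuts neighbourhoods of these points
    dyadically. Telescoping [bad k (chi 2) bad k (chi 3) bad k (chi 5)] one factor at a time writes
    the law of [2 log |L|] as a sum of pieces in which one of the primes 2, 3, 5 supplies a bounded
    continuous density, of size [O(2^k)], on an event of probability [O(4^-k)]. The series of the
    densities converges uniformly; its sum times [sqrt (2 pi)] is [M]. *)
Require Import Defs.
From Stdlib Require Import Lia Lra Permutation ClassicalEpsilon FunctionalExtensionality IndefiniteDescription.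
From mathcomp Require all_boot ssralg zmodp poly cyclic finfield.


(** * The multiplicative group of a prime field *)

(** The point [sigma] is real, so only a real zero can exclude it from [G chi]; closeness to 1 is
    therefore needed on a half-line only, and no zero density estimate enters. The obstacle is that
    the law has to be produced without a limiting random variable: no measure on an infinite torus
    is built. At each modulus [q] the pieces of the density are finite averages over characters,
    continuous in [u], and they are Cauchy in [q] uniformly in [u]. Independence is only tested on
    finitely many primes, through finite means over roots of unity.

    Passing from continuous functions of compact support to the test functions takes three more
    facts. The density is bounded, so points and short intervals carry little mass and Riemann
    integrable functions can be squeezed by step functions. The laws are tight, so bounded
    continuous functions can be cut off. Characters with [sigma] outside [G chi] have vanishing
    proportion, so leaving them out does not affect the limit. *)

Module PrimeFieldUnits.
Import all_boot ssralg zmodp poly cyclic finfield.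
Import GRing.Theory.
Local Open Scope nat_scope.

Lemma prime_Z_nat (q : nat) : Znumtheory.prime (Z.of_nat q) <-> prime q.
Proof.
split.
- move=> [H1 H2]; apply/primeP; split; first by apply/ltP; lia.
  move=> d /dvdnP [k Hk].
  have Hq : (Z.of_nat d | Z.of_nat q)%Z by exists (Z.of_nat k); rewrite Hk -multE Nat2Z.inj_mul.
  have := Znumtheory.prime_divisors _ (Znumtheory.prime_intro _ H1 H2) _ Hq.
  move=> H; apply/orP; case: H => [|[|[|]]] H; [lia | left | right | lia]; apply/eqP; lia.
- move=> /primeP [H1 H2]; apply: Znumtheory.prime_intro.
    by move/ltP: H1; lia.
  move=> n Hn.
  apply: Znumtheory.Zis_gcd_intro; try exact: Z.divide_1_l.
  move=> x [a Ha] [b Hb].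
  have Hx : x <> 0%Z by move=> Hx; subst x; lia.
  have Hd : Z.to_nat (Z.abs x) %| q.
    apply/dvdnP; exists (Z.to_nat (Z.abs b)); rewrite -multE; have := ltP H1; nia.
  case/orP: (H2 _ Hd) => /eqP E.
  + have : Z.abs x = 1%Z by lia.
    move=> E2. exists (x)%Z. lia.
  + have : Z.abs x = Z.of_nat q by lia.
    move=> E2. have : (a <> 0)%Z by move=> E3; subst a; lia. nia.
Qed.

(** The [q - 1] nonzero elements of the field are roots of unity of order dividing [q - 1], and
    there are enough of them for one to have that exact order. The conclusion is phrased with
    [Nat.modulo] and [Nat.pow] so that the field does not leave this module. *)
Lemma primitive_root (q : nat) : Znumtheory.prime (Z.of_nat q) ->
  exists g : nat,
    (forall a : nat, ~ Nat.divide q a ->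
       exists k, (k < Nat.sub q 1)%coq_nat /\ Nat.modulo (Nat.pow g k) q = Nat.modulo a q) /\
    (forall i j, (i < Nat.sub q 1)%coq_nat -> (j < Nat.sub q 1)%coq_nat ->
       Nat.modulo (Nat.pow g i) q = Nat.modulo (Nat.pow g j) q -> i = j) /\
    Nat.modulo (Nat.pow g (Nat.sub q 1)) q = Nat.modulo 1 q.
Proof.
move=> /prime_Z_nat pq.
have cardF : #|'F_q| = q by apply: card_Fp.
have q1 := prime_gt1 pq.
have fermat (x : 'F_q) : x != 0%R -> (x ^+ q.-1 = 1)%R.
  move=> x0; apply: (mulfI x0); rewrite -exprS prednK ?(ltnW q1) // mulr1.
  by have := expf_card x; rewrite cardF.
have Hmod n : nat_of_ord ((n%:R)%R : 'F_q) = Nat.modulo n q.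
  rewrite val_Fp_nat //.
  have Hq := ltP q1.
  apply: (Nat.mod_unique _ _ (n %/ q)); first by apply/ltP; rewrite ltn_mod ltnW.
  by rewrite {1}(divn_eq n q) mulnC.
have Hpow a n : ((Nat.pow a n)%:R = (a%:R) ^+ n :> 'F_q)%R.
  elim: n => [|n IH] //=. rewrite exprS -IH -natrM. by [].
pose rs := [seq x <- enum 'F_q | x != 0%R].
have ex_z : has (q.-1).-primitive_root%R rs.
  apply: has_prim_root.
  - by rewrite -ltnS prednK // ltnW.
  - apply/allP => x; rewrite /rs mem_filter => /andP [x0 _].
    rewrite unity_rootE fermat //; apply: eqxx.
  - by rewrite /rs filter_uniq // enum_uniq.
  - rewrite /rs size_filter.
    have := count_predC (pred1 (0%R : 'F_q)) (enum 'F_q).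
    rewrite -cardE cardF (count_uniq_mem _ (enum_uniq _)) mem_enum /=.
    move=> H. rewrite -{1}H add1n /=. by apply: eq_leq; apply: eq_count.
case/hasP: ex_z => z zrs zprim.
have q0 : 0 < q.-1 by rewrite -ltnS prednK // ltnW.
exists (nat_of_ord z); split; last split.
- move=> a Ha.
  have a0 : (a%:R : 'F_q)%R != 0%R.
    apply/eqP => E; apply: Ha.
    have := Hmod a; rewrite E /= => H0.
    have Hq := ltP q1. apply/Nat.Lcm0.mod_divide. by rewrite -H0.
  have [i Hi] := prim_rootP zprim (fermat _ a0).
  exists (nat_of_ord i); split; first by have := ltP (ltn_ord i); have := ltP q1; lia.
  rewrite -!Hmod Hpow natr_Zp -Hi. by [].
- move=> i j Hi Hj. rewrite -!Hmod => /ord_inj. rewrite !Hpow natr_Zp => /eqP.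
  rewrite (eq_prim_root_expr zprim) => /eqP.
  by rewrite !modn_small //; apply/ltP; have := ltP q1; lia.
- rewrite -!Hmod Hpow natr_Zp (_ : Nat.sub q 1 = q.-1); last by lia.
  by rewrite (prim_expr_order zprim).
Qed.

Lemma prime_above (n : nat) : exists q, (n < q)%coq_nat /\ Znumtheory.prime (Z.of_nat q).
Proof. by have [p Hp /prime_Z_nat pp] := prime_above n; exists p; split => //; apply/ltP. Qed.

Lemma prime_divisor (n : nat) : (1 < n)%coq_nat ->
  exists p, Znumtheory.prime (Z.of_nat p) /\ Nat.divide p n.
Proof.
move=> /ltP /pdivP [p pp /dvdnP [k Hk]]; exists p; split; first exact/prime_Z_nat.
by exists k.
Qed.

(** The exponent of [p] in [n]. Its additivity and its values at primes are all of unique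
    factorisation that the equidistribution argument uses. *)
Definition valuation (p n : nat) : nat := logn p n.

Lemma valuation_mult p m n : (0 < m)%coq_nat -> (0 < n)%coq_nat ->
  valuation p (Nat.mul m n) = Nat.add (valuation p m) (valuation p n).
Proof. by move=> /ltP m0 /ltP n0; apply: lognM. Qed.

Lemma valuation_1 p : valuation p 1 = 0.
Proof. exact: logn1. Qed.

Lemma valuation_prime p p' : Znumtheory.prime (Z.of_nat p') ->
  valuation p p' = if Nat.eqb p p' then 1 else 0.
Proof.
by move=> /prime_Z_nat pp; rewrite /valuation logn_prime.
Qed.
End PrimeFieldUnits.

(** * Finite sums and exponential sums *)

Definition rsum {T : Type} (l : list T) (f : T -> R) : R :=
  fold_right (fun x s => f x + s) 0 l.

Definition csum {T : Type} (l : list T) (f : T -> C) : C :=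
  fold_right (fun x s => (f x + s)%C) (RtoC 0) l.

Lemma rsum_ext {T} (l : list T) f g :
  (forall x, In x l -> f x = g x) -> rsum l f = rsum l g.
Proof.
  induction l as [|x l IH]; intros H; simpl; trivial.
  rewrite (H x), IH; trivial; [intros; apply H|]; simpl; auto.
Qed.

Lemma rsum_plus {T} (l : list T) f g :
  rsum l (fun x => f x + g x) = rsum l f + rsum l g.
Proof. induction l as [|x l IH]; simpl; [|rewrite IH]; ring. Qed.

Lemma rsum_minus {T} (l : list T) f g :
  rsum l (fun x => f x - g x) = rsum l f - rsum l g.
Proof. induction l as [|x l IH]; simpl; [|rewrite IH]; ring. Qed.

Lemma rsum_scal {T} (l : list T) c f : rsum l (fun x => c * f x) = c * rsum l f.
Proof. induction l as [|x l IH]; simpl; [|rewrite IH]; ring. Qed.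

Lemma rsum_const {T} (l : list T) c : rsum l (fun _ => c) = INR (length l) * c.
Proof.
  induction l as [|x l IH]; [simpl; ring|].
  change (rsum (x :: l) (fun _ => c)) with (c + rsum l (fun _ => c)).
  rewrite IH; change (length (x :: l)) with (S (length l)); rewrite S_INR; ring.
Qed.

Lemma rsum_le {T} (l : list T) f g :
  (forall x, In x l -> f x <= g x) -> rsum l f <= rsum l g.
Proof.
  induction l as [|x l IH]; intros H; simpl; [lra|].
  apply Rplus_le_compat; [|apply IH; intros]; apply H; simpl; auto.
Qed.

Lemma rsum_nonneg {T} (l : list T) f :
  (forall x, In x l -> 0 <= f x) -> 0 <= rsum l f.
Proof.
  intros H; apply Rle_trans with (rsum l (fun _ => 0)).
  - rewrite rsum_const; lra.
  - apply rsum_le; auto.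
Qed.

Lemma rsum_abs {T} (l : list T) f : Rabs (rsum l f) <= rsum l (fun x => Rabs (f x)).
Proof.
  induction l as [|x l IH]; simpl; [rewrite Rabs_R0; lra|].
  eapply Rle_trans; [apply Rabs_triang|lra].
Qed.

Lemma rsum_app {T} (l l' : list T) f : rsum (l ++ l') f = rsum l f + rsum l' f.
Proof. induction l as [|x l IH]; simpl; [|rewrite IH]; ring. Qed.

Lemma rsum_cons {T} x (l : list T) f : rsum (x :: l) f = f x + rsum l f.
Proof. reflexivity. Qed.

Lemma csum_cons {T} x (l : list T) f : csum (x :: l) f = (f x + csum l f)%C.
Proof. reflexivity. Qed.

Lemma rsum_map {S T} (h : S -> T) (l : list S) f :
  rsum (map h l) f = rsum l (fun x => f (h x)).
Proof. induction l as [|x l IH]; simpl; [|rewrite IH]; trivial. Qed.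

Lemma rsum_perm {T} (l l' : list T) f : Permutation l l' -> rsum l f = rsum l' f.
Proof. induction 1; simpl; lra. Qed.

Lemma rsum_swap {S T} (l : list S) (l' : list T) (f : S -> T -> R) :
  rsum l (fun x => rsum l' (f x)) = rsum l' (fun y => rsum l (fun x => f x y)).
Proof.
  induction l as [|x l IH]; simpl; [rewrite rsum_const; ring|].
  rewrite IH, <- rsum_plus; trivial.
Qed.

Lemma rsum_filter {T} (l : list T) (b : T -> bool) f :
  rsum (filter b l) f = rsum l (fun x => if b x then f x else 0).
Proof.
  induction l as [|x l IH]; simpl; trivial.
  destruct (b x); simpl; rewrite IH; ring.
Qed.

Lemma rsum_incl {T} (l l' : list T) f : NoDup l -> incl l l' ->
  (forall x, In x l' -> 0 <= f x) -> rsum l f <= rsum l' f.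
Proof.
  revert l'; induction l as [|x l IH]; intros l' Hl Hi Hf; [apply rsum_nonneg; auto|].
  inversion Hl; subst.
  destruct (in_split x l') as [l1 [l2 ->]]; [apply Hi; simpl; auto|].
  rewrite rsum_app; simpl.
  assert (H : rsum l f <= rsum (l1 ++ l2) f).
  { apply IH; trivial.
    - intros y Hy; assert (Hy' := Hi y (or_intror Hy)).
      apply in_app_or in Hy'; apply in_or_app; destruct Hy' as [|[->|]]; auto; contradiction.
    - intros y Hy; apply Hf; apply in_app_or in Hy; apply in_or_app; simpl; tauto. }
  rewrite rsum_app in H; lra.
Qed.

(** The squared deviations of [f] from its mean [m] have a non-negative sum. *)
Lemma Cauchy_Schwarz_rsum {T} (l : list T) f :
  rsum l f ^ 2 <= INR (length l) * rsum l (fun x => f x ^ 2).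
Proof.
  destruct l as [|x0 l0]; [simpl; lra|]; set (l := x0 :: l0).
  assert (Hn : 0 < INR (length l)) by (apply lt_0_INR; unfold l; simpl; lia).
  set (n := INR (length l)) in *; set (m := rsum l f / n).
  assert (H : 0 <= rsum l (fun x => f x ^ 2 - 2 * m * f x + m ^ 2)).
  { apply rsum_nonneg; intros x _.
    replace (f x ^ 2 - 2 * m * f x + m ^ 2) with ((f x - m) ^ 2) by ring; apply pow2_ge_0. }
  rewrite rsum_plus, rsum_minus, rsum_scal, rsum_const in H; fold n in H.
  apply (Rmult_le_compat_l n) in H; [|lra].
  assert (E : rsum l f = n * m) by (unfold m; field; lra).
  rewrite E in *; nra.
Qed.

Lemma csum_ext {T} (l : list T) f g :
  (forall x, In x l -> f x = g x) -> csum l f = csum l g.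
Proof.
  induction l as [|x l IH]; intros H; simpl; trivial.
  rewrite (H x), IH; trivial; [intros; apply H|]; simpl; auto.
Qed.

Lemma csum_plus {T} (l : list T) f g :
  csum l (fun x => (f x + g x)%C) = (csum l f + csum l g)%C.
Proof. induction l as [|x l IH]; simpl; [|rewrite IH]; ring. Qed.

Lemma csum_scal {T} (l : list T) c f : csum l (fun x => (c * f x)%C) = (c * csum l f)%C.
Proof. induction l as [|x l IH]; simpl; [|rewrite IH]; ring. Qed.

Lemma csum_app {T} (l l' : list T) f : csum (l ++ l') f = (csum l f + csum l' f)%C.
Proof. induction l as [|x l IH]; simpl; [|rewrite IH]; ring. Qed.

Lemma csum_map {S T} (h : S -> T) (l : list S) f :
  csum (map h l) f = csum l (fun x => f (h x)).
Proof. induction l as [|x l IH]; simpl; [|rewrite IH]; trivial. Qed.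

Lemma csum_perm {T} (l l' : list T) f : Permutation l l' -> csum l f = csum l' f.
Proof. induction 1; simpl; trivial; [congruence|ring|congruence]. Qed.

Lemma csum_filter {T} (l : list T) (b : T -> bool) f :
  csum (filter b l) f = csum l (fun x => if b x then f x else RtoC 0).
Proof.
  induction l as [|x l IH]; simpl; trivial.
  destruct (b x); simpl; rewrite IH; ring.
Qed.

Lemma csum_RtoC {T} (l : list T) f : csum l (fun x => RtoC (f x)) = RtoC (rsum l f).
Proof. induction l as [|x l IH]; simpl; trivial. rewrite IH, <- RtoC_plus; trivial. Qed.

Lemma csum_0 {T} (l : list T) : csum l (fun _ => RtoC 0) = RtoC 0.
Proof. rewrite csum_RtoC, rsum_const; f_equal; ring. Qed.

Lemma csum_1 {T} (l : list T) : csum l (fun _ => RtoC 1) = RtoC (INR (length l)).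
Proof. rewrite csum_RtoC, rsum_const; f_equal; ring. Qed.

Lemma csum_swap {S T} (l : list S) (l' : list T) (f : S -> T -> C) :
  csum l (fun x => csum l' (f x)) = csum l' (fun y => csum l (fun x => f x y)).
Proof.
  induction l as [|x l IH]; simpl; [rewrite csum_0; ring|].
  rewrite IH, <- csum_plus; trivial.
Qed.

Lemma csum_conj {T} (l : list T) f : Cconj (csum l f) = csum l (fun x => Cconj (f x)).
Proof.
  induction l as [|x l IH]; simpl; [apply injective_projections; simpl; ring|].
  rewrite <- IH; apply injective_projections; simpl; ring.
Qed.

Lemma Cmod_csum {T} (l : list T) f : Cmod (csum l f) <= rsum l (fun x => Cmod (f x)).
Proof.
  induction l as [|x l IH]; simpl; [rewrite Cmod_0; lra|].
  eapply Rle_trans; [apply Cmod_triangle|lra].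
Qed.

Lemma Re_csum {T} (l : list T) f : Re (csum l f) = rsum l (fun x => Re (f x)).
Proof. induction l as [|x l IH]; simpl; trivial. rewrite <- IH; trivial. Qed.

Lemma Im_csum {T} (l : list T) f : Im (csum l f) = rsum l (fun x => Im (f x)).
Proof. induction l as [|x l IH]; simpl; trivial. rewrite <- IH; trivial. Qed.

Lemma Cmod_sqr (z : C) : Cmod z ^ 2 = Re z ^ 2 + Im z ^ 2.
Proof.
  unfold Cmod; rewrite <- Rsqr_pow2, Rsqr_sqrt; trivial.
  apply Rplus_le_le_0_compat; apply pow2_ge_0.
Qed.

Lemma Cmod_sqr_plus (z w : C) :
  Cmod (z + w)%C ^ 2 = Cmod z ^ 2 + Cmod w ^ 2 + 2 * Re (z * Cconj w)%C.
Proof. rewrite !Cmod_sqr; unfold Re, Im; simpl; ring. Qed.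

(** Adding a vector to [L] adds its own square, and orthogonality to each vector already present
    kills the cross term. The squared norm [d n] may vary, so that integers divisible by the
    modulus, where all characters vanish, can be given norm 0. *)
Lemma Parseval {S T} (J : list T) (L : list S) (u : S -> T -> C) (a : S -> C) (d : S -> R) :
  NoDup L ->
  (forall n n', In n L -> In n' L -> n <> n' ->
     csum J (fun j => u n j * Cconj (u n' j))%C = RtoC 0) ->
  (forall n, In n L -> csum J (fun j => u n j * Cconj (u n j))%C = RtoC (d n)) ->
  rsum J (fun j => Cmod (csum L (fun n => a n * u n j)%C) ^ 2) =
  rsum L (fun n => Cmod (a n) ^ 2 * d n).
Proof.
  intros HL H0 H1; induction L as [|n L IH].
  { simpl; rewrite Cmod_0, rsum_const; ring. }
  inversion HL as [|? ? Hn HL']; subst.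
  transitivity (rsum J (fun j => Cmod (a n * u n j)%C ^ 2)
    + rsum J (fun j => Cmod (csum L (fun n => a n * u n j)%C) ^ 2)
    + 2 * rsum J (fun j => Re (a n * u n j * Cconj (csum L (fun n => a n * u n j)))%C)).
  { rewrite <- rsum_scal, <- !rsum_plus; apply rsum_ext; intros j _; simpl csum.
    apply Cmod_sqr_plus. }
  rewrite IH; trivial.
  2:{ intros; apply H0; simpl; auto. }
  2:{ intros; apply H1; simpl; auto. }
  assert (E1 : rsum J (fun j => Cmod (a n * u n j)%C ^ 2) = Cmod (a n) ^ 2 * d n).
  { assert (E := H1 n (or_introl eq_refl)).
    apply (f_equal Re) in E; rewrite Re_csum in E; simpl in E; rewrite <- E, <- rsum_scal.
    apply rsum_ext; intros j _.
    rewrite Cmod_mult, Rpow_mult_distr; f_equal; rewrite Cmod_sqr; unfold Re, Im; simpl; ring. }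
  assert (E2 : rsum J (fun j => Re (a n * u n j * Cconj (csum L (fun n => a n * u n j)))%C) = 0).
  { rewrite <- Re_csum.
    replace (csum J (fun j => a n * u n j * Cconj (csum L (fun n => a n * u n j)))%C) with (RtoC 0);
      trivial.
    transitivity (csum J (fun j => csum L (fun n' => a n * Cconj (a n') * (u n j * Cconj (u n' j))))%C).
    - rewrite csum_swap; symmetry.
      rewrite <- (csum_0 L); apply csum_ext; intros n' Hn'.
      rewrite csum_scal, H0; simpl; auto; [ring|intros ->; contradiction].
    - apply csum_ext; intros j _; rewrite csum_conj, <- csum_scal; apply csum_ext; intros n' _.
      rewrite Cmult_conj; ring. }
  rewrite E1, E2; simpl; ring.
Qed.

(** * Points of the unit circle and sums of roots of unity *)

Definition ce (x : R) : C := (cos (2 * PI * x), sin (2 * PI * x)).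

Lemma ce_plus x y : ce (x + y) = (ce x * ce y)%C.
Proof.
  unfold ce; rewrite Rmult_plus_distr_l, cos_plus, sin_plus.
  apply injective_projections; simpl; ring.
Qed.

Lemma ce_0 : ce 0 = RtoC 1.
Proof. unfold ce; rewrite Rmult_0_r, cos_0, sin_0; trivial. Qed.

Lemma ce_opp x : ce (- x) = Cconj (ce x).
Proof.
  unfold ce, Cconj; replace (2 * PI * - x) with (- (2 * PI * x)) by ring.
  rewrite cos_neg, sin_neg; trivial.
Qed.

Lemma Cmod_ce x : Cmod (ce x) = 1.
Proof.
  unfold Cmod, ce; simpl fst; simpl snd; rewrite <- sqrt_1; f_equal.
  rewrite <- (sin2_cos2 (2 * PI * x)); unfold Rsqr; ring.
Qed.

Lemma ce_INR n : ce (INR n) = RtoC 1.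
Proof.
  induction n as [|n IH]; [apply ce_0|].
  rewrite S_INR, ce_plus, IH; unfold ce; rewrite Rmult_1_r, cos_2PI, sin_2PI.
  apply injective_projections; simpl; ring.
Qed.

Lemma ce_IZR n : ce (IZR n) = RtoC 1.
Proof.
  destruct (Z_le_dec 0 n).
  - rewrite <- (Z2Nat.id n), <- INR_IZR_INZ by lia; apply ce_INR.
  - replace (IZR n) with (- INR (Z.to_nat (- n))).
    + rewrite ce_opp, ce_INR; apply injective_projections; simpl; ring.
    + rewrite INR_IZR_INZ, Z2Nat.id, <- opp_IZR by lia; f_equal; lia.
Qed.

Lemma ce_pow x n : Cpow (ce x) n = ce (INR n * x).
Proof.
  induction n as [|n IH]; simpl Cpow.
  - simpl; rewrite Rmult_0_l, ce_0; trivial.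
  - rewrite IH, S_INR, Rmult_plus_distr_r, Rplus_comm, ce_plus, Rmult_1_l; trivial.
Qed.

Lemma ce_eq_1 x : ce x = RtoC 1 -> exists n : Z, x = IZR n.
Proof.
  intros H; injection H; intros Hs Hc.
  destruct (sin_eq_0_0 (PI * x)) as [k Hk].
  { replace (2 * PI * x) with (2 * (PI * x)) in Hc by ring.
    rewrite cos_2a_sin in Hc; nra. }
  exists k; assert (HP := PI_RGT_0); apply (Rmult_eq_reg_l PI); lra.
Qed.

Lemma ce_surj (z : C) : Cmod z = 1 -> exists x, 0 <= x < 1 /\ z = ce x.
Proof.
  intros H; assert (HP := PI_RGT_0); destruct z as [a b].
  assert (Hab : a ^ 2 + b ^ 2 = 1).
  { change (a ^ 2 + b ^ 2) with (Re (a, b) ^ 2 + Im (a, b) ^ 2).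
    rewrite <- Cmod_sqr, H; ring. }
  assert (Ha : -1 <= a <= 1) by nra.
  assert (Hac := acos_bound a).
  assert (Hs : sin (acos a) = Rabs b).
  { rewrite sin_acos by trivial.
    replace (1 - a²) with (b²) by (unfold Rsqr; lra). apply sqrt_Rsqr_abs. }
  destruct (Rle_lt_dec 0 b) as [Hb|Hb].
  - exists (acos a / (2 * PI)); split.
    + split; [apply Rdiv_le_0_compat; lra|].
      apply (Rmult_lt_reg_r (2 * PI)); [lra|]; field_simplify; lra.
    + unfold ce; replace (2 * PI * (acos a / (2 * PI))) with (acos a) by (field; lra).
      rewrite cos_acos, Hs, Rabs_pos_eq; trivial.
  (* Below the real axis the angle is reflected; [acos a] is nonzero there, which keeps the
     parameter strictly below 1. *)
  - assert (Hne : acos a <> 0).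
    { assert (0 < Rabs b) by (apply Rabs_pos_lt; lra); intros E; rewrite E, sin_0 in Hs; lra. }
    exists (1 - acos a / (2 * PI)); split.
    + assert (0 < acos a / (2 * PI)) by (apply Rdiv_lt_0_compat; lra).
      assert (acos a / (2 * PI) <= 1).
      { apply (Rmult_le_reg_r (2 * PI)); [lra|]; field_simplify; lra. }
      lra.
    + unfold ce; replace (2 * PI * (1 - acos a / (2 * PI))) with (- acos a + 2 * PI) by (field; lra).
      rewrite cos_plus, sin_plus, cos_2PI, sin_2PI, cos_neg, sin_neg, cos_acos, Hs, Rabs_left; trivial.
      apply injective_projections; simpl; ring.
Qed.

Lemma geometric_Csum (w : C) (n : nat) :
  ((1 - w) * csum (seq 0 n) (fun k => Cpow w k) = 1 - Cpow w n)%C.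
Proof.
  induction n as [|n IH]; [simpl; ring|].
  rewrite seq_S, csum_app, Cmult_plus_distr_l, IH; simpl; ring.
Qed.

(** A geometric sum whose ratio is an [m]-th root of unity other than 1. *)
Lemma csum_ce_0 (m : nat) (a : Z) : (0 < m)%nat -> ~ (Z.of_nat m | a)%Z ->
  csum (seq 0 m) (fun k => ce (INR k * (IZR a / INR m))) = RtoC 0.
Proof.
  intros Hm Ha.
  assert (Hm' : 0 < INR m) by (apply lt_0_INR; trivial).
  set (w := ce (IZR a / INR m)).
  assert (H := geometric_Csum w m).
  replace (Cpow w m) with (RtoC 1) in H.
  2:{ unfold w; rewrite ce_pow.
      replace (INR m * (IZR a / INR m)) with (IZR a) by (field; lra); rewrite ce_IZR; trivial. }
  rewrite (csum_ext _ _ (fun k => Cpow w k)) by (intros; unfold w; rewrite ce_pow; trivial).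
  assert (Hw : (1 - w)%C <> RtoC 0).
  { intros E; apply Ha.
    destruct (ce_eq_1 (IZR a / INR m)) as [n Hn].
    - fold w; replace w with (1 - (1 - w))%C by ring; rewrite E; ring.
    - exists n; apply eq_IZR; rewrite mult_IZR, <- INR_IZR_INZ, <- Hn; field; lra. }
  replace (csum _ _) with (/ (1 - w) * ((1 - w) * csum (seq 0 m) (fun k => Cpow w k)))%C
    by (field; trivial).
  rewrite H; ring.
Qed.

(** * Characters modulo a prime *)

(** The primitive root transported to the integers. Residues may be negative, so [a] is first
    reduced modulo [q]; exponents are first reduced modulo [q - 1] by Fermat's theorem, and then
    injectivity on small exponents applies. *)
Lemma discrete_log (q : nat) : prime (Z.of_nat q) ->
  exists (g : Z) (ind : Z -> nat),
    ~ (Z.of_nat q | g)%Z /\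
    (forall a, ~ (Z.of_nat q | a)%Z -> (ind a < q - 1)%nat /\ (Z.of_nat q | g ^ Z.of_nat (ind a) - a)%Z) /\
    (forall i j : nat, (Z.of_nat q | g ^ Z.of_nat i - g ^ Z.of_nat j)%Z -> (i mod (q - 1) = j mod (q - 1))%nat) /\
    (Z.of_nat q | g ^ Z.of_nat (q - 1) - 1)%Z.
Proof.
  intros Hq; assert (Hq2 := prime_ge_2 _ Hq).
  destruct (PrimeFieldUnits.primitive_root q Hq) as [g [Hs [Hi Hf]]].
  assert (Hz : forall a b : nat, (Nat.modulo a q = Nat.modulo b q)%nat <->
                (Z.of_nat q | Z.of_nat a - Z.of_nat b)%Z).
  { intros a b; split.
    - intros H; exists (Z.of_nat (a / q) - Z.of_nat (b / q))%Z.
      assert (Ha := Nat.div_mod_eq a q); assert (Hb := Nat.div_mod_eq b q); nia.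
    - intros [k Hk].
      apply Nat2Z.inj; rewrite !Nat2Z.inj_mod.
      replace (Z.of_nat a) with (Z.of_nat b + k * Z.of_nat q)%Z by lia.
      apply Z.mod_add; lia. }
  assert (Hpz : forall i, Z.of_nat (g ^ i) = (Z.of_nat g ^ Z.of_nat i)%Z)
    by (intros; apply Nat2Z.inj_pow).
  assert (Hs' : forall a, ~ (Z.of_nat q | a)%Z ->
    exists k, (k < q - 1)%nat /\ (Z.of_nat q | Z.of_nat g ^ Z.of_nat k - a)%Z).
  { intros a Ha; set (b := Z.to_nat (a mod Z.of_nat q)).
    assert (Hb : Z.of_nat b = (a mod Z.of_nat q)%Z).
    { unfold b; rewrite Z2Nat.id; trivial; apply Z.mod_pos_bound; lia. }
    assert (Hdm := Z.div_mod a (Z.of_nat q) ltac:(lia)).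
    destruct (Hs b) as [k [Hk Hk2]].
    { intros [c Hc]; apply Ha; exists (Z.of_nat c + a / Z.of_nat q)%Z; nia. }
    exists k; split; trivial; apply Hz in Hk2; rewrite Hpz in Hk2; destruct Hk2 as [c Hc].
    exists (c - a / Z.of_nat q)%Z; nia. }
  assert (Hg : ~ (Z.of_nat q | Z.of_nat g)%Z).
  { intros Hg; apply Hz in Hf; rewrite Hpz in Hf.
    assert (H1 : (Z.of_nat q | Z.of_nat g ^ Z.of_nat (q - 1))%Z).
    { replace (Z.of_nat (q - 1)) with (Z.succ (Z.of_nat (q - 2))) by lia.
      rewrite Z.pow_succ_r by lia; apply Z.divide_mul_l; trivial. }
    assert (H2 := Z.divide_sub_r _ _ _ H1 Hf).
    rewrite Z.sub_sub_distr, Z.sub_diag in H2.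
    apply Z.divide_pos_le in H2; lia. }
  assert (Hf' : (Z.of_nat q | Z.of_nat g ^ Z.of_nat (q - 1) - 1)%Z).
  { apply Hz in Hf; rewrite Hpz in Hf; exact Hf. }
  assert (Hred : forall i, (Z.of_nat q | Z.of_nat g ^ Z.of_nat i - Z.of_nat g ^ Z.of_nat (i mod (q - 1)))%Z).
  { intros i; assert (Hdm := Nat.div_mod_eq i (q - 1)).
    set (r := (i mod (q - 1))%nat) in *; set (t := (i / (q - 1))%nat) in *; rewrite Hdm; clearbody r t; clear Hdm.
    replace (Z.of_nat ((q - 1) * t + r)) with (Z.of_nat (q - 1) * Z.of_nat t + Z.of_nat r)%Z by lia.
    rewrite Z.pow_add_r, Z.pow_mul_r by nia.
    set (G := (Z.of_nat g ^ Z.of_nat (q - 1))%Z) in *.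
    assert (Ht : (Z.of_nat q | G ^ Z.of_nat t - 1)%Z).
    { induction t as [|t IH]; [exists 0%Z; simpl; lia|].
      rewrite Nat2Z.inj_succ, Z.pow_succ_r by lia.
      destruct IH as [c Hc]; destruct Hf' as [c' Hc']; exists (G * c + c')%Z; nia. }
    destruct Ht as [c Hc]; exists (c * Z.of_nat g ^ Z.of_nat r)%Z; nia. }
  set (P := fun a k => ~ (Z.of_nat q | a)%Z -> (k < q - 1)%nat /\ (Z.of_nat q | Z.of_nat g ^ Z.of_nat k - a)%Z).
  exists (Z.of_nat g), (fun a => epsilon (inhabits 0%nat) (P a)); repeat split; trivial.
  - apply (epsilon_spec (inhabits 0%nat) (P a)); trivial.
    destruct (Hs' a H) as [k Hk]; exists k; intros _; exact Hk.
  - apply (epsilon_spec (inhabits 0%nat) (P a)); trivial.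
    destruct (Hs' a H) as [k Hk]; exists k; intros _; exact Hk.
  - intros i j Hij; apply Hi; try (apply Nat.mod_upper_bound; lia).
    apply Hz; rewrite !Hpz.
    assert (H1 := Hred i); assert (H2 := Hred j).
    destruct Hij as [a Ha], H1 as [b Hb], H2 as [c Hc]; exists (a - b + c)%Z; lia.
Qed.

Lemma dirichlet_character_cong (q : nat) chi a b : dirichlet_character q chi ->
  (Z.of_nat q | a - b)%Z -> chi a = chi b.
Proof.
  intros [_ [Hp _]] [k Hk].
  assert (H : forall (n : nat) c, chi (c + Z.of_nat n * Z.of_nat q)%Z = chi c).
  { induction n as [|n IH]; intros c; [f_equal; lia|].
    rewrite <- (IH c), <- (Hp (c + Z.of_nat n * Z.of_nat q)%Z); f_equal; lia. }
  destruct (Z_le_dec 0 k).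
  - rewrite <- (H (Z.to_nat k) b); f_equal; rewrite Z2Nat.id; lia.
  - rewrite <- (H (Z.to_nat (- k)) a); f_equal; rewrite Z2Nat.id; lia.
Qed.

Lemma dirichlet_character_1 (q : nat) chi : dirichlet_character q chi -> chi 1%Z = RtoC 1.
Proof.
  intros [Hm [_ Hn]].
  assert (H1 : chi 1%Z <> RtoC 0) by (apply Hn, rel_prime_1).
  assert (H := Hm 1%Z 1%Z); rewrite Z.mul_1_r in H.
  replace (chi 1%Z) with (/ chi 1%Z * (chi 1%Z * chi 1%Z))%C by (field; trivial).
  rewrite <- H; field; trivial.
Qed.

Lemma dirichlet_character_pow (q : nat) chi a n : dirichlet_character q chi ->
  chi (a ^ Z.of_nat n)%Z = Cpow (chi a) n.
Proof.
  intros H; induction n as [|n IH]; [exact (dirichlet_character_1 q chi H)|].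
  rewrite Nat2Z.inj_succ, Z.pow_succ_r by lia.
  destruct H as [Hm _]; rewrite Hm, IH; trivial.
Qed.

Lemma rel_prime_prime (q : nat) a : prime (Z.of_nat q) ->
  rel_prime a (Z.of_nat q) <-> ~ (Z.of_nat q | a)%Z.
Proof.
  intros Hq; split.
  - intros H Hd; assert (H2 := prime_ge_2 _ Hq).
    destruct H as [_ _ H]; specialize (H _ Hd (Z.divide_refl _)).
    apply Z.divide_pos_le in H; lia.
  - intros H; apply rel_prime_sym, prime_rel_prime; trivial.
Qed.

(** The group is cyclic, so the characters are [a |-> ce (k * ind a / (q - 1))] for [k < q - 1].
    Index 0 is the principal character, and because [q] is prime the remaining ones are exactly the
    primitive ones. *)
Lemma characters_mod_prime (q : nat) : prime (Z.of_nat q) ->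
  exists chi : nat -> Z -> C,
    (forall k, dirichlet_character q (chi k)) /\
    (forall k a, ~ (Z.of_nat q | a)%Z -> Cmod (chi k a) = 1) /\
    (forall a, ~ (Z.of_nat q | a)%Z -> chi 0%nat a = RtoC 1) /\
    (forall a b, ~ (Z.of_nat q | a)%Z -> ~ (Z.of_nat q | b)%Z ->
       csum (seq 0 (q - 1)) (fun k => chi k a * Cconj (chi k b))%C =
       if Zdivide_dec (Z.of_nat q) (a - b) then RtoC (INR (q - 1)) else RtoC 0) /\
    (forall k, (1 <= k < q - 1)%nat ->
       csum (seq 0 q) (fun n => chi k (Z.of_nat n)) = RtoC 0) /\
    enumerates (X q) (map chi (seq 1 (q - 2))).
Proof.
  intros Hq; assert (Hq2 := prime_ge_2 _ Hq).
  destruct (discrete_log q Hq) as [g [ind [Hg [Hind [Hinj Hf]]]]].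
  set (N := INR (q - 1)).
  assert (HN : 0 < N) by (apply lt_0_INR; lia).
  set (chi := fun k a => if Zdivide_dec (Z.of_nat q) a then RtoC 0 else ce (INR k * (INR (ind a) / N))).
  assert (Hmod : forall k i j, (i mod (q - 1) = j mod (q - 1))%nat ->
    ce (INR k * (INR i / N)) = ce (INR k * (INR j / N))).
  { assert (H : forall k i, ce (INR k * (INR i / N)) = ce (INR k * (INR (i mod (q - 1)) / N))).
    { intros k i; rewrite (Nat.div_mod_eq i (q - 1)) at 1.
      rewrite plus_INR, mult_INR; fold N.
      replace (INR k * ((N * INR (i / (q - 1)) + INR (i mod (q - 1))) / N))
        with (INR (k * (i / (q - 1))) + INR k * (INR (i mod (q - 1)) / N))
        by (rewrite mult_INR; field; lra).
      rewrite ce_plus, ce_INR; ring. }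
    intros k i j E; rewrite H, (H k j), E; trivial. }
  assert (Hnd : forall a, rel_prime a (Z.of_nat q) <-> ~ (Z.of_nat q | a)%Z)
    by (intros; apply rel_prime_prime; trivial).
  assert (Hpow : forall k i, chi k (g ^ Z.of_nat i)%Z = ce (INR k * (INR i / N))).
  { intros k i; unfold chi; destruct (Zdivide_dec _ _) as [Hd|Hd].
    - exfalso; revert Hd; induction i as [|i IH].
      + simpl; intros H; apply Z.divide_pos_le in H; lia.
      + rewrite Nat2Z.inj_succ, Z.pow_succ_r by lia; intros H.
        apply prime_mult in H; trivial; tauto.
    - apply Hmod, Hinj, Hind; trivial. }
  assert (Hcong : forall k a b, (Z.of_nat q | a - b)%Z -> chi k a = chi k b).
  { intros k a b Hab; unfold chi; destruct (Zdivide_dec _ a) as [Ha|Ha], (Zdivide_dec _ b) as [Hb|Hb]; trivial.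
    - exfalso; apply Hb; replace b with (a - (a - b))%Z by lia; apply Z.divide_sub_r; trivial.
    - exfalso; apply Ha; replace a with (b + (a - b))%Z by lia; apply Z.divide_add_r; trivial.
    - apply Hmod, Hinj.
      destruct (Hind a Ha) as [_ [c1 H1]], (Hind b Hb) as [_ [c2 H2]], Hab as [c3 H3].
      exists (c1 - c2 + c3)%Z; lia. }
  assert (Hchar : forall k, dirichlet_character q (chi k)).
  { intros k; split; [|split].
    - intros a b; destruct (Zdivide_dec (Z.of_nat q) a) as [Ha|Ha];
        [|destruct (Zdivide_dec (Z.of_nat q) b) as [Hb|Hb]].
      + unfold chi; destruct (Zdivide_dec (Z.of_nat q) a); [|contradiction].
        destruct (Zdivide_dec _ _) as [_|H]; [ring|exfalso; apply H, Z.divide_mul_l; trivial].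
      + unfold chi; destruct (Zdivide_dec (Z.of_nat q) b); [|contradiction].
        destruct (Zdivide_dec _ (a * b)) as [_|H]; [ring|exfalso; apply H, Z.divide_mul_r; trivial].
      + destruct (Hind a Ha) as [_ [c1 H1]], (Hind b Hb) as [_ [c2 H2]].
        rewrite <- (Hcong k (g ^ Z.of_nat (ind a + ind b))%Z (a * b)%Z).
        2:{ rewrite Nat2Z.inj_add, Z.pow_add_r by lia.
            exists (c1 * g ^ Z.of_nat (ind b) + a * c2)%Z; nia. }
        rewrite Hpow, plus_INR; unfold chi.
        destruct (Zdivide_dec _ a); [contradiction|]; destruct (Zdivide_dec _ b); [contradiction|].
        rewrite <- ce_plus; f_equal; field; lra.
    - intros a; apply Hcong; exists 1%Z; lia.
    - intros a; rewrite Hnd; unfold chi; destruct (Zdivide_dec _ _) as [Ha|Ha]; [tauto|].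
      split; trivial; intros _ E; assert (H := Cmod_ce (INR k * (INR (ind a) / N))).
      rewrite E, Cmod_0 in H; lra. }
  assert (Hone : forall a, ~ (Z.of_nat q | a)%Z -> chi 0%nat a = RtoC 1).
  { intros a Ha; unfold chi; destruct (Zdivide_dec _ _); [contradiction|].
    simpl; rewrite Rmult_0_l; apply ce_0. }
  assert (Hval : forall k a, ~ (Z.of_nat q | a)%Z -> chi k a = ce (INR k * (INR (ind a) / N))).
  { intros k a Ha; unfold chi; destruct (Zdivide_dec _ _); [contradiction|trivial]. }
  exists chi; split; [|split; [|split; [|split; [|split]]]]; trivial.
  - intros k a Ha; rewrite Hval by trivial; apply Cmod_ce.
  - intros a b Ha Hb.
    rewrite (csum_ext _ _ (fun k => ce (INR k * (IZR (Z.of_nat (ind a) - Z.of_nat (ind b)) / INR (q - 1))))).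
    2:{ intros k _; rewrite !Hval, <- ce_opp, <- ce_plus by trivial; fold N.
        rewrite minus_IZR, <- !INR_IZR_INZ; f_equal; field; lra. }
    destruct (Zdivide_dec _ _) as [Hab|Hab].
    + rewrite (csum_ext _ _ (fun _ => RtoC 1)); [rewrite csum_1, length_seq; trivial|].
      assert (E : ind a = ind b).
      { destruct (Hind a Ha) as [Hla [c1 H1]], (Hind b Hb) as [Hlb [c2 H2]], Hab as [c3 H3].
        rewrite <- (Nat.mod_small (ind a) (q - 1)), <- (Nat.mod_small (ind b) (q - 1)) by trivial.
        apply Hinj; exists (c1 - c2 + c3)%Z; lia. }
      intros k _; rewrite E, Z.sub_diag; unfold Rdiv; rewrite Rmult_0_l, Rmult_0_r; apply ce_0.
    + apply csum_ce_0; [lia|].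
      intros [c Hc]; apply Hab.
      destruct (Hind a Ha) as [Hla [c1 H1]], (Hind b Hb) as [Hlb [c2 H2]].
      assert (Hc' : (- Z.of_nat (q - 1) < c * Z.of_nat (q - 1) < Z.of_nat (q - 1))%Z) by lia.
      assert (c = 0)%Z by nia; subst c.
      assert (E : ind a = ind b) by lia.
      rewrite E in H1; exists (c2 - c1)%Z; lia.
  - intros k Hk.
    replace (seq 0 q) with (0%nat :: seq 1 (q - 1)) by (replace q with (S (q - 1)) at 2 by lia; trivial).
    simpl csum.
    assert (Hs : forall n, In n (seq 1 (q - 1)) -> ~ (Z.of_nat q | Z.of_nat n)%Z).
    { intros n Hn Hd; apply in_seq in Hn; apply Z.divide_pos_le in Hd; lia. }
    (* On the nonzero residues [ind] takes each exponent below [q - 1] once, so the sum becomes a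
       complete sum of roots of unity. *)
    rewrite (csum_ext (seq 1 (q - 1)) _ (fun n => ce (INR (ind (Z.of_nat n)) * (IZR (Z.of_nat k) / INR (q - 1))))).
    2:{ intros n Hn; rewrite Hval, <- INR_IZR_INZ by auto; fold N; f_equal; field; lra. }
    rewrite <- (csum_map (fun n => ind (Z.of_nat n)) _ (fun j => ce (INR j * (IZR (Z.of_nat k) / INR (q - 1))))).
    rewrite (csum_perm _ (seq 0 (q - 1))).
    + rewrite csum_ce_0; [|lia|intros Hd; apply Z.divide_pos_le in Hd; lia].
      unfold chi; destruct (Zdivide_dec _ _) as [_|H]; [ring|exfalso; apply H, Z.divide_0_r].
    + apply NoDup_Permutation_bis.
      * apply NoDup_map_NoDup_ForallPairs; [|apply seq_NoDup].
        intros n n' Hn Hn' E.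
        destruct (Hind _ (Hs n Hn)) as [_ [c1 H1]], (Hind _ (Hs n' Hn')) as [_ [c2 H2]].
        rewrite E in H1; apply in_seq in Hn; apply in_seq in Hn'.
        assert (H3 : (Z.of_nat n - Z.of_nat n' = (c2 - c1) * Z.of_nat q)%Z) by lia.
        assert (H4 : (- Z.of_nat q < (c2 - c1) * Z.of_nat q < Z.of_nat q)%Z) by lia.
        assert (c2 - c1 = 0)%Z by nia; lia.
      * rewrite length_map, !length_seq; lia.
      * intros j Hj; apply in_map_iff in Hj; destruct Hj as [n [<- Hn]].
        apply in_seq; destruct (Hind _ (Hs n Hn)); lia.
  - assert (Hg1 : forall k, chi k g = ce (INR k / N)).
    { intros k; transitivity (chi k (g ^ Z.of_nat 1)%Z); [f_equal; simpl; lia|].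
      rewrite Hpow; simpl; f_equal; field; lra. }
    assert (Hlt : forall k k', (k < q - 1)%nat -> (k' < q - 1)%nat -> chi k g = chi k' g -> k = k').
    { intros k k' Hk Hk' E; rewrite !Hg1 in E.
      destruct (ce_eq_1 (INR k / N - INR k' / N)) as [z Hz].
      - unfold Rminus; rewrite ce_plus, ce_opp, E, <- Cmod2_conj, Cmod_ce, RtoC_pow; f_equal; ring.
      - assert (Hz' : INR k - INR k' = IZR z * N) by (rewrite <- Hz; field; lra).
        unfold N in Hz'; rewrite !INR_IZR_INZ, <- minus_IZR, <- mult_IZR in Hz'; apply eq_IZR in Hz'.
        assert (- Z.of_nat (q - 1) < z * Z.of_nat (q - 1) < Z.of_nat (q - 1))%Z by lia.
        assert (z = 0)%Z by nia; lia. }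
    split.
    + apply NoDup_map_NoDup_ForallPairs; [|apply seq_NoDup].
      intros k k' Hk Hk' E; apply in_seq in Hk; apply in_seq in Hk'.
      apply Hlt; [lia|lia|rewrite E; trivial].
    + intros psi; rewrite in_map_iff; split.
      * intros [k [<- Hk]]; apply in_seq in Hk; split; trivial; split.
        { split; [apply Nat.divide_refl|exists (chi k); auto]. }
        intros d [Hd [psi [Hpsi E]]].
        assert (Hd' : d = 1%nat \/ d = q).
        { assert (H : (Z.of_nat d | Z.of_nat q)%Z) by (destruct Hd as [c Hc]; exists (Z.of_nat c); lia).
          apply prime_divisors in H; trivial; lia. }
        destruct Hd' as [Hd'|Hd']; subst d; [exfalso|lia].
        (* A character induced from modulus 1 would be 1 at [g], which the values at [g] allow only
           for index 0. *)
        assert (E1 : chi k g = chi 0%nat g).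
        { rewrite E by (apply Hnd; trivial); rewrite Hone by trivial.
          rewrite (dirichlet_character_cong 1 psi g 1 Hpsi) by (exists (g - 1)%Z; lia).
          apply (dirichlet_character_1 1); trivial. }
        apply Hlt in E1; lia.
      * intros [Hpsi Hcond].
        (* Conversely, a character is determined by its value at [g]. This value is a root of unity
           [ce x] of order dividing [q - 1], and [N * x] is the index sought. *)
        assert (Hp1 : Cpow (psi g) (q - 1) = RtoC 1).
        { rewrite <- (dirichlet_character_pow q) by trivial.
          rewrite (dirichlet_character_cong q psi _ 1 Hpsi Hf); apply (dirichlet_character_1 q); trivial. }
        assert (Hm1 : Cmod (psi g) = 1).
        { assert (H := f_equal Cmod Hp1); rewrite Cmod_pow, Cmod_1 in H.
          assert (H0 := Cmod_ge_0 (psi g)).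
          destruct (Rtotal_order (Cmod (psi g)) 1) as [Hl|[Hl|Hl]]; trivial; exfalso.
          - assert (Hp := pow_lt_1_compat (Cmod (psi g)) (q - 1) (conj H0 Hl) ltac:(lia)); lra.
          - assert (Hp := Rlt_pow_R1 (Cmod (psi g)) (q - 1) Hl ltac:(lia)); lra. }
        destruct (ce_surj _ Hm1) as [x [Hx Ex]].
        assert (HNx : exists z, N * x = IZR z).
        { apply ce_eq_1; unfold N; rewrite <- ce_pow, <- Ex; trivial. }
        destruct HNx as [z Hz].
        assert (Hzb : (0 <= z < Z.of_nat (q - 1))%Z).
        { split; [apply le_IZR|apply lt_IZR]; rewrite <- Hz; try rewrite <- INR_IZR_INZ; fold N; nra. }
        set (k := Z.to_nat z).
        assert (Hk : psi = chi k).
        { apply functional_extensionality; intros a; destruct (Zdivide_dec (Z.of_nat q) a) as [Ha|Ha].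
          - unfold chi; destruct (Zdivide_dec _ _); [|contradiction].
            destruct (excluded_middle_informative (psi a = RtoC 0)) as [E|E]; trivial.
            destruct Hpsi as [_ [_ Hpsi]]; apply Hpsi, Hnd in E; contradiction.
          - rewrite Hval by trivial; destruct (Hind a Ha) as [_ H].
            rewrite <- (dirichlet_character_cong q psi _ a Hpsi H), (dirichlet_character_pow q), Ex, ce_pow by trivial.
            f_equal; unfold k; rewrite (INR_IZR_INZ (Z.to_nat z)), Z2Nat.id, <- Hz by lia; field; lra. }
        exists k; split; [congruence|]; apply in_seq.
        (* Index 0 would make [psi] principal, hence induced from modulus 1, against its conductor
           being [q]. *)
        destruct (Nat.eq_dec k 0) as [E|E]; [exfalso|unfold k in *; lia].
        destruct Hcond as [_ Hcond].
        assert (H : (q <= 1)%nat); [apply Hcond|lia].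
        split; [exists q; lia|exists (fun _ => RtoC 1); split].
        { split; [intros; ring|split; trivial]. intros a; split; intros _.
          - apply rel_prime_sym, rel_prime_1.
          - intros E1; injection E1; lra. }
        intros a Ha; rewrite Hk, E; apply Hone, Hnd; trivial.
Qed.

(** [enum] is a choice among enumerations; the explicit list of characters shows that there is one
    to choose. *)
Lemma X_enumerates (q : nat) : prime (Z.of_nat q) -> enumerates (X q) (enum (X q)).
Proof.
  intros Hq; destruct (characters_mod_prime q Hq) as [chi [_ [_ [_ [_ [_ H]]]]]].
  unfold enum; apply epsilon_spec; eexists; exact H.
Qed.

Lemma enumerates_perm {T} (A : T -> Prop) l l' :
  enumerates A l -> enumerates A l' -> Permutation l l'.
Proof.
  intros [H1 H2] [H3 H4]; apply NoDup_Permutation; trivial.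
  intros x; rewrite H2, H4; tauto.
Qed.

Lemma X_length (q : nat) : prime (Z.of_nat q) -> length (enum (X q)) = (q - 2)%nat.
Proof.
  intros Hq; destruct (characters_mod_prime q Hq) as [chi [_ [_ [_ [_ [_ H]]]]]].
  rewrite (Permutation_length (enumerates_perm _ _ _ (X_enumerates q Hq) H)).
  rewrite length_map, length_seq; trivial.
Qed.

Lemma X_Cmod_1 (q : nat) chi a : prime (Z.of_nat q) -> X q chi ->
  ~ (Z.of_nat q | a)%Z -> Cmod (chi a) = 1.
Proof.
  intros Hq HX Ha; destruct (characters_mod_prime q Hq) as [c [_ [H1 [_ [_ [_ [_ H]]]]]]].
  apply H, in_map_iff in HX; destruct HX as [k [<- _]]; auto.
Qed.

Lemma X_zero (q : nat) chi a : prime (Z.of_nat q) -> X q chi ->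
  (Z.of_nat q | a)%Z -> chi a = RtoC 0.
Proof.
  intros Hq [[_ [_ H]] _] Ha.
  destruct (excluded_middle_informative (chi a = RtoC 0)) as [E|E]; trivial.
  apply H, (rel_prime_prime q) in E; trivial; contradiction.
Qed.

Lemma X_Cmod_le (q : nat) chi a : prime (Z.of_nat q) -> X q chi -> Cmod (chi a) <= 1.
Proof.
  intros Hq HX; destruct (Zdivide_dec (Z.of_nat q) a) as [Ha|Ha].
  - rewrite (X_zero q), Cmod_0 by trivial; lra.
  - rewrite (X_Cmod_1 q) by trivial; lra.
Qed.

(** Moving the window by one step drops [chi N] and gains [chi (N + q)], the same value. *)
Lemma X_period (q : nat) chi N : prime (Z.of_nat q) -> X q chi ->
  csum (seq N q) (fun n => chi (Z.of_nat n)) = RtoC 0.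
Proof.
  intros Hq HX; destruct (characters_mod_prime q Hq) as [c [_ [_ [_ [_ [H0 [_ H]]]]]]].
  induction N as [|N IH].
  - apply H, in_map_iff in HX; destruct HX as [k [<- Hk]]; apply in_seq in Hk; apply H0; lia.
  - assert (E : csum (seq N (S q)) (fun n => chi (Z.of_nat n)) =
                (csum (seq N q) (fun n => chi (Z.of_nat n)) + chi (Z.of_nat N))%C).
    { rewrite seq_S, csum_app; simpl; f_equal.
      destruct HX as [[_ [Hp _]] _]; rewrite <- (Hp (Z.of_nat N)), Nat2Z.inj_add; ring. }
    rewrite IH in E; simpl in E.
    replace (csum _ _) with ((chi (Z.of_nat N) + csum (seq (S N) q) (fun n => chi (Z.of_nat n))) - chi (Z.of_nat N))%C by ring.
    rewrite E; ring.
Qed.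

(** Orthogonality holds for the whole group of characters, while [X q] omits the principal one; its
    contribution is therefore kept as a separate term. The integers in [L] must be incongruent
    because characters cannot separate congruent ones. *)
Lemma X_Parseval_principal (q : nat) (L : list nat) (a : nat -> C) :
  prime (Z.of_nat q) -> NoDup L ->
  (forall n n', In n L -> In n' L -> n <> n' -> ~ (Z.of_nat q | Z.of_nat n - Z.of_nat n')%Z) ->
  rsum (enum (X q)) (fun chi => Cmod (csum L (fun n => a n * chi (Z.of_nat n))%C) ^ 2) +
    Cmod (csum (filter (fun n => if Zdivide_dec (Z.of_nat q) (Z.of_nat n) then false else true) L) a) ^ 2
  = INR (q - 1) * rsum (filter (fun n => if Zdivide_dec (Z.of_nat q) (Z.of_nat n) then false else true) L)
                       (fun n => Cmod (a n) ^ 2).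
Proof.
  intros Hq HL Hinc; assert (H2 := prime_ge_2 _ Hq).
  destruct (characters_mod_prime q Hq) as [c [Hc [_ [H1 [Ho [_ H]]]]]].
  rewrite (rsum_perm _ _ _ (enumerates_perm _ _ _ (X_enumerates q Hq) H)), rsum_map.
  assert (Hz : forall k n, (Z.of_nat q | Z.of_nat n)%Z -> c k (Z.of_nat n) = RtoC 0).
  { intros k n Hd; destruct (Hc k) as [_ [_ Hk]].
    destruct (excluded_middle_informative (c k (Z.of_nat n) = RtoC 0)) as [E|E]; trivial.
    apply Hk, (rel_prime_prime q) in E; trivial; contradiction. }
  rewrite rsum_filter, <- rsum_scal, csum_filter.
  transitivity (rsum (seq 0 (q - 1)) (fun k => Cmod (csum L (fun n => a n * c k (Z.of_nat n))%C) ^ 2)).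
  - replace (seq 0 (q - 1)) with (0%nat :: seq 1 (q - 2)) by (replace (q - 1)%nat with (S (q - 2)) by lia; trivial).
    rewrite rsum_cons, Rplus_comm; do 3 f_equal.
    apply csum_ext; intros n _; destruct (Zdivide_dec _ _) as [Hd|Hd]; [rewrite Hz|rewrite H1]; trivial; ring.
  - rewrite (Parseval (seq 0 (q - 1)) L (fun n k => c k (Z.of_nat n)) a
      (fun n => if Zdivide_dec (Z.of_nat q) (Z.of_nat n) then 0 else INR (q - 1))); trivial.
    + apply rsum_ext; intros n _; destruct (Zdivide_dec _ _); ring.
    + intros n n' Hn Hn' Hnn.
      destruct (Zdivide_dec (Z.of_nat q) (Z.of_nat n)) as [Hd|Hd].
      { rewrite <- (csum_0 (seq 0 (q - 1))); apply csum_ext; intros; rewrite (Hz _ n) by trivial; ring. }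
      destruct (Zdivide_dec (Z.of_nat q) (Z.of_nat n')) as [Hd'|Hd'].
      { rewrite <- (csum_0 (seq 0 (q - 1))); apply csum_ext; intros; rewrite (Hz _ n') by trivial.
        apply injective_projections; simpl; ring. }
      rewrite Ho by trivial; destruct (Zdivide_dec _ _) as [E|]; trivial.
      exfalso; exact (Hinc n n' Hn Hn' Hnn E).
    + intros n Hn; destruct (Zdivide_dec (Z.of_nat q) (Z.of_nat n)) as [Hd|Hd].
      { rewrite <- (csum_0 (seq 0 (q - 1))); apply csum_ext; intros; rewrite (Hz _ n) by trivial; ring. }
      rewrite Ho by trivial; destruct (Zdivide_dec _ _) as [E|E]; trivial.
      exfalso; apply E; rewrite Z.sub_diag; apply Z.divide_0_r.
Qed.

(** Dropping the principal term and restoring the multiples of [q] both go in the right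
    direction. *)
Lemma X_Bessel (q : nat) (L : list nat) (a : nat -> C) :
  prime (Z.of_nat q) -> NoDup L ->
  (forall n n', In n L -> In n' L -> n <> n' -> ~ (Z.of_nat q | Z.of_nat n - Z.of_nat n')%Z) ->
  rsum (enum (X q)) (fun chi => Cmod (csum L (fun n => a n * chi (Z.of_nat n))%C) ^ 2)
  <= INR (q - 1) * rsum L (fun n => Cmod (a n) ^ 2).
Proof.
  intros Hq HL Hinc; assert (H := X_Parseval_principal q L a Hq HL Hinc).
  assert (H' : rsum (filter (fun n => if Zdivide_dec (Z.of_nat q) (Z.of_nat n) then false else true) L)
                 (fun n => Cmod (a n) ^ 2) <= rsum L (fun n => Cmod (a n) ^ 2)).
  { rewrite rsum_filter; apply rsum_le; intros n _.
    assert (H0 := pow2_ge_0 (Cmod (a n))); destruct (Zdivide_dec _ _); lra. }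
  assert (H0 := pow2_ge_0 (Cmod (csum (filter (fun n => if Zdivide_dec (Z.of_nat q) (Z.of_nat n) then false else true) L) a))).
  assert (H1 := pos_INR (q - 1)); nra.
Qed.

Lemma X_Parseval (q : nat) (L : list nat) (a : nat -> C) :
  prime (Z.of_nat q) -> NoDup L -> (forall n, In n L -> (0 < n < q)%nat) ->
  rsum (enum (X q)) (fun chi => Cmod (csum L (fun n => a n * chi (Z.of_nat n))%C) ^ 2) +
    Cmod (csum L a) ^ 2
  = INR (q - 1) * rsum L (fun n => Cmod (a n) ^ 2).
Proof.
  intros Hq HL Hb.
  assert (E : filter (fun n => if Zdivide_dec (Z.of_nat q) (Z.of_nat n) then false else true) L = L).
  { apply forallb_filter_id, forallb_forall; intros n Hn; specialize (Hb n Hn).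
    destruct (Zdivide_dec _ _) as [Hd|]; trivial; apply Z.divide_pos_le in Hd; lia. }
  assert (H := X_Parseval_principal q L a Hq HL); rewrite E in H; apply H.
  intros n n' Hn Hn' Hnn [k Hk]; specialize (Hb n Hn) as Hb1; specialize (Hb n' Hn') as Hb2.
  assert (- Z.of_nat q < k * Z.of_nat q < Z.of_nat q)%Z by lia.
  assert (k = 0)%Z by nia; lia.
Qed.

(** * Mean values of L-functions *)

(** The exponent carries a minus sign, as in a Dirichlet series; a negative [s] gives a growing
    power, as in [sqrt_npow]. *)
Definition npow (s : R) (n : nat) : R := exp (- s * ln (INR n)).

Lemma npow_pos s n : 0 < npow s n.
Proof. apply exp_pos. Qed.

Lemma ln_INR_nonneg n : (1 <= n)%nat -> 0 <= ln (INR n).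
Proof.
  intros Hn; rewrite <- ln_1; destruct (Nat.eq_dec n 1) as [->|Hn1]; [simpl; lra|].
  apply Rlt_le, ln_increasing; [lra|]; apply (lt_INR 1); lia.
Qed.

Lemma ln_INR_le m n : (1 <= m <= n)%nat -> ln (INR m) <= ln (INR n).
Proof.
  intros [H1 H2]; destruct (Nat.eq_dec m n) as [->|Hn1]; [lra|].
  apply Rlt_le, ln_increasing; [apply lt_0_INR; lia|]; apply lt_INR; lia.
Qed.

Lemma exp_le x y : x <= y -> exp x <= exp y.
Proof. intros [H| ->]; [apply Rlt_le, exp_increasing; trivial|lra]. Qed.

Lemma npow_1 s : npow s 1 = 1.
Proof. unfold npow; simpl; rewrite ln_1, Rmult_0_r, exp_0; trivial. Qed.

Lemma npow_lt_1 s n : 0 < s -> (2 <= n)%nat -> npow s n < 1.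
Proof.
  intros Hs Hn; unfold npow; rewrite <- exp_0; apply exp_increasing.
  assert (H : 0 < ln (INR n)).
  { rewrite <- ln_1; apply ln_increasing; [lra|]; apply (lt_INR 1); lia. }
  nra.
Qed.

Lemma npow_mult s m n : (1 <= m)%nat -> (1 <= n)%nat ->
  npow s (m * n) = npow s m * npow s n.
Proof.
  intros Hm Hn; unfold npow; rewrite <- exp_plus, mult_INR, ln_mult; [f_equal; ring| |];
    apply lt_0_INR; lia.
Qed.

Lemma npow_plus s t n : npow (s + t) n = npow s n * npow t n.
Proof. unfold npow; rewrite <- exp_plus; f_equal; ring. Qed.

Lemma npow_decr s m n : 0 <= s -> (1 <= m <= n)%nat -> npow s n <= npow s m.
Proof.
  intros Hs Hn; apply exp_le; assert (H := ln_INR_le m n Hn); nra.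
Qed.

Lemma npow_anti s t n : s <= t -> (1 <= n)%nat -> npow t n <= npow s n.
Proof.
  intros Hs Hn; apply exp_le; assert (H := ln_INR_nonneg n Hn); nra.
Qed.

Lemma npow_small s eps : 0 < s -> 0 < eps ->
  exists N, (1 <= N)%nat /\ forall n, (N <= n)%nat -> npow s n < eps.
Proof.
  intros Hs He; destruct (nfloor_ex (exp (- ln eps / s))) as [N [_ HN]].
  { apply Rlt_le, exp_pos. }
  exists (S N); split; [lia|]; intros n Hn.
  assert (HnN : exp (- ln eps / s) < INR n).
  { eapply Rlt_le_trans; [exact HN|]; rewrite <- S_INR; apply le_INR; trivial. }
  unfold npow; rewrite <- (exp_ln eps) by trivial; apply exp_increasing.
  apply ln_increasing in HnN; [|apply exp_pos]; rewrite ln_exp in HnN.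
  apply (Rmult_lt_compat_l s) in HnN; trivial.
  replace (s * (- ln eps / s)) with (- ln eps) in HnN by (field; lra); lra.
Qed.

(** Comparison with an integral, done by hand: [1 / (m + 1)] is at most [ln (m + 1) - ln m], and
    [exp x >= 1 + x] turns this difference of logarithms into a difference of powers, which
    telescopes. *)
Lemma npow_tail_term kappa m : 0 < kappa -> (1 <= m)%nat ->
  npow (1 + kappa) (S m) <= / kappa * (npow kappa m - npow kappa (S m)).
Proof.
  intros Hk Hm.
  assert (Hm0 : 0 < INR m) by (apply lt_0_INR; lia).
  assert (H1 : npow 1 (S m) = / INR (S m)).
  { unfold npow; replace (- (1) * ln (INR (S m))) with (- ln (INR (S m))) by ring.
    rewrite exp_Ropp, exp_ln; trivial; apply lt_0_INR; lia. }
  assert (Hd : / INR (S m) <= ln (INR (S m)) - ln (INR m)).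
  { rewrite S_INR.
    assert (H : ln (INR m / (INR m + 1)) <= INR m / (INR m + 1) - 1).
    { assert (Hp : 0 < INR m / (INR m + 1)) by (apply Rdiv_lt_0_compat; lra).
      assert (He := exp_ineq1_le (ln (INR m / (INR m + 1)))); rewrite exp_ln in He; lra. }
    rewrite ln_div in H by lra.
    replace (INR m / (INR m + 1) - 1) with (- / (INR m + 1)) in H by (field; lra); lra. }
  rewrite npow_plus, H1.
  assert (Hr : npow kappa m = npow kappa (S m) * exp (kappa * (ln (INR (S m)) - ln (INR m)))).
  { unfold npow; rewrite <- exp_plus; f_equal; ring. }
  rewrite Hr; set (d := ln (INR (S m)) - ln (INR m)) in *.
  assert (He := exp_ineq1_le (kappa * d)); assert (Hp := npow_pos kappa (S m)).
  apply (Rmult_le_reg_l kappa); trivial.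
  replace (kappa * (/ kappa * (npow kappa (S m) * exp (kappa * d) - npow kappa (S m))))
    with (npow kappa (S m) * (exp (kappa * d) - 1)) by (field; lra).
  replace (kappa * (/ INR (S m) * npow kappa (S m))) with (npow kappa (S m) * (kappa * / INR (S m))) by ring.
  apply Rmult_le_compat_l; [lra|nra].
Qed.

Lemma rsum_telescope (f : nat -> R) m k :
  rsum (seq m k) (fun n => f n - f (S n)) = f m - f (m + k)%nat.
Proof.
  revert m; induction k as [|k IH]; intros m; simpl; [rewrite Nat.add_0_r; ring|].
  rewrite IH, Nat.add_succ_r; simpl; ring.
Qed.

Lemma npow_tail kappa y k : 0 < kappa -> (1 <= y)%nat ->
  rsum (seq (S y) k) (npow (1 + kappa)) <= / kappa * npow kappa y.
Proof.
  intros Hk Hy; rewrite <- seq_shift, rsum_map.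
  eapply Rle_trans; [apply rsum_le; intros n Hn; apply in_seq in Hn; apply npow_tail_term; [exact Hk|lia]|].
  rewrite rsum_scal, rsum_telescope; apply Rmult_le_compat_l.
  - apply Rlt_le, Rinv_0_lt_compat; trivial.
  - assert (H := npow_pos kappa (y + k)); lra.
Qed.

(** Bernoulli's inequality for the [k]-th power of [exp (- x)]. *)
Lemma one_minus_exp_convex k x : 1 <= k -> 1 - exp (- k * x) <= k * (1 - exp (- x)).
Proof.
  intros Hk; assert (H := exp_pos (- x)).
  assert (H1 : exp (- x) * (1 + - (k - 1) * x) <= exp (- k * x)).
  { replace (- k * x) with (- x + - (k - 1) * x) by ring; rewrite exp_plus.
    apply Rmult_le_compat_l; [lra|apply exp_ineq1_le]. }
  assert (H2 : exp (- x) * (1 + x) <= 1).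
  { apply Rle_trans with (exp (- x) * exp x).
    - apply Rmult_le_compat_l; [lra|apply exp_ineq1_le].
    - rewrite <- exp_plus, Rplus_opp_l, exp_0; lra. }
  nra.
Qed.

(** The constant does not depend on [delta]; this is what later serves all [rho] at once. With
    [k = delta / eta], Bernoulli's inequality loses a factor [k], which is paid for by [npow (delta
    - eta) n <= exp (- (k - 1) * eta * ln 2)]; here [n >= 2] matters. *)
Lemma npow_diff_le eta delta n : 0 < eta <= delta -> (2 <= n)%nat ->
  npow delta n - npow delta (S n) <=
  (1 + / (eta * ln 2)) * (npow eta n - npow eta (S n)).
Proof.
  intros [He Hd] Hn; set (k := delta / eta).
  assert (Hk : 1 <= k).
  { unfold k; apply (Rmult_le_reg_r eta); trivial.
    replace (delta / eta * eta) with delta by (field; lra); lra. }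
  assert (Hdk : delta = k * eta) by (unfold k; field; lra).
  set (d := ln (INR (S n)) - ln (INR n)).
  assert (E1 : npow delta n - npow delta (S n) = npow (delta - eta) n * npow eta n * (1 - exp (- k * (eta * d)))).
  { replace (npow (delta - eta) n * npow eta n) with (npow delta n) by (rewrite <- npow_plus; f_equal; ring).
    rewrite Rmult_minus_distr_l, Rmult_1_r; f_equal; unfold npow, d; rewrite <- exp_plus, Hdk; f_equal; ring. }
  assert (E2 : npow eta n - npow eta (S n) = npow eta n * (1 - exp (- (eta * d)))).
  { rewrite Rmult_minus_distr_l, Rmult_1_r; f_equal; unfold npow, d; rewrite <- exp_plus; f_equal; ring. }
  assert (Hd0 : 0 <= d) by (assert (H := ln_INR_le n (S n) ltac:(lia)); unfold d; lra).
  assert (Hc := one_minus_exp_convex k (eta * d) Hk).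
  assert (Hx : exp (- (eta * d)) <= 1) by (rewrite <- exp_0; apply exp_le; nra).
  assert (Hln2 : 0 < ln 2) by (rewrite <- ln_1; apply ln_increasing; lra).
  set (th := eta * ln 2); assert (Hth : 0 < th) by (unfold th; nra).
  assert (Hq : npow (delta - eta) n * k <= 1 + / th).
  { assert (Hb : npow (delta - eta) n <= exp (- ((k - 1) * th))).
    { apply exp_le; unfold th; rewrite Hdk.
      assert (H := ln_INR_le 2 n ltac:(lia)); simpl in H; replace (1 + 1) with 2 in H by ring.
      assert (0 <= (k - 1) * eta) by nra; nra. }
    assert (Hm : 1 <= exp ((k - 1) * th) * / (1 + (k - 1) * th)).
    { assert (H := exp_ineq1_le ((k - 1) * th)); assert (0 <= (k - 1) * th) by nra.
      apply (Rmult_le_reg_r (1 + (k - 1) * th)); [lra|]; rewrite Rmult_assoc, Rinv_l by lra; lra. }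
    assert (0 <= (k - 1) * th) by nra.
    assert (Hb2 : exp (- ((k - 1) * th)) <= / (1 + (k - 1) * th)).
    { rewrite exp_Ropp; apply Rinv_le_contravar; [lra|apply exp_ineq1_le]. }
    apply Rle_trans with (/ (1 + (k - 1) * th) * k); [nra|].
    apply (Rmult_le_reg_l (1 + (k - 1) * th)); [lra|].
    rewrite <- Rmult_assoc, Rinv_r, Rmult_1_l by lra.
    replace ((1 + (k - 1) * th) * (1 + / th)) with (1 + / th + (k - 1) * th + (k - 1)) by (field; lra).
    assert (0 < / th) by (apply Rinv_0_lt_compat; trivial); lra. }
  rewrite E1, E2; assert (Hp := npow_pos eta n); assert (Hp' := npow_pos (delta - eta) n).
  apply Rle_trans with (npow (delta - eta) n * k * (npow eta n * (1 - exp (- (eta * d))))).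
  - replace (npow (delta - eta) n * k * (npow eta n * (1 - exp (- (eta * d)))))
      with (npow (delta - eta) n * npow eta n * (k * (1 - exp (- (eta * d))))) by ring.
    apply Rmult_le_compat_l; [nra|lra].
  - apply Rmult_le_compat_r; [nra|exact Hq].
Qed.

(** * Summation by parts *)

Lemma Abel_summation (a : nat -> C) (b : nat -> R) M k :
  csum (seq (S M) k) (fun n => a n * RtoC (b n))%C =
  (csum (seq (S M) k) a * RtoC (b (M + k)%nat) +
   csum (seq 0 k) (fun j => csum (seq (S M) j) a * RtoC (b (M + j)%nat - b (S (M + j)))))%C.
Proof.
  induction k as [|k IH]; [simpl; ring|].
  rewrite !seq_S, !csum_app, IH; simpl csum; rewrite !RtoC_minus.
  replace (M + S k)%nat with (S (M + k)) by lia; replace (S M + k)%nat with (S (M + k)) by lia; ring.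
Qed.

(** The partial sums are only controlled on average over [J], with a bound for each length but none
    uniform in [t]. The weights are common to all [t], so the two sums can be interchanged before
    the decreasing weights telescope. *)
Lemma Abel_bound_mean {T} (J : list T) (a : T -> nat -> C) (b : nat -> R) M k B :
  (forall j, (j <= k)%nat -> rsum J (fun t => Cmod (csum (seq (S M) j) (a t))) <= B) ->
  (forall n, (M <= n)%nat -> 0 <= b (S n) <= b n) ->
  rsum J (fun t => Cmod (csum (seq (S M) k) (fun n => a t n * RtoC (b n))%C)) <= B * b M.
Proof.
  intros HB Hb.
  assert (Hb0 : forall n, (M <= n)%nat -> 0 <= b n) by (intros n Hn; specialize (Hb n Hn); lra).
  apply Rle_trans with (rsum J (fun t => Cmod (csum (seq (S M) k) (a t)) * b (M + k)%nat +
    rsum (seq 0 k) (fun j => Cmod (csum (seq (S M) j) (a t)) * (b (M + j)%nat - b (S (M + j)))))).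
  { apply rsum_le; intros t _; rewrite Abel_summation.
    eapply Rle_trans; [apply Cmod_triangle|apply Rplus_le_compat].
    - rewrite Cmod_mult, Cmod_R, Rabs_pos_eq by (apply Hb0; lia); lra.
    - eapply Rle_trans; [apply Cmod_csum|apply rsum_le; intros j _].
      rewrite Cmod_mult, Cmod_R; specialize (Hb (M + j)%nat ltac:(lia)).
      rewrite Rabs_pos_eq by lra; lra. }
  rewrite rsum_plus, rsum_swap.
  replace (B * b M) with (B * b (M + k)%nat + B * (b (M + 0)%nat - b (M + (0 + k))%nat))
    by (rewrite Nat.add_0_r, Nat.add_0_l; ring).
  apply Rplus_le_compat.
  - rewrite (rsum_ext _ _ (fun t => b (M + k)%nat * Cmod (csum (seq (S M) k) (a t)))) by (intros; ring).
    rewrite rsum_scal, Rmult_comm; apply Rmult_le_compat_r; [apply Hb0; lia|apply HB; lia].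
  - rewrite <- (rsum_telescope (fun j => b (M + j)%nat)), <- rsum_scal.
    apply rsum_le; intros j Hj; apply in_seq in Hj.
    rewrite (rsum_ext _ _ (fun t => (b (M + j)%nat - b (S (M + j))) * Cmod (csum (seq (S M) j) (a t)))) by (intros; ring).
    rewrite rsum_scal, Nat.add_succ_r, Rmult_comm; specialize (Hb (M + j)%nat ltac:(lia)).
    apply Rmult_le_compat_r; [lra|apply HB; lia].
Qed.

Lemma Abel_bound (a : nat -> C) (b : nat -> R) M k B :
  (forall j, (j <= k)%nat -> Cmod (csum (seq (S M) j) a) <= B) ->
  (forall n, (M <= n)%nat -> 0 <= b (S n) <= b n) ->
  Cmod (csum (seq (S M) k) (fun n => a n * RtoC (b n))%C) <= B * b M.
Proof.
  intros HB Hb; assert (H := Abel_bound_mean (tt :: nil) (fun _ => a) b M k B).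
  simpl in H; rewrite Rplus_0_r in H; apply H; trivial.
  intros j Hj; rewrite Rplus_0_r; auto.
Qed.

(** Multiplying an L-function by the inverse Euler factors at the primes of [l] leaves the Dirichlet
    series over these integers. *)
Definition rough (l : list nat) (n : nat) : bool :=
  forallb (fun p => negb (n mod p =? 0)%nat) l.

Definition roughen (l : list nat) (F : nat -> C) (n : nat) : C :=
  if rough l n then F n else RtoC 0.

Definition all_prime (l : list nat) : Prop := forall p, In p l -> prime (Z.of_nat p).

Lemma rough_mult p l m : prime (Z.of_nat p) -> ~ In p l -> all_prime l ->
  rough l (p * m) = rough l m.
Proof.
  intros Hp Hn Hl; induction l as [|p' l IH]; trivial; simpl; f_equal.
  2:{ apply IH; [intros H; apply Hn; simpl; auto|intros x Hx; apply Hl; simpl; auto]. }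
  f_equal; assert (Hp' := Hl p' (or_introl eq_refl)); assert (H2 := prime_ge_2 _ Hp').
  apply Bool.eq_true_iff_eq; rewrite !Nat.eqb_eq, !Nat.Lcm0.mod_divide.
  split; [|intros [c ->]; exists (p * c)%nat; lia].
  intros [c Hc].
  assert (H : (Z.of_nat p' | Z.of_nat p * Z.of_nat m)%Z) by (exists (Z.of_nat c); lia).
  apply prime_mult in H; trivial; destruct H as [H|H].
  - exfalso; apply Hn; left; apply prime_div_prime in H; trivial; lia.
  - destruct H as [d Hd]; exists (Z.to_nat d); nia.
Qed.

(** One step of Legendre's sieve: the new prime removes its multiples [p * m], and such a multiple
    had survived the earlier primes exactly when [m] had. *)
Lemma roughen_cons_sum p l F x : prime (Z.of_nat p) -> ~ In p l -> all_prime l ->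
  csum (seq 1 x) (roughen (p :: l) F) =
  (csum (seq 1 x) (roughen l F) - csum (seq 1 (x / p)) (roughen l (fun m => F (p * m)%nat)))%C.
Proof.
  intros Hp Hn Hl; assert (H2 := prime_ge_2 _ Hp).
  induction x as [|x IH].
  { rewrite Nat.Div0.div_0_l; simpl; ring. }
  rewrite !(seq_S x), !csum_app, IH; simpl csum.
  assert (Hdm := Nat.div_mod_eq x p); assert (Hml := Nat.mod_upper_bound x p ltac:(lia)).
  assert (Ev : roughen (p :: l) F (S x) = if (S x mod p =? 0)%nat then RtoC 0 else roughen l F (S x)).
  { unfold roughen; simpl rough; destruct (_ =? _)%nat; trivial. }
  rewrite Ev; clear Ev.
  destruct (Nat.eqb_spec (S x mod p) 0) as [E|E].
  - assert (E' := Nat.div_mod_eq (S x) p); rewrite E in E'.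
    assert (Ediv : (S x / p = S (x / p))%nat) by nia.
    rewrite Ediv, seq_S, csum_app; simpl csum.
    replace (roughen l (fun m => F (p * m)%nat) (S (x / p))) with (roughen l F (S x)); [ring|].
    unfold roughen; replace (S x) with (p * S (x / p))%nat by lia.
    rewrite rough_mult; trivial.
  - assert (E' := Nat.div_mod_eq (S x) p); assert (Hml' := Nat.mod_upper_bound (S x) p ltac:(lia)).
    assert (Ediv : (S x / p = x / p)%nat) by nia.
    rewrite Ediv; ring.
Qed.

Lemma csum_seq_split (f : nat -> C) N k :
  csum (seq (S N) k) f = (csum (seq 1 (N + k)) f - csum (seq 1 N) f)%C.
Proof. rewrite (seq_app N k 1), csum_app; simpl; ring. Qed.

Lemma X_interval_reduce (q : nat) chi N k : prime (Z.of_nat q) -> X q chi ->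
  csum (seq N k) (fun n => chi (Z.of_nat n)) =
  csum (seq (N + q * (k / q)) (k mod q)) (fun n => chi (Z.of_nat n)).
Proof.
  intros Hq HX; rewrite (Nat.div_mod_eq k q) at 1.
  rewrite seq_app, csum_app.
  replace (csum (seq N (q * (k / q))) (fun n => chi (Z.of_nat n))) with (RtoC 0); [ring|].
  generalize (k / q)%nat; intros t; revert N; induction t as [|t IH]; intros N.
  - rewrite Nat.mul_0_r; trivial.
  - replace (q * S t)%nat with (q + q * t)%nat by lia.
    rewrite seq_app, csum_app, (X_period q) by trivial; rewrite <- IH; ring.
Qed.

Lemma X_interval_le (q : nat) chi N k : prime (Z.of_nat q) -> X q chi ->
  Cmod (csum (seq N k) (fun n => chi (Z.of_nat n))) <= INR q.
Proof.
  intros Hq HX; assert (H2 := prime_ge_2 _ Hq); rewrite (X_interval_reduce q) by trivial.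
  eapply Rle_trans; [apply Cmod_csum|].
  apply Rle_trans with (rsum (seq (N + q * (k / q)) (k mod q)) (fun _ => 1)).
  - apply rsum_le; intros n _; apply (X_Cmod_le q); trivial.
  - rewrite rsum_const, length_seq, Rmult_1_r; apply le_INR, Nat.lt_le_incl, Nat.mod_upper_bound; lia.
Qed.

(** Orthogonality and Cauchy-Schwarz give, on average over [chi], the strength of the Polya-Vinogradov inequality. *)
Lemma X_interval_mean (q : nat) N k : prime (Z.of_nat q) ->
  rsum (enum (X q)) (fun chi => Cmod (csum (seq N k) (fun n => chi (Z.of_nat n)))) <=
  INR (q - 1) * sqrt (INR q).
Proof.
  intros Hq; assert (H2 := prime_ge_2 _ Hq).
  rewrite (rsum_ext _ _ (fun chi => Cmod (csum (seq (N + q * (k / q)) (k mod q)) (fun n => RtoC 1 * chi (Z.of_nat n))%C))).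
  2:{ intros chi Hchi; apply (X_enumerates q Hq) in Hchi; rewrite (X_interval_reduce q) by trivial.
      f_equal; apply csum_ext; intros; ring. }
  set (L := seq (N + q * (k / q)) (k mod q)).
  assert (Hkq := Nat.mod_upper_bound k q ltac:(lia)).
  assert (HB := X_Bessel q L (fun _ => RtoC 1) Hq (seq_NoDup _ _)).
  assert (HCS := Cauchy_Schwarz_rsum (enum (X q)) (fun chi => Cmod (csum L (fun n => RtoC 1 * chi (Z.of_nat n))%C))).
  rewrite X_length in HCS by trivial.
  cbv beta in HB; rewrite (rsum_ext L (fun n => Cmod ((fun _ : nat => RtoC 1) n) ^ 2) (fun _ => 1)) in HB
    by (intros; rewrite Cmod_1; ring).
  assert (HLl : length L = (k mod q)%nat) by apply length_seq.
  rewrite rsum_const, HLl, Rmult_1_r in HB.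
  set (T := rsum (enum (X q)) (fun chi => Cmod (csum L (fun n => RtoC 1 * chi (Z.of_nat n))%C))) in *.
  assert (HT : 0 <= T) by (apply rsum_nonneg; intros; apply Cmod_ge_0).
  assert (HTT : T ^ 2 <= (INR (q - 1) * sqrt (INR q)) ^ 2).
  { rewrite Rpow_mult_distr, pow2_sqrt by apply pos_INR.
    eapply Rle_trans; [exact HCS|].
    apply Rle_trans with (INR (q - 1) * (INR (q - 1) * (INR q))).
    - apply Rmult_le_compat; [apply pos_INR|apply rsum_nonneg; intros; apply pow2_ge_0|apply le_INR; lia|].
      eapply Rle_trans; [apply HB|].
      + unfold L; intros n n' Hn Hn' Hnn [c Hc]; apply in_seq in Hn; apply in_seq in Hn'.
        assert (- Z.of_nat q < c * Z.of_nat q < Z.of_nat q)%Z by lia.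
        assert (c = 0)%Z by nia; lia.
      + apply Rmult_le_compat_l; [apply pos_INR|].
        apply le_INR; lia.
    - right; ring. }
  apply Rsqr_incr_0; [rewrite !Rsqr_pow2; trivial|trivial|].
  apply Rmult_le_pos; [apply pos_INR|apply sqrt_pos].
Qed.

Lemma roughen_scal l F (b : nat -> R) n :
  roughen l (fun n => F n * RtoC (b n))%C n = (roughen l F n * RtoC (b n))%C.
Proof. unfold roughen; destruct (rough l n); ring. Qed.

Lemma roughen_mult l c F n : roughen l (fun n => c * F n)%C n = (c * roughen l F n)%C.
Proof. unfold roughen; destruct (rough l n); ring. Qed.

Lemma roughen_cons_interval p l F N k : prime (Z.of_nat p) -> ~ In p l -> all_prime l ->
  csum (seq (S N) k) (roughen (p :: l) F) =
  (csum (seq (S N) k) (roughen l F) -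
   csum (seq (S (N / p)) ((N + k) / p - N / p)) (roughen l (fun m => F (p * m)%nat)))%C.
Proof.
  intros Hp Hn Hl; assert (H2 := prime_ge_2 _ Hp).
  rewrite (csum_seq_split (roughen (p :: l) F) N), (csum_seq_split (roughen l F) N),
    (csum_seq_split _ (N / p)), !roughen_cons_sum by trivial.
  replace (N / p + ((N + k) / p - N / p))%nat with ((N + k) / p)%nat; [ring|].
  assert (H : (N / p <= (N + k) / p)%nat) by (apply Nat.Div0.div_le_mono; lia); lia.
Qed.

Definition on_nat (chi : Z -> C) (n : nat) : C := chi (Z.of_nat n).

Lemma roughen_X_mult q chi l p : X q chi ->
  forall m, roughen l (fun m => on_nat chi (p * m)%nat) m = (on_nat chi p * roughen l (on_nat chi) m)%C.
Proof.
  intros [[Hm _] _] m; rewrite <- roughen_mult; unfold roughen, on_nat; rewrite Nat2Z.inj_mul, Hm; trivial.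
Qed.

(** Each sieving prime replaces an interval sum by two, the second multiplied by [chi p]; hence a
    factor 2 per prime. For fixed [l] this factor is harmless as [q] grows. *)
Lemma rough_interval_mean q l N k : prime (Z.of_nat q) -> all_prime l -> NoDup l ->
  rsum (enum (X q)) (fun chi => Cmod (csum (seq (S N) k) (roughen l (on_nat chi)))) <=
  2 ^ length l * (INR (q - 1) * sqrt (INR q)).
Proof.
  intros Hq; revert N k; induction l as [|p l IH]; intros N k Hl Hnd.
  { simpl pow; rewrite Rmult_1_l; apply (X_interval_mean q (S N) k Hq). }
  inversion Hnd; subst.
  assert (Hl' : all_prime l) by (intros x Hx; apply Hl; simpl; auto).
  assert (Hp : prime (Z.of_nat p)) by (apply Hl; simpl; auto).
  apply Rle_trans with (rsum (enum (X q)) (fun chi =>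
    Cmod (csum (seq (S N) k) (roughen l (on_nat chi))) +
    Cmod (csum (seq (S (N / p)) ((N + k) / p - N / p)) (roughen l (on_nat chi))))).
  - apply rsum_le; intros chi Hchi; apply (X_enumerates q Hq) in Hchi.
    rewrite roughen_cons_interval by trivial; unfold Cminus.
    eapply Rle_trans; [apply Cmod_triangle|]; apply Rplus_le_compat_l.
    rewrite Cmod_opp, (csum_ext _ _ _ (fun m _ => roughen_X_mult q chi l p Hchi m)), csum_scal, Cmod_mult.
    assert (H0 := X_Cmod_le q chi (Z.of_nat p) Hq Hchi); fold (on_nat chi p) in H0.
    assert (H4 := Cmod_ge_0 (csum (seq (S (N / p)) ((N + k) / p - N / p)) (roughen l (on_nat chi)))).
    nra.
  - rewrite rsum_plus; simpl pow; rewrite Rmult_assoc; apply Rle_trans with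
      (2 ^ length l * (INR (q - 1) * sqrt (INR q)) + 2 ^ length l * (INR (q - 1) * sqrt (INR q))); [|lra].
    apply Rplus_le_compat; auto.
Qed.

(** Bound for a single character: too weak for the mean value, but enough at fixed [q] to give
    convergence and to discard boundary terms. *)
Lemma rough_interval_le q l chi N k : prime (Z.of_nat q) -> X q chi -> all_prime l -> NoDup l ->
  Cmod (csum (seq (S N) k) (roughen l (on_nat chi))) <= 2 ^ length l * INR q.
Proof.
  intros Hq Hchi; revert N k; induction l as [|p l IH]; intros N k Hl Hnd.
  { simpl pow; rewrite Rmult_1_l; apply (X_interval_le q chi (S N) k Hq Hchi). }
  inversion Hnd; subst.
  assert (Hl' : all_prime l) by (intros x Hx; apply Hl; simpl; auto).
  assert (Hp : prime (Z.of_nat p)) by (apply Hl; simpl; auto).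
  rewrite roughen_cons_interval by trivial; unfold Cminus.
  eapply Rle_trans; [apply Cmod_triangle|].
  rewrite Cmod_opp, (csum_ext _ _ _ (fun m _ => roughen_X_mult q chi l p Hchi m)), csum_scal, Cmod_mult.
  assert (H0 := X_Cmod_le q chi (Z.of_nat p) Hq Hchi); fold (on_nat chi p) in H0.
  assert (H4 := Cmod_ge_0 (csum (seq (S (N / p)) ((N + k) / p - N / p)) (roughen l (on_nat chi)))).
  assert (H5 := IH N k Hl' ltac:(trivial)).
  assert (H6 := IH (N / p)%nat ((N + k) / p - N / p)%nat Hl' ltac:(trivial)).
  simpl pow; nra.
Qed.

Lemma sqrt_npow n : (1 <= n)%nat -> sqrt (INR n) = npow (- (1 / 2)) n.
Proof.
  intros Hn; assert (H : 0 < INR n) by (apply lt_0_INR; lia).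
  apply sqrt_lem_1; [lra|apply Rlt_le, npow_pos|].
  rewrite <- npow_plus; unfold npow.
  replace (- (- (1 / 2) + - (1 / 2)) * ln (INR n)) with (ln (INR n)) by lra.
  apply exp_ln; trivial.
Qed.

Lemma npow_sqr s n : npow s n ^ 2 = npow (2 * s) n.
Proof. simpl; rewrite Rmult_1_r, <- npow_plus; f_equal; ring. Qed.

Definition dsum (l : list nat) (s : R) (chi : Z -> C) (M k : nat) : C :=
  csum (seq M k) (roughen l (fun n => on_nat chi n * RtoC (npow s n))%C).

Lemma sqrt_le_double n : (1 <= n)%nat -> sqrt (INR (S n)) <= 2 * sqrt (INR n).
Proof.
  intros Hn; assert (H : 1 <= INR n) by (apply (le_INR 1); trivial).
  replace 2 with (sqrt (2 * 2)) by (apply sqrt_square; lra).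
  rewrite <- sqrt_mult by lra; apply sqrt_le_1; rewrite ?S_INR; lra.
Qed.

(** Below [q] the integers are distinct residues, so Bessel's inequality and Cauchy-Schwarz apply;
    only integers above [y] survive the sieve, whence the first term. From [q] on, the mean bound of
    order [sqrt q] for interval sums is combined with the weight [npow s], and [s > 1 / 2] makes the
    result decay. *)
Lemma dsum_mean q l s y k : prime (Z.of_nat q) -> all_prime l -> NoDup l ->
  1 / 2 < s -> (1 <= y)%nat -> (forall n, (1 < n)%nat -> rough l n = true -> (y < n)%nat) ->
  rsum (enum (X q)) (fun chi => Cmod (dsum l s chi 2 k)) <=
  INR (q - 1) * (sqrt (/ (2 * s - 1) * npow (2 * s - 1) y) + 2 ^ length l * (2 * npow (s - 1 / 2) (q - 1))).
Proof.
  intros Hq Hl Hnd Hs Hy Hrough; assert (Hq2 := prime_ge_2 _ Hq).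
  set (A := sqrt (/ (2 * s - 1) * npow (2 * s - 1) y)).
  assert (Hq1 := pos_INR (q - 1)).
  assert (Hsmall : forall k, (k <= q - 2)%nat ->
    rsum (enum (X q)) (fun chi => Cmod (dsum l s chi 2 k)) <= INR (q - 1) * A).
  { clear k; intros k Hk.
    set (L := filter (rough l) (seq 2 k)).
    assert (HLb : forall n, In n L -> (2 <= n < 2 + k)%nat /\ rough l n = true).
    { intros n Hn; apply filter_In in Hn; destruct Hn as [Hn Hr]; apply in_seq in Hn; auto. }
    rewrite (rsum_ext _ _ (fun chi => Cmod (csum L (fun n => RtoC (npow s n) * chi (Z.of_nat n))%C))).
    2:{ intros chi _; f_equal; unfold dsum, L; rewrite csum_filter; apply csum_ext; intros n _.
        unfold roughen, on_nat; destruct (rough l n); ring. }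
    assert (HB := X_Bessel q L (fun n => RtoC (npow s n)) Hq (NoDup_filter _ (seq_NoDup _ _))).
    assert (HCS := Cauchy_Schwarz_rsum (enum (X q)) (fun chi => Cmod (csum L (fun n => RtoC (npow s n) * chi (Z.of_nat n))%C))).
    rewrite X_length in HCS by trivial; cbv beta in HB.
    set (T2 := rsum (enum (X q)) (fun chi => Cmod (csum L (fun n => RtoC (npow s n) * chi (Z.of_nat n))%C) ^ 2)) in *.
    set (T := rsum (enum (X q)) (fun chi => Cmod (csum L (fun n => RtoC (npow s n) * chi (Z.of_nat n))%C))) in *.
    assert (HT : 0 <= T) by (apply rsum_nonneg; intros; apply Cmod_ge_0).
    assert (HT2 : 0 <= T2) by (apply rsum_nonneg; intros; apply pow2_ge_0).
    assert (HL2 : rsum L (fun n => Cmod (RtoC (npow s n)) ^ 2) <= / (2 * s - 1) * npow (2 * s - 1) y).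
    { rewrite (rsum_ext _ _ (npow (1 + (2 * s - 1)))).
      2:{ intros n _; rewrite Cmod_R, Rabs_pos_eq, npow_sqr by (apply Rlt_le, npow_pos); f_equal; ring. }
      eapply Rle_trans; [|apply (npow_tail (2 * s - 1) y (1 + k)); trivial; lra].
      apply rsum_incl.
      - apply NoDup_filter, seq_NoDup.
      - intros n Hn; destruct (HLb n Hn) as [Hn1 Hn2]; specialize (Hrough n ltac:(lia) Hn2).
        apply in_seq; lia.
      - intros; apply Rlt_le, npow_pos. }
    apply Rsqr_incr_0; [rewrite !Rsqr_pow2|trivial|apply Rmult_le_pos; [trivial|apply sqrt_pos]].
    assert (HA : A ^ 2 = / (2 * s - 1) * npow (2 * s - 1) y).
    { apply pow2_sqrt; apply Rmult_le_pos; [|apply Rlt_le, npow_pos].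
      apply Rlt_le, Rinv_0_lt_compat; lra. }
    rewrite Rpow_mult_distr, HA; eapply Rle_trans; [exact HCS|].
    apply Rle_trans with (INR (q - 1) * (INR (q - 1) * (/ (2 * s - 1) * npow (2 * s - 1) y))); [|right; ring].
    apply Rmult_le_compat; [apply pos_INR|trivial|apply le_INR; lia|].
    eapply Rle_trans; [apply HB|apply Rmult_le_compat_l; trivial].
    intros n n' Hn Hn' Hnn [c Hc]; apply HLb in Hn; apply HLb in Hn'.
    assert (- Z.of_nat q < c * Z.of_nat q < Z.of_nat q)%Z by lia.
    assert (c = 0)%Z by nia; lia. }
  assert (HE : 0 <= 2 ^ length l * (2 * npow (s - 1 / 2) (q - 1))).
  { apply Rmult_le_pos; [apply pow_le; lra|]; assert (H := npow_pos (s - 1 / 2) (q - 1)); lra. }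
  destruct (Nat.le_gt_cases k (q - 2)) as [Hk|Hk].
  { eapply Rle_trans; [apply Hsmall; trivial|]; apply Rmult_le_compat_l; lra. }
  apply Rle_trans with (rsum (enum (X q)) (fun chi => Cmod (dsum l s chi 2 (q - 2)) +
    Cmod (csum (seq (S (q - 1)) (k - (q - 2))) (fun n => roughen l (on_nat chi) n * RtoC (npow s n))%C))).
  { apply rsum_le; intros chi _; unfold dsum.
    replace k with ((q - 2) + (k - (q - 2)))%nat at 1 by lia.
    rewrite seq_app, csum_app; eapply Rle_trans; [apply Cmod_triangle|]; right; f_equal.
    f_equal; replace (2 + (q - 2))%nat with (S (q - 1)) by lia.
    apply csum_ext; intros n _; apply roughen_scal. }
  rewrite rsum_plus, Rmult_plus_distr_l; apply Rplus_le_compat; [apply Hsmall; lia|].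
  eapply Rle_trans.
  - apply (Abel_bound_mean _ (fun chi => roughen l (on_nat chi)) (npow s) (q - 1) _ (2 ^ length l * (INR (q - 1) * sqrt (INR q)))).
    + intros j _; apply rough_interval_mean; trivial.
    + intros n Hn; split; [apply Rlt_le, npow_pos|apply npow_decr; [lra|lia]].
  (* The tail weight is taken at [q - 1]; the factor 2 pays for replacing [sqrt q] by
     [sqrt (q - 1)]. *)
  - assert (Hsq := sqrt_le_double (q - 1) ltac:(lia)).
    replace (S (q - 1)) with q in Hsq by lia; rewrite (sqrt_npow (q - 1)) in Hsq by lia.
    replace (npow (s - 1 / 2) (q - 1)) with (npow (- (1 / 2)) (q - 1) * npow s (q - 1)) by (rewrite <- npow_plus; f_equal; ring).
    assert (H0 := npow_pos s (q - 1)).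
    assert (H1 : 0 <= 2 ^ length l) by (apply pow_le; lra).
    replace (2 ^ length l * (INR (q - 1) * sqrt (INR q)) * npow s (q - 1)) with
      (2 ^ length l * (INR (q - 1) * npow s (q - 1)) * sqrt (INR q)) by ring.
    replace (INR (q - 1) * (2 ^ length l * (2 * (npow (- (1 / 2)) (q - 1) * npow s (q - 1))))) with
      (2 ^ length l * (INR (q - 1) * npow s (q - 1)) * (2 * npow (- (1 / 2)) (q - 1))) by ring.
    apply Rmult_le_compat_l; [apply Rmult_le_pos; [trivial|nra]|trivial].
Qed.

Lemma dsum_le q l s chi k : prime (Z.of_nat q) -> X q chi -> all_prime l -> NoDup l -> 0 <= s ->
  Cmod (dsum l s chi 2 k) <= 2 ^ length l * INR q.
Proof.
  intros Hq Hchi Hl Hnd Hs; unfold dsum.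
  rewrite (csum_ext _ _ (fun n => roughen l (on_nat chi) n * RtoC (npow s n))%C)
    by (intros; apply roughen_scal).
  eapply Rle_trans; [apply (Abel_bound _ _ 1 k (2 ^ length l * INR q))|].
  - intros j _; apply rough_interval_le; trivial.
  - intros n Hn; split; [apply Rlt_le, npow_pos|apply npow_decr; [lra|lia]].
  - rewrite npow_1; lra.
Qed.

(** * Convergence of the Dirichlet series *)

Definition Clim (u : nat -> C) (L : C) : Prop :=
  is_lim_seq (fun n => Re (u n)) (Re L) /\ is_lim_seq (fun n => Im (u n)) (Im L).

Lemma Cmod_le_Re_Im (z : C) : Cmod z <= Rabs (Re z) + Rabs (Im z).
Proof.
  replace z with (RtoC (Re z) + (0, Im z))%C at 1 by (apply injective_projections; simpl; unfold Re, Im; ring).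
  eapply Rle_trans; [apply Cmod_triangle|]; rewrite Cmod_R; apply Rplus_le_compat_l.
  unfold Cmod; simpl; replace (0 * (0 * 1) + Im z * (Im z * 1)) with (Rsqr (Im z)) by (unfold Rsqr; ring).
  rewrite sqrt_Rsqr_abs; lra.
Qed.

Lemma Clim_Cmod_le u L z B : Clim u L ->
  (forall eps, 0 < eps -> exists N, forall n, (N <= n)%nat -> Cmod (u n - z)%C <= B + eps) ->
  Cmod (L - z)%C <= B.
Proof.
  intros [H1 H2] H; apply le_epsilon; intros eps Heps.
  assert (He : 0 < eps / 3) by lra.
  destruct (H _ He) as [N0 HN0].
  apply is_lim_seq_spec in H1; apply is_lim_seq_spec in H2.
  destruct (H1 (mkposreal _ He)) as [N1 HN1], (H2 (mkposreal _ He)) as [N2 HN2]; simpl in *.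
  set (n := (N0 + N1 + N2)%nat).
  specialize (HN0 n ltac:(unfold n; lia)); specialize (HN1 n ltac:(unfold n; lia)); specialize (HN2 n ltac:(unfold n; lia)).
  replace (L - z)%C with ((u n - z) - (u n - L))%C by ring.
  unfold Cminus at 1; eapply Rle_trans; [apply Cmod_triangle|]; rewrite Cmod_opp.
  assert (H3 := Cmod_le_Re_Im (u n - L)%C).
  replace (Re (u n - L)) with (Re (u n) - Re L) in H3 by (unfold Re; simpl; ring).
  replace (Im (u n - L)) with (Im (u n) - Im L) in H3 by (unfold Im; simpl; ring).
  lra.
Qed.

Lemma Clim_minus u v L L' : Clim u L -> Clim v L' -> Clim (fun n => u n - v n)%C (L - L')%C.
Proof.
  intros [H1 H2] [H3 H4]; split.
  - eapply is_lim_seq_ext; [|apply is_lim_seq_minus'; [exact H1|exact H3]]; intros; simpl; unfold Re; simpl; ring.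
  - eapply is_lim_seq_ext; [|apply is_lim_seq_minus'; [exact H2|exact H4]]; intros; simpl; unfold Im; simpl; ring.
Qed.

Lemma Clim_scal c u L : Clim u L -> Clim (fun n => c * u n)%C (c * L)%C.
Proof.
  intros [H1 H2]; split; simpl.
  - apply is_lim_seq_minus'; apply (is_lim_seq_scal_l _ _ (Finite _)); trivial.
  - apply is_lim_seq_plus'; apply (is_lim_seq_scal_l _ _ (Finite _)); trivial.
Qed.

Lemma Clim_ext u v L : (forall n, u n = v n) -> Clim u L -> Clim v L.
Proof.
  intros E [H1 H2]; split; [eapply is_lim_seq_ext; [|exact H1]|eapply is_lim_seq_ext; [|exact H2]];
    intros; simpl; rewrite E; trivial.
Qed.

Lemma Clim_div p u L : (1 <= p)%nat -> Clim u L -> Clim (fun n => u (n / p)%nat) L.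
Proof.
  intros Hp [H1 H2].
  assert (H : filterlim (fun n => (n / p)%nat) eventually eventually).
  { intros P [N HN]; exists (p * N)%nat; intros n Hn; apply HN.
    apply Nat.div_le_lower_bound; lia. }
  split; [apply (filterlim_comp _ _ _ _ _ _ _ _ H H1)|apply (filterlim_comp _ _ _ _ _ _ _ _ H H2)].
Qed.

Lemma ex_Clim_Cauchy u :
  (forall eps, 0 < eps -> exists N, forall k, Cmod (u (N + k)%nat - u N)%C <= eps) -> exists L, Clim u L.
Proof.
  intros H.
  assert (HC : forall f : C -> R, (forall z w, Rabs (f z - f w) <= Cmod (z - w)%C) ->
    ex_finite_lim_seq (fun n => f (u n))).
  { intros f Hf; apply ex_lim_seq_cauchy_corr; intros eps.
    destruct (H (eps / 3)) as [N HN]; [assert (He := cond_pos eps); lra|].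
    exists N; intros n m Hn Hm.
    assert (H1 := HN (n - N)%nat); assert (H2 := HN (m - N)%nat).
    replace (N + (n - N))%nat with n in H1 by lia; replace (N + (m - N))%nat with m in H2 by lia.
    assert (H3 := Hf (u n) (u N)); assert (H4 := Hf (u m) (u N)).
    replace (f (u n) - f (u m)) with ((f (u n) - f (u N)) - (f (u m) - f (u N))) by ring.
    unfold Rminus at 1; eapply Rle_lt_trans; [apply Rabs_triang|]; rewrite Rabs_Ropp.
    assert (He := cond_pos eps); lra. }
  destruct (HC Re) as [a Ha].
  { intros z w; replace (Re z - Re w) with (Re (z - w)%C) by (unfold Re; simpl; ring).
    eapply Rle_trans; [|apply Rmax_Cmod]; apply Rmax_l. }
  destruct (HC Im) as [b Hb].
  { intros z w; replace (Im z - Im w) with (Im (z - w)%C) by (unfold Im; simpl; ring).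
    eapply Rle_trans; [|apply Rmax_Cmod]; apply Rmax_r. }
  exists (a, b); split; trivial.
Qed.

Lemma Rpow_opp_npow s n : Rpow_opp (INR (S n)) (RtoC s) = RtoC (npow s (S n)).
Proof.
  unfold Rpow_opp, Cexp, npow; set (x := ln (INR (S n))).
  replace (- RtoC s * RtoC x)%C with (RtoC (- s * x)) by (rewrite <- RtoC_opp, RtoC_mult; trivial).
  unfold Re, Im, RtoC; simpl; rewrite cos_0, sin_0, Rmult_1_r, Rmult_0_r; trivial.
Qed.

Lemma sum_n_csum (f : nat -> C) (g : C -> R) n :
  (forall z w, g (z + w)%C = g z + g w) -> g (RtoC 0) = 0 ->
  sum_n (fun k => g (f (S k))) n = g (csum (seq 1 (S n)) f).
Proof.
  intros Hg H0; induction n as [|n IH].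
  - rewrite sum_O; simpl; rewrite Hg, H0; ring.
  - rewrite sum_Sn, IH, (seq_S (S n)), csum_app, Hg, csum_cons, Cplus_0_r; reflexivity.
Qed.

(** [Series] returns a value even for a divergent series. Here the sums of [chi] over intervals are
    bounded by [q], so summation by parts makes the partial sums Cauchy and the value is a true
    limit. *)
Lemma dirichlet_L_lim q chi s : prime (Z.of_nat q) -> X q chi -> 0 < s ->
  Clim (fun k => csum (seq 1 k) (fun n => on_nat chi n * RtoC (npow s n))%C) (dirichlet_L chi (RtoC s)).
Proof.
  intros Hq Hchi Hs.
  set (u := fun k => csum (seq 1 k) (fun n => on_nat chi n * RtoC (npow s n))%C).
  assert (Hex : exists L, Clim u L).
  { apply ex_Clim_Cauchy; intros eps He.
    assert (Hq0 : 0 < INR q) by (apply lt_0_INR; assert (H := prime_ge_2 _ Hq); lia).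
    destruct (npow_small s (eps / INR q)) as [N [HN1 HN]]; [trivial|apply Rdiv_lt_0_compat; trivial|].
    exists N; intros k; unfold u.
    rewrite <- csum_seq_split.
    eapply Rle_trans; [apply (Abel_bound (on_nat chi) (npow s) N k (INR q))|].
    - intros j _; apply X_interval_le; trivial.
    - intros n Hn; split; [apply Rlt_le, npow_pos|apply npow_decr; [lra|lia]].
    - specialize (HN N (Nat.le_refl N)); apply (Rmult_lt_compat_l (INR q)) in HN; trivial.
      replace (INR q * (eps / INR q)) with eps in HN by (field; lra); lra. }
  destruct Hex as [L HL].
  replace (dirichlet_L chi (RtoC s)) with L; trivial.
  assert (E : forall n, (chi (Z.of_nat (S n)) * Rpow_opp (INR (S n)) (RtoC s))%C =
                (fun n => on_nat chi n * RtoC (npow s n))%C (S n)).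
  { intros n; rewrite Rpow_opp_npow; trivial. }
  destruct HL as [H1 H2]; apply is_lim_seq_incr_1 in H1; apply is_lim_seq_incr_1 in H2.
  unfold dirichlet_L, CSeries; apply injective_projections; unfold fst, snd, Series; symmetry.
  - rewrite (Lim_seq_ext _ (fun n => Re (u (S n)))); [rewrite (is_lim_seq_unique _ _ H1); reflexivity|].
    intros n; unfold u; rewrite <- (sum_n_csum _ Re) by reflexivity.
    apply sum_n_ext; intros k; apply (f_equal Re (E k)).
  - rewrite (Lim_seq_ext _ (fun n => Im (u (S n)))); [rewrite (is_lim_seq_unique _ _ H2); reflexivity|].
    intros n; unfold u; rewrite <- (sum_n_csum _ Im) by reflexivity.
    apply sum_n_ext; intros k; apply (f_equal Im (E k)).
Qed.

(** The inverse of the partial Euler product: multiplying L by it removes the primes of [l]. *)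
Definition euler (l : list nat) (s : R) (chi : Z -> C) : C :=
  fold_right (fun p z => ((1 - RtoC (npow s p) * on_nat chi p) * z)%C) (RtoC 1) l.

(** By complete multiplicativity, a sieve step subtracts from the partial sum at [x] the factor [c]
    times the partial sum at [x / p]. Both partial sums have the same limit, so the limit is
    multiplied by [1 - c]. *)
Lemma dsum_lim q l chi s : prime (Z.of_nat q) -> X q chi -> all_prime l -> NoDup l -> 0 < s ->
  Clim (dsum l s chi 1) (euler l s chi * dirichlet_L chi (RtoC s))%C.
Proof.
  intros Hq Hchi Hl Hnd Hs; induction l as [|p l IH].
  - simpl; rewrite Cmult_1_l; apply (dirichlet_L_lim q); trivial.
  - inversion Hnd; subst.
    assert (Hl' : all_prime l) by (intros x Hx; apply Hl; simpl; auto).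
    assert (Hp : prime (Z.of_nat p)) by (apply Hl; simpl; auto).
    assert (Hp2 := prime_ge_2 _ Hp); specialize (IH Hl' ltac:(trivial)).
    set (c := (RtoC (npow s p) * on_nat chi p)%C).
    replace (euler (p :: l) s chi * dirichlet_L chi (RtoC s))%C with
      (euler l s chi * dirichlet_L chi (RtoC s) - c * (euler l s chi * dirichlet_L chi (RtoC s)))%C
      by (simpl; fold c; ring).
    apply (Clim_ext (fun n => dsum l s chi 1 n - c * dsum l s chi 1 (n / p))%C).
    + intros x; unfold dsum; rewrite roughen_cons_sum by trivial; f_equal; f_equal.
      rewrite <- csum_scal; apply csum_ext; intros m Hm; apply in_seq in Hm.
      unfold roughen; destruct (rough l m); [|ring].
      rewrite npow_mult, RtoC_mult by lia; unfold c, on_nat.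
      destruct Hchi as [[Hmul _] _]; rewrite Nat2Z.inj_mul, Hmul; ring.
    + apply Clim_minus; trivial; apply Clim_scal, Clim_div; trivial; lia.
Qed.

Lemma rough_1 l : all_prime l -> rough l 1 = true.
Proof.
  intros Hl; apply forallb_forall; intros p Hp; assert (H := prime_ge_2 _ (Hl p Hp)).
  rewrite Nat.mod_small by lia; trivial.
Qed.

(** For every exponent gap at least [eta], this majorises the weight that summation by parts puts on
    the partial sum of length [j >= 1] starting at 2, whose last index is [j + 1]. *)
Definition abel_weight (eta : R) (j : nat) : R :=
  (1 + / (eta * ln 2)) * (npow eta (S j) - npow eta (S (S j))).

Lemma abel_weight_nonneg eta j : 0 < eta -> 0 <= abel_weight eta j.
Proof.
  intros He; apply Rmult_le_pos.
  - assert (Hln2 : 0 < ln 2) by (rewrite <- ln_1; apply ln_increasing; lra).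
    assert (0 < / (eta * ln 2)) by (apply Rinv_0_lt_compat; nra); lra.
  - assert (H := npow_decr eta (S j) (S (S j)) ltac:(lra) ltac:(lia)); lra.
Qed.

Lemma abel_weight_sum eta k : 0 < eta ->
  rsum (seq 0 k) (abel_weight eta) <= 1 + / (eta * ln 2).
Proof.
  intros He; unfold abel_weight; rewrite rsum_scal, (rsum_telescope (fun j => npow eta (S j))), npow_1.
  assert (Hln2 : 0 < ln 2) by (rewrite <- ln_1; apply ln_increasing; lra).
  assert (0 < / (eta * ln 2)) by (apply Rinv_0_lt_compat; nra).
  assert (H1 := npow_pos eta (S (0 + k))); nra.
Qed.

(** Write [npow rho n] as [npow s0 n * npow (rho - s0) n] and sum by parts: [rho] then enters only
    through weights dominated by [abel_weight]. The term [n = 1] gives the 1 that is subtracted, and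
    the boundary term tends to 0 at fixed [q]. *)
Lemma euler_L_close q chi l s0 eta Z rho : prime (Z.of_nat q) -> X q chi -> all_prime l -> NoDup l ->
  0 < s0 -> 0 < eta -> s0 + eta <= rho ->
  (forall k, rsum (seq 0 k) (fun j => Cmod (dsum l s0 chi 2 j) * abel_weight eta j) <= Z) ->
  Cmod (euler l rho chi * dirichlet_L chi (RtoC rho) - 1)%C <= Z.
Proof.
  intros Hq Hchi Hl Hnd Hs0 He Hrho HZ; assert (Hq2 := prime_ge_2 _ Hq).
  apply (Clim_Cmod_le _ _ _ _ (dsum_lim q l chi rho Hq Hchi Hl Hnd ltac:(lra))); intros eps Heps.
  set (B := 2 ^ length l * INR q).
  assert (HB : 0 < B) by (apply Rmult_lt_0_compat; [apply pow_lt; lra|apply lt_0_INR; lia]).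
  destruct (npow_small eta (eps / B) He) as [N [HN1 HN]]; [apply Rdiv_lt_0_compat; trivial|].
  exists (S N); intros n Hn; destruct n as [|k]; [lia|].
  set (delta := rho - s0).
  replace (dsum l rho chi 1 (S k) - 1)%C with
    (csum (seq 2 k) (fun n => roughen l (fun n => on_nat chi n * RtoC (npow s0 n))%C n * RtoC (npow delta n))%C).
  2:{ unfold dsum; simpl seq; rewrite csum_cons.
      unfold roughen at 2; rewrite rough_1, npow_1 by trivial; unfold on_nat at 2; simpl Z.of_nat.
      rewrite (dirichlet_character_1 q chi (proj1 Hchi)).
      rewrite (csum_ext (seq 2 k) (roughen l _) (fun n => roughen l (fun n => on_nat chi n * RtoC (npow s0 n))%C n * RtoC (npow delta n))%C); [ring|].
      intros m _; rewrite <- roughen_scal; unfold roughen; destruct (rough l m); trivial.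
      unfold delta; replace rho with (s0 + (rho - s0)) at 1 by ring; rewrite npow_plus, RtoC_mult; ring. }
  rewrite Abel_summation.
  eapply Rle_trans; [apply Cmod_triangle|]; rewrite Rplus_comm; apply Rplus_le_compat.
  - eapply Rle_trans; [apply Cmod_csum|]; eapply Rle_trans; [|apply (HZ k)].
    apply rsum_le; intros j _; rewrite Cmod_mult, Cmod_R.
    (* The empty partial sum is set apart because [npow_diff_le] starts at 2. *)
    destruct j as [|j].
    { unfold dsum; simpl csum; rewrite Cmod_0, !Rmult_0_l; lra. }
    apply Rmult_le_compat_l; [apply Cmod_ge_0|].
    assert (H := npow_decr delta (1 + S j) (S (1 + S j)) ltac:(unfold delta; lra) ltac:(lia)).
    rewrite Rabs_pos_eq by lra; apply npow_diff_le; [unfold delta; lra|lia].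
  - rewrite Cmod_mult, Cmod_R, Rabs_pos_eq by (apply Rlt_le, npow_pos).
    assert (H1 := dsum_le q l s0 chi k Hq Hchi Hl Hnd ltac:(lra)); fold B in H1.
    specialize (HN (1 + k)%nat ltac:(lia)).
    assert (H2 := npow_anti eta delta (1 + k) ltac:(unfold delta; lra) ltac:(lia)).
    apply (Rmult_lt_compat_l B) in HN; trivial; replace (B * (eps / B)) with eps in HN by (field; lra).
    assert (H3 := Cmod_ge_0 (dsum l s0 chi 2 k)); assert (H4 := npow_pos delta (1 + k)).
    apply Rle_trans with (B * npow delta (1 + k)); [apply Rmult_le_compat_r; [lra|exact H1]|nra].
Qed.

Lemma is_lim_seq_rsum {T} (l : list T) (u : T -> nat -> R) (v : T -> R) :
  (forall x, In x l -> is_lim_seq (u x) (v x)) ->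
  is_lim_seq (fun n => rsum l (fun x => u x n)) (rsum l v).
Proof.
  induction l as [|x l IH]; intros H; simpl; [apply is_lim_seq_const|].
  apply is_lim_seq_plus'; [apply H; simpl; auto|apply IH; intros; apply H; simpl; auto].
Qed.

(** Summation by parts from [s0] bounds all [rho >= s0 + eta] by the same [Z chi]; this is what
    excludes real zeros to the right of [s0 + eta] when [Z chi] is small. *)
Lemma euler_L_mean q l s0 eta K : prime (Z.of_nat q) -> all_prime l -> NoDup l ->
  0 < s0 -> 0 < eta -> 0 <= K ->
  (forall k, rsum (enum (X q)) (fun chi => Cmod (dsum l s0 chi 2 k)) <= K) ->
  exists Z : (BinNums.Z -> C) -> R,
    (forall chi rho, X q chi -> s0 + eta <= rho ->
       Cmod (euler l rho chi * dirichlet_L chi (RtoC rho) - 1)%C <= Z chi) /\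
    rsum (enum (X q)) Z <= (1 + / (eta * ln 2)) * K.
Proof.
  intros Hq Hl Hnd Hs0 He HK0 HK.
  set (z := fun chi k => rsum (seq 0 k) (fun j => Cmod (dsum l s0 chi 2 j) * abel_weight eta j)).
  assert (Hz0 : forall chi j, 0 <= Cmod (dsum l s0 chi 2 j) * abel_weight eta j).
  { intros; apply Rmult_le_pos; [apply Cmod_ge_0|apply abel_weight_nonneg; trivial]. }
  assert (Hincr : forall chi k, z chi k <= z chi (S k)).
  { intros chi k; unfold z; rewrite seq_S, rsum_app; simpl; assert (H := Hz0 chi k); lra. }
  assert (Hlim : forall chi, X q chi -> is_lim_seq (z chi) (real (Lim_seq (z chi)))).
  { intros chi Hchi; apply Lim_seq_correct', (ex_finite_lim_seq_incr _ (2 ^ length l * INR q * (1 + / (eta * ln 2)))); [apply Hincr|].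
    intros k; unfold z.
    apply Rle_trans with (2 ^ length l * INR q * rsum (seq 0 k) (abel_weight eta)).
    - rewrite <- rsum_scal; apply rsum_le; intros j _.
      apply Rmult_le_compat_r; [apply abel_weight_nonneg; trivial|apply dsum_le; trivial; lra].
    - apply Rmult_le_compat_l; [apply Rmult_le_pos; [apply pow_le; lra|apply pos_INR]|apply abel_weight_sum; trivial]. }
  (* The limit of a non-decreasing sequence majorises all its terms, and the mean bound passes to
     the limit because there are finitely many characters. *)
  exists (fun chi => real (Lim_seq (z chi))); split.
  - intros chi rho Hchi Hrho; apply (euler_L_close q chi l s0 eta _ rho); trivial.
    intros k; apply (is_lim_seq_incr_compare (z chi) _ (Hlim chi Hchi) (Hincr chi) k).
  - assert (H := is_lim_seq_rsum (enum (X q)) z (fun chi => real (Lim_seq (z chi)))).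
    assert (H1 : is_lim_seq (fun n => rsum (enum (X q)) (fun x => z x n)) (rsum (enum (X q)) (fun chi => real (Lim_seq (z chi))))).
    { apply H; intros chi Hchi; apply Hlim, (X_enumerates q Hq); trivial. }
    refine (is_lim_seq_le _ _ _ (Finite _) _ H1 (is_lim_seq_const ((1 + / (eta * ln 2)) * K))).
    intros k; unfold z; rewrite rsum_swap.
    apply Rle_trans with (rsum (seq 0 k) (fun j => K * abel_weight eta j)).
    + apply rsum_le; intros j _.
      rewrite (rsum_ext _ _ (fun chi => abel_weight eta j * Cmod (dsum l s0 chi 2 j))) by (intros; ring).
      rewrite rsum_scal, Rmult_comm; apply Rmult_le_compat_r; [apply abel_weight_nonneg; trivial|apply HK].
    + rewrite rsum_scal, Rmult_comm; apply Rmult_le_compat_r; [trivial|apply abel_weight_sum; trivial].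
Qed.

(** * Approximation of the logarithm by finitely many primes *)

Definition indic (P : Prop) : R := if excluded_middle_informative P then 1 else 0.

(** At [r = npow sigma p] and [z = chi p], twice the logarithm of the modulus of the Euler factor at
    [p]. *)
Definition local_log (r : R) (z : C) : R := - ln (Cmod (1 - RtoC r * z)%C ^ 2).

Definition log_sum (sigma : R) (l : list nat) (chi : Z -> C) : R :=
  rsum l (fun p => local_log (npow sigma p) (on_nat chi p)).

Definition log_L (sigma : R) (chi : Z -> C) : R := 2 * ln (Cmod (dirichlet_L chi (RtoC sigma))).

(** Membership in [G] is included so that one bound on exceptional characters also covers those left
    out of the average. *)
Definition close_log (sigma eps : R) (l : list nat) (chi : Z -> C) : Prop :=
  G chi (RtoC sigma) /\ Rabs (log_L sigma chi - log_sum sigma l chi) <= eps.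

Lemma one_minus_pos r z : 0 <= r < 1 -> Cmod z <= 1 -> 1 - r <= Cmod (1 - RtoC r * z)%C.
Proof.
  intros Hr Hz.
  assert (H : Cmod (RtoC 1) <= Cmod (1 - RtoC r * z)%C + Cmod (RtoC r * z)%C).
  { replace (RtoC 1) with ((1 - RtoC r * z) + RtoC r * z)%C at 1 by ring; apply Cmod_triangle. }
  rewrite Cmod_1, Cmod_mult, Cmod_R, Rabs_pos_eq in H by lra.
  assert (H0 := Cmod_ge_0 z); nra.
Qed.

Lemma ln_euler q l sigma chi : prime (Z.of_nat q) -> X q chi -> all_prime l -> 0 < sigma ->
  0 < Cmod (euler l sigma chi) /\ 2 * ln (Cmod (euler l sigma chi)) = - log_sum sigma l chi.
Proof.
  intros Hq Hchi Hl Hs; induction l as [|p l IH]; simpl.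
  { rewrite Cmod_1, ln_1; unfold log_sum; simpl; lra. }
  assert (Hl' : all_prime l) by (intros x Hx; apply Hl; simpl; auto).
  assert (Hp2 := prime_ge_2 _ (Hl p (or_introl eq_refl))).
  destruct (IH Hl') as [H1 H2].
  assert (H3 := one_minus_pos (npow sigma p) (on_nat chi p)
    (conj (Rlt_le _ _ (npow_pos sigma p)) (npow_lt_1 sigma p Hs ltac:(lia))) (X_Cmod_le q chi _ Hq Hchi)).
  assert (H4 := npow_lt_1 sigma p Hs ltac:(lia)).
  rewrite Cmod_mult; split; [apply Rmult_lt_0_compat; lra|].
  rewrite ln_mult by lra; unfold log_sum; simpl; unfold log_sum in H2.
  rewrite Rmult_plus_distr_l, H2; unfold local_log; rewrite ln_pow by lra; simpl; ring.
Qed.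

(** A slit through the real point [sigma] comes from a real zero at or beyond it, and at such a zero
    the product would be at distance 1 from 1. For the logarithm, [x] within [Z <= 1 / 2] of 1 gives
    [- 2 * Z <= ln x <= Z]; doubling yields [4 * Z]. *)
Lemma close_log_of_euler q l sigma Z chi : prime (Z.of_nat q) -> X q chi -> all_prime l ->
  1 / 2 < sigma -> Z <= 1 / 2 ->
  (forall rho, sigma <= rho -> Cmod (euler l rho chi * dirichlet_L chi (RtoC rho) - 1)%C <= Z) ->
  close_log sigma (4 * Z) l chi.
Proof.
  intros Hq Hchi Hl Hs HZ H.
  assert (Hnz : forall rho, sigma <= rho -> 1 - Z <= Cmod (euler l rho chi * dirichlet_L chi (RtoC rho))%C).
  { intros rho Hr; specialize (H rho Hr).
    assert (H1 : Cmod (RtoC 1) <= Cmod (euler l rho chi * dirichlet_L chi (RtoC rho))%C +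
       Cmod (- (euler l rho chi * dirichlet_L chi (RtoC rho) - 1))%C).
    { replace (RtoC 1) with (euler l rho chi * dirichlet_L chi (RtoC rho) +
        - (euler l rho chi * dirichlet_L chi (RtoC rho) - 1))%C at 1 by ring; apply Cmod_triangle. }
    rewrite Cmod_opp, Cmod_1 in H1; lra. }
  split.
  - split; [unfold Re, RtoC; simpl; lra|].
    intros rho H0 Hr [[HB1 HB2] HB3]; simpl in HB2, HB3.
    assert (E : rho = RtoC (Re rho)) by (apply injective_projections; simpl; [reflexivity|symmetry; exact HB3]).
    specialize (Hnz (Re rho) HB2); rewrite <- E, H0, Cmult_0_r, Cmod_0 in Hnz; lra.
  - destruct (ln_euler q l sigma chi Hq Hchi Hl ltac:(lra)) as [He1 He2].
    assert (H1 := H sigma (Rle_refl _)); assert (H2 := Hnz sigma (Rle_refl _)).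
    set (x := Cmod (euler l sigma chi * dirichlet_L chi (RtoC sigma))%C) in *.
    assert (H3 : x <= 1 + Z).
    { unfold x; replace (euler l sigma chi * dirichlet_L chi (RtoC sigma))%C with
        ((euler l sigma chi * dirichlet_L chi (RtoC sigma) - 1) + 1)%C by ring.
      eapply Rle_trans; [apply Cmod_triangle|rewrite Cmod_1; lra]. }
    assert (HL : 0 < Cmod (dirichlet_L chi (RtoC sigma))).
    { destruct (Cmod_ge_0 (dirichlet_L chi (RtoC sigma))) as [HL|HL]; trivial.
      unfold x in H2; rewrite Cmod_mult, <- HL in H2; lra. }
    assert (Hx : log_L sigma chi - log_sum sigma l chi = 2 * ln x).
    { unfold x, log_L; rewrite Cmod_mult, ln_mult by trivial; lra. }
    assert (HZ0 : 0 <= Z) by (eapply Rle_trans; [apply Cmod_ge_0|apply H1]).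
    assert (U1 : ln x <= x - 1).
    { assert (E := exp_ineq1_le (ln x)); rewrite exp_ln in E; lra. }
    assert (U2 : - ln x <= / x - 1).
    { assert (E := exp_ineq1_le (- ln x)); rewrite exp_Ropp, exp_ln in E; lra. }
    assert (U3 : / x <= 1 + 2 * Z).
    { apply (Rmult_le_reg_l x); [lra|]; rewrite Rinv_r by lra; nra. }
    rewrite Hx; apply Rabs_le; lra.
Qed.

Definition primes_upto (y : nat) : list nat :=
  filter (fun n => if prime_dec (Z.of_nat n) then true else false) (seq 0 (S y)).

Lemma in_primes_upto y p : In p (primes_upto y) <-> (p <= y)%nat /\ prime (Z.of_nat p).
Proof.
  unfold primes_upto; rewrite filter_In, in_seq; destruct (prime_dec _); split; intuition (try lia; discriminate).
Qed.

Lemma primes_upto_prime y : all_prime (primes_upto y).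
Proof. intros p Hp; apply in_primes_upto in Hp; tauto. Qed.

Lemma primes_upto_NoDup y : NoDup (primes_upto y).
Proof. apply NoDup_filter, seq_NoDup. Qed.

Lemma rough_primes_upto y n : (1 < n)%nat -> rough (primes_upto y) n = true -> (y < n)%nat.
Proof.
  intros Hn Hr; destruct (PrimeFieldUnits.prime_divisor n Hn) as [p [Hp Hd]].
  destruct (Nat.le_gt_cases n y) as [H|H]; trivial; exfalso.
  assert (Hpn : (p <= n)%nat) by (apply Nat.divide_pos_le; [lia|trivial]).
  assert (Hin : In p (primes_upto y)) by (apply in_primes_upto; split; [lia|trivial]).
  unfold rough in Hr; rewrite forallb_forall in Hr; specialize (Hr p Hin).
  apply Nat.Lcm0.mod_divide in Hd; rewrite Hd in Hr; discriminate.
Qed.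

(** Markov's inequality for the majorant [Z]. The order of the quantifiers reflects the two error
    terms: [y] makes the contribution of integers above [y] small, and only then can [q] beat the
    factor [2 ^ length l]. The abscissa [s0] is halfway between [1 / 2] and [sigma], leaving room on
    both sides. *)
Lemma log_L_approx sigma eps : 1 / 2 < sigma -> 0 < eps ->
  exists Y, forall y, (Y <= y)%nat -> exists q0, forall q, (q0 <= q)%nat -> prime (Z.of_nat q) ->
    rsum (enum (X q)) (fun chi => indic (~ close_log sigma eps (primes_upto y) chi)) <= eps * INR (q - 1).
Proof.
  intros Hs Heps.
  set (s0 := (sigma + 1 / 2) / 2); set (eta := sigma - s0); set (kappa := 2 * s0 - 1).
  assert (Hs0 : 1 / 2 < s0) by (unfold s0; lra).
  assert (Heta : 0 < eta) by (unfold eta, s0; lra).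
  assert (Hk : 0 < kappa) by (unfold kappa; lra).
  set (Ce := 1 + / (eta * ln 2)).
  assert (HCe : 0 < Ce).
  { assert (Hln2 : 0 < ln 2) by (rewrite <- ln_1; apply ln_increasing; lra).
    assert (0 < / (eta * ln 2)) by (apply Rinv_0_lt_compat; nra); unfold Ce; lra. }
  (* The threshold for [Z]: below it [close_log_of_euler] applies and its error [4 * Z] is at most
     [eps]. *)
  set (tau := Rmin (1 / 2) (eps / 4)).
  assert (Htau : 0 < tau) by (apply Rmin_glb_lt; lra).
  (* Chosen so that the mean bound [Ce * (2 * w)], divided by the threshold [tau], is [eps]. *)
  set (w := eps * tau / (2 * Ce)).
  assert (Hw : 0 < w) by (apply Rdiv_lt_0_compat; nra).
  destruct (npow_small kappa (kappa * w ^ 2) Hk) as [Y [HY1 HY]].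
  { apply Rmult_lt_0_compat; [trivial|apply pow_lt; trivial]. }
  exists Y; intros y Hy; specialize (HY y Hy); set (l := primes_upto y).
  assert (HA : sqrt (/ kappa * npow kappa y) <= w).
  { rewrite <- (sqrt_pow2 w) by lra; apply sqrt_le_1_alt.
    apply (Rmult_le_reg_l kappa); trivial; rewrite <- Rmult_assoc, Rinv_r by lra; lra. }
  assert (H2l : 0 < 2 ^ length l) by (apply pow_lt; lra).
  destruct (npow_small (s0 - 1 / 2) (w / (2 ^ length l * 2))) as [Q [HQ1 HQ]]; [lra|apply Rdiv_lt_0_compat; lra|].
  exists (S Q); intros q Hq0 Hq.
  specialize (HQ (q - 1)%nat ltac:(lia)).
  assert (HE : 2 ^ length l * (2 * npow (s0 - 1 / 2) (q - 1)) <= w).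
  { apply (Rmult_lt_compat_l (2 ^ length l * 2)) in HQ; [|lra].
    replace (2 ^ length l * 2 * (w / (2 ^ length l * 2))) with w in HQ by (field; lra); lra. }
  assert (Hq1 := pos_INR (q - 1)).
  destruct (euler_L_mean q l s0 eta (INR (q - 1) * (2 * w)) Hq) as [Z [HZ1 HZ2]]; trivial.
  - apply primes_upto_prime.
  - apply primes_upto_NoDup.
  - lra.
  - nra.
  - intros k; eapply Rle_trans; [apply (dsum_mean q l s0 y k Hq)|].
    + apply primes_upto_prime.
    + apply primes_upto_NoDup.
    + trivial.
    + lia.
    + intros n; apply rough_primes_upto.
    + apply Rmult_le_compat_l; [trivial|fold kappa; lra].
  - assert (HZ3 : forall chi, X q chi -> close_log sigma eps l chi \/ tau < Z chi).
    { intros chi Hchi; destruct (Rle_lt_dec (Z chi) tau) as [H|H]; [left|right; trivial].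
      assert (Ht1 := Rmin_l (1 / 2) (eps / 4)); assert (Ht2 := Rmin_r (1 / 2) (eps / 4)); fold tau in Ht1, Ht2.
      destruct (close_log_of_euler q l sigma (Z chi) chi Hq Hchi (primes_upto_prime y) Hs ltac:(lra)) as [C1 C2].
      - intros rho Hr; apply HZ1; [trivial|unfold eta; lra].
      - split; [trivial|lra]. }
    apply Rle_trans with (rsum (enum (X q)) (fun chi => / tau * Z chi)).
    + apply rsum_le; intros chi Hchi; apply (X_enumerates q Hq) in Hchi.
      assert (Hti := Rinv_0_lt_compat _ Htau).
      assert (Z0 : 0 <= Z chi) by (eapply Rle_trans; [apply Cmod_ge_0|apply (HZ1 chi sigma Hchi); unfold eta; lra]).
      unfold indic; destruct (excluded_middle_informative _) as [N|N]; [|nra].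
      destruct (HZ3 chi Hchi) as [|HH]; [contradiction|].
      apply (Rmult_le_reg_l tau); trivial; rewrite <- Rmult_assoc, Rinv_r by lra; lra.
    + rewrite rsum_scal; apply (Rmult_le_reg_l tau); trivial; rewrite <- Rmult_assoc, Rinv_r, Rmult_1_l by lra.
      eapply Rle_trans; [exact HZ2|]; right; fold Ce; unfold w; field; lra.
Qed.

(** * Equidistribution of the values at finitely many primes *)

Definition rprod {T : Type} (l : list T) (f : T -> R) : R :=
  fold_right (fun x s => f x * s) 1 l.

Lemma rprod_ext {T} (l : list T) f g :
  (forall x, In x l -> f x = g x) -> rprod l f = rprod l g.
Proof.
  induction l as [|x l IH]; intros H; simpl; trivial.
  rewrite (H x), IH; trivial; [intros; apply H|]; simpl; auto.
Qed.

Lemma rprod_nonneg {T} (l : list T) f : (forall x, In x l -> 0 <= f x) -> 0 <= rprod l f.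
Proof.
  induction l as [|x l IH]; intros H; simpl; [lra|].
  apply Rmult_le_pos; [apply H|apply IH; intros; apply H]; simpl; auto.
Qed.

Lemma rprod_mult {T} (l : list T) f g : rprod l (fun x => f x * g x) = rprod l f * rprod l g.
Proof. induction l as [|x l IH]; simpl; [|rewrite IH]; ring. Qed.

Lemma rprod_1 {T} (l : list T) f : (forall x, In x l -> f x = 1) -> rprod l f = 1.
Proof.
  induction l as [|x l IH]; intros H; simpl; trivial.
  rewrite (H x), IH; [ring|intros; apply H|]; simpl; auto.
Qed.

Lemma rprod_single (l : list nat) p x : NoDup l -> In p l ->
  rprod l (fun p' => if Nat.eq_dec p' p then x else 1) = x.
Proof.
  induction l as [|p' l IH]; intros Hnd Hin; [contradiction|]; simpl; inversion Hnd; subst.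
  destruct (Nat.eq_dec p' p) as [E|E].
  - subst; rewrite rprod_1; [ring|]; intros y Hy; destruct (Nat.eq_dec y p); congruence.
  - rewrite IH; [ring|trivial|]; destruct Hin; [contradiction|trivial].
Qed.

(** Points have a coordinate at every natural number, so that the list of relevant primes can be
    enlarged or permuted without changing the type of functions. *)
Definition torus (z : nat -> C) : Prop := forall p, Cmod (z p) = 1.

Definition upd (z : nat -> C) (p : nat) (c : C) : nat -> C :=
  fun p' => if Nat.eq_dec p' p then c else z p'.

Lemma upd_torus z p c : torus z -> Cmod c = 1 -> torus (upd z p c).
Proof. intros Hz Hc p'; unfold upd; destruct (Nat.eq_dec p' p); auto. Qed.

Lemma upd_upd z p c c' : upd (upd z p c) p c' = upd z p c'.
Proof. apply functional_extensionality; intros p'; unfold upd; destruct (Nat.eq_dec p' p); trivial. Qed.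

Definition cmean (m : nat) (g : C -> R) : R :=
  / INR m * rsum (seq 0 m) (fun j => g (ce (INR j / INR m))).

(** Mean over the coordinates in [l], each ranging over the [m]-th roots of
    unity; the head of [l] is the innermost summation. *)
Fixpoint dmean (m : nat) (l : list nat) (f : (nat -> C) -> R) : (nat -> C) -> R :=
  match l with
  | nil => f
  | p :: l' => dmean m l' (fun z => cmean m (fun c => f (upd z p c)))
  end.

Lemma cmean_le m g h : (forall c, Cmod c = 1 -> g c <= h c) -> cmean m g <= cmean m h.
Proof.
  intros H; unfold cmean; destruct m as [|m].
  - simpl; lra.
  - apply Rmult_le_compat_l; [apply Rlt_le, Rinv_0_lt_compat, lt_0_INR; lia|].
    apply rsum_le; intros; apply H, Cmod_ce.
Qed.

Lemma cmean_scal m a g : cmean m (fun c => a * g c) = a * cmean m g.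
Proof. unfold cmean; rewrite rsum_scal; ring. Qed.

Lemma cmean_plus m g h : cmean m (fun c => g c + h c) = cmean m g + cmean m h.
Proof. unfold cmean; rewrite rsum_plus; ring. Qed.

Lemma cmean_const m a : (1 <= m)%nat -> cmean m (fun _ => a) = a.
Proof.
  intros Hm; unfold cmean; rewrite rsum_const, length_seq; field.
  apply not_0_INR; lia.
Qed.

Lemma dmean_le m l f g z : torus z -> (forall w, torus w -> f w <= g w) ->
  dmean m l f z <= dmean m l g z.
Proof.
  intros Hz; revert f g; induction l as [|p l IH]; intros f g H; simpl; [auto|].
  apply IH; intros w Hw; apply cmean_le; intros c Hc; apply H, upd_torus; trivial.
Qed.

Lemma dmean_ext m l f g z : torus z -> (forall w, torus w -> f w = g w) ->
  dmean m l f z = dmean m l g z.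
Proof.
  intros Hz H; apply Rle_antisym; apply dmean_le; trivial; intros w Hw; rewrite H; trivial; lra.
Qed.

Lemma dmean_scal m l a f z : torus z -> dmean m l (fun w => a * f w) z = a * dmean m l f z.
Proof.
  intros Hz; revert f; induction l as [|p l IH]; intros f; simpl; trivial.
  rewrite <- IH; apply dmean_ext; trivial; intros w _; apply cmean_scal.
Qed.

Lemma dmean_plus m l f g z : torus z ->
  dmean m l (fun w => f w + g w) z = dmean m l f z + dmean m l g z.
Proof.
  intros Hz; revert f g; induction l as [|p l IH]; intros f g; simpl; trivial.
  rewrite <- IH; apply dmean_ext; trivial; intros w _; apply cmean_plus.
Qed.

Lemma dmean_const m l a z : (1 <= m)%nat -> torus z -> dmean m l (fun _ => a) z = a.
Proof.
  intros Hm Hz; induction l as [|p l IH]; simpl; trivial.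
  transitivity (dmean m l (fun _ => a) z); trivial.
  apply dmean_ext; trivial; intros w _; apply cmean_const; trivial.
Qed.

Lemma dmean_rsum {T} m l (J : list T) (f : T -> (nat -> C) -> R) z : (1 <= m)%nat -> torus z ->
  dmean m l (fun w => rsum J (fun t => f t w)) z = rsum J (fun t => dmean m l (f t) z).
Proof.
  intros Hm Hz; induction J as [|t J IH]; simpl; [apply dmean_const; trivial|].
  rewrite <- IH; apply dmean_plus; trivial.
Qed.

Lemma dmean_abs m l f g z : torus z -> (forall w, torus w -> Rabs (f w) <= g w) ->
  Rabs (dmean m l f z) <= dmean m l g z.
Proof.
  intros Hz H; apply Rabs_le; split.
  - replace (- dmean m l g z) with (-1 * dmean m l g z) by ring.
    rewrite <- dmean_scal by trivial; apply dmean_le; trivial; intros w Hw.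
    specialize (H w Hw); apply Rabs_le_between in H; lra.
  - apply dmean_le; trivial; intros w Hw; specialize (H w Hw); apply Rabs_le_between in H; lra.
Qed.

(** Independence of the coordinates: the innermost mean sees only the factor at the head, since the
    head does not recur in the list. *)
Lemma dmean_prod m l (g : nat -> C -> R) z : torus z -> NoDup l ->
  dmean m l (fun w => rprod l (fun p => g p (w p))) z = rprod l (fun p => cmean m (g p)).
Proof.
  intros Hz; induction l as [|p l IH]; intros Hnd; [trivial|]; inversion Hnd; subst; simpl.
  rewrite <- IH, <- dmean_scal by trivial; apply dmean_ext; trivial; intros w _.
  rewrite Rmult_comm, <- cmean_scal; unfold cmean; f_equal; apply rsum_ext; intros j _.
  rewrite Rmult_comm; f_equal.
  - apply rprod_ext; intros p' Hp'; unfold upd; destruct (Nat.eq_dec p' p) as [E|E]; [congruence|trivial].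
  - unfold upd; destruct (Nat.eq_dec p p); [trivial|contradiction].
Qed.

(** The Fejer kernel as a squared modulus: it is visibly non-negative, and its means over roots of
    unity or over characters are instances of Parseval's identity. *)
Definition fejer (N : nat) (w : C) : R := / INR N * Cmod (csum (seq 0 N) (fun k => Cpow w k)) ^ 2.

Lemma fejer_nonneg N w : (1 <= N)%nat -> 0 <= fejer N w.
Proof.
  intros HN; apply Rmult_le_pos; [|apply pow2_ge_0].
  apply Rlt_le, Rinv_0_lt_compat, lt_0_INR; lia.
Qed.

(** Powers with exponents below [N <= m] remain orthogonal on the [m]-th roots of unity, so the
    discrete mean is exact. *)
Lemma fejer_mean N m z : (1 <= N <= m)%nat -> Cmod z = 1 ->
  cmean m (fun c => fejer N (z * Cconj c)%C) = 1.
Proof.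
  intros [HN Hm] Hz; unfold cmean, fejer; rewrite rsum_scal.
  assert (HN' : INR N <> 0) by (apply not_0_INR; lia).
  assert (Hm' : INR m <> 0) by (apply not_0_INR; lia).
  assert (Hu : forall k j, Cpow (Cconj (ce (INR j / INR m))) k = ce (- (INR j * (INR k / INR m)))).
  { intros k j; rewrite <- ce_opp, ce_pow; f_equal; field; trivial. }
  rewrite (rsum_ext _ _ (fun j => Cmod (csum (seq 0 N) (fun k => Cpow z k * Cpow (Cconj (ce (INR j / INR m))) k)%C) ^ 2)).
  2:{ intros j _; do 2 f_equal; apply csum_ext; intros k _; apply Cpow_mult_l. }
  rewrite (Parseval (seq 0 m) (seq 0 N) (fun k j => Cpow (Cconj (ce (INR j / INR m))) k) (Cpow z) (fun _ => INR m)).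
  - rewrite (rsum_ext _ _ (fun _ => INR m)) by (intros; rewrite Cmod_pow, Hz, pow1; ring).
    rewrite rsum_const, length_seq; field; auto.
  - apply seq_NoDup.
  - intros k k' Hk Hk' Hkk; apply in_seq in Hk; apply in_seq in Hk'.
    rewrite (csum_ext _ _ (fun j => ce (INR j * (IZR (Z.of_nat k' - Z.of_nat k) / INR m)))).
    + apply csum_ce_0; [lia|]; intros [c Hc].
      assert (- Z.of_nat m < c * Z.of_nat m < Z.of_nat m)%Z by lia.
      assert (c = 0)%Z by nia; lia.
    + intros j _; rewrite !Hu, <- ce_opp, <- ce_plus, minus_IZR, <- !INR_IZR_INZ; f_equal; field; trivial.
  - intros k _; transitivity (csum (seq 0 m) (fun _ => RtoC 1)); [|rewrite csum_1, length_seq; trivial].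
    apply csum_ext; intros j _; rewrite Hu, <- Cmod2_conj, Cmod_ce, RtoC_pow; f_equal; ring.
Qed.

(** Up to a unimodular factor, [z - c] is [1 - w], which collapses the geometric sum to
    [1 - Cpow w N], of modulus at most 2. *)
Lemma fejer_second_moment N m z : (1 <= N <= m)%nat -> Cmod z = 1 ->
  cmean m (fun c => fejer N (z * Cconj c)%C * Cmod (z - c)%C ^ 2) <= 4 / INR N.
Proof.
  intros [HN Hm] Hz.
  assert (HN' : 0 < INR N) by (apply lt_0_INR; lia).
  rewrite <- (cmean_const m (4 / INR N)) by lia; apply cmean_le; intros c Hc.
  set (w := (z * Cconj c)%C).
  assert (Hw : Cmod w = 1) by (unfold w; rewrite Cmod_mult, Cmod_conj, Hz, Hc; ring).
  assert (E : Cmod (z - c)%C = Cmod (1 - w)%C).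
  { replace (z - c)%C with (- c * (1 - w))%C.
    - rewrite Cmod_mult, Cmod_opp, Hc; ring.
    - unfold w; replace (- c * (1 - z * Cconj c))%C with (z * (c * Cconj c) - c)%C by ring.
      rewrite <- Cmod2_conj, Hc; rewrite pow1; ring. }
  unfold fejer; rewrite E, Rmult_assoc, <- Rpow_mult_distr, <- Cmod_mult, Cmult_comm, geometric_Csum.
  unfold Rdiv; rewrite Rmult_comm; apply Rmult_le_compat_r; [apply Rlt_le, Rinv_0_lt_compat; trivial|].
  assert (H1 : Cmod (1 - Cpow w N)%C <= 2).
  { unfold Cminus; eapply Rle_trans; [apply Cmod_triangle|].
    rewrite Cmod_opp, Cmod_1, Cmod_pow, Hw, pow1; lra. }
  assert (H2 := Cmod_ge_0 (1 - Cpow w N)%C); nra.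
Qed.

Definition torus_bounded (B : R) (f : (nat -> C) -> R) : Prop :=
  forall z, torus z -> Rabs (f z) <= B.

(** Continuity at one fixed scale. Thresholds for [q] will depend on [eps], [delta] and a bound but
    not on [f], so they are uniform over families of functions. *)
Definition torus_modulus (l : list nat) (eps delta : R) (f : (nat -> C) -> R) : Prop :=
  forall z w, torus z -> torus w -> (forall p, In p l -> Cmod (z p - w p)%C < delta) ->
    Rabs (f z - f w) <= eps.

Definition kernel (N : nat) (l : list nat) (z w : nat -> C) : R :=
  rprod l (fun p => fejer N (z p * Cconj (w p))%C).

(** A base point; means over [l] overwrite its coordinates in [l]. *)
Definition pt1 : nat -> C := fun _ => RtoC 1.

Lemma pt1_torus : torus pt1.
Proof. intros p; apply Cmod_1. Qed.

Lemma kernel_nonneg N l z w : (1 <= N)%nat -> 0 <= kernel N l z w.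
Proof. intros; apply rprod_nonneg; intros; apply fejer_nonneg; trivial. Qed.

Lemma kernel_mean N m l z : (1 <= N <= m)%nat -> torus z -> NoDup l ->
  dmean m l (kernel N l z) pt1 = 1.
Proof.
  intros HN Hz Hnd; unfold kernel.
  rewrite (dmean_prod m l (fun p c => fejer N (z p * Cconj c)%C) pt1 pt1_torus Hnd).
  apply rprod_1; intros; apply fejer_mean; trivial.
Qed.

Lemma kernel_second_moment N m l z p : (1 <= N <= m)%nat -> torus z -> NoDup l -> In p l ->
  dmean m l (fun w => kernel N l z w * Cmod (z p - w p)%C ^ 2) pt1 <= 4 / INR N.
Proof.
  intros HN Hz Hnd Hp.
  set (g := fun p' c => if Nat.eq_dec p' p then fejer N (z p' * Cconj c)%C * Cmod (z p' - c)%C ^ 2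
                        else fejer N (z p' * Cconj c)%C).
  rewrite (dmean_ext m l _ (fun w => rprod l (fun p' => g p' (w p'))) _ pt1_torus).
  2:{ intros w _; unfold kernel; rewrite <- (rprod_single l p (Cmod (z p - w p)%C ^ 2) Hnd Hp), <- rprod_mult.
      apply rprod_ext; intros p' _; unfold g; destruct (Nat.eq_dec p' p) as [->|_]; ring. }
  rewrite (dmean_prod m l g pt1 pt1_torus Hnd).
  rewrite (rprod_ext _ _ (fun p' => if Nat.eq_dec p' p then cmean m (g p) else 1)).
  - rewrite rprod_single by trivial; unfold g; destruct (Nat.eq_dec p p); [|contradiction].
    apply fejer_second_moment; trivial.
  - intros p' _; destruct (Nat.eq_dec p' p) as [->|E]; trivial.
    unfold g; destruct (Nat.eq_dec p' p); [contradiction|]; apply fejer_mean; trivial.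
Qed.

(** The kernel is an approximate identity, by Chebyshev's argument: where some coordinate is off by
    at least [delta], the trivial bound [2 * B] is at most [2 * B / delta ^ 2] times the sum of
    squared distances, whose mean is a sum of second moments. *)
Lemma kernel_approx N m l z f B eps delta : (1 <= N <= m)%nat -> torus z -> NoDup l ->
  0 < delta -> 0 <= eps -> torus_bounded B f -> torus_modulus l eps delta f ->
  Rabs (f z - dmean m l (fun w => f w * kernel N l z w) pt1) <=
  eps + 2 * B / delta ^ 2 * (INR (length l) * (4 / INR N)).
Proof.
  intros HN Hz Hnd Hd He HB Hf.
  assert (HB0 : 0 <= B) by (eapply Rle_trans; [apply Rabs_pos|apply (HB z Hz)]).
  set (Q := 2 * B / delta ^ 2).
  assert (HQ : 0 <= Q).
  { apply Rmult_le_pos; [lra|]; apply Rlt_le, Rinv_0_lt_compat, pow_lt; trivial. }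
  replace (f z - dmean m l (fun w => f w * kernel N l z w) pt1) with
    (dmean m l (fun w => (f z - f w) * kernel N l z w) pt1).
  2:{ rewrite (dmean_ext m l _ (fun w => f z * kernel N l z w + -1 * (f w * kernel N l z w)) _ pt1_torus)
        by (intros; ring).
      rewrite dmean_plus, !dmean_scal, kernel_mean by (trivial; apply pt1_torus); ring. }
  apply Rle_trans with (dmean m l (fun w => eps * kernel N l z w +
      Q * rsum l (fun p => kernel N l z w * Cmod (z p - w p)%C ^ 2)) pt1).
  - apply dmean_abs; [apply pt1_torus|]; intros w Hw.
    assert (HK := kernel_nonneg N l z w ltac:(lia)).
    rewrite Rabs_mult, (Rabs_pos_eq (kernel N l z w)), rsum_scal by trivial.
    replace (eps * kernel N l z w + Q * (kernel N l z w * rsum l (fun p => Cmod (z p - w p)%C ^ 2)))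
      with ((eps + Q * rsum l (fun p => Cmod (z p - w p)%C ^ 2)) * kernel N l z w) by ring.
    apply Rmult_le_compat_r; trivial.
    assert (Hs : 0 <= rsum l (fun p => Cmod (z p - w p)%C ^ 2)) by (apply rsum_nonneg; intros; apply pow2_ge_0).
    destruct (excluded_middle_informative (forall p, In p l -> Cmod (z p - w p)%C < delta)) as [Hc|Hc].
    + specialize (Hf z w Hz Hw Hc); nra.
    + assert (Hex : exists p, In p l /\ delta <= Cmod (z p - w p)%C).
      { destruct (excluded_middle_informative (exists p, In p l /\ delta <= Cmod (z p - w p)%C)) as [|Hn]; trivial.
        exfalso; apply Hc; intros p Hp; destruct (Rlt_le_dec (Cmod (z p - w p)%C) delta); trivial.
        exfalso; apply Hn; exists p; auto. }
      destruct Hex as [p [Hp Hdp]].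
      assert (H1 : Cmod (z p - w p)%C ^ 2 <= rsum l (fun p => Cmod (z p - w p)%C ^ 2)).
      { replace (Cmod (z p - w p)%C ^ 2) with (rsum (p :: nil) (fun p => Cmod (z p - w p)%C ^ 2)) by (simpl; ring).
        apply rsum_incl; [constructor; [simpl; tauto|constructor]| |intros; apply pow2_ge_0].
        intros x [<-|[]]; trivial. }
      assert (H2 : delta ^ 2 <= Cmod (z p - w p)%C ^ 2) by (apply pow_incr; lra).
      assert (H3 : 2 * B <= Q * rsum l (fun p => Cmod (z p - w p)%C ^ 2)).
      { apply Rle_trans with (Q * delta ^ 2); [|apply Rmult_le_compat_l; [trivial|lra]].
        unfold Q; right; field; lra. }
      assert (H4 := HB z Hz); assert (H5 := HB w Hw).
      unfold Rminus; eapply Rle_trans; [apply Rabs_triang|]; rewrite Rabs_Ropp; lra.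
  - rewrite dmean_plus, !dmean_scal, kernel_mean, Rmult_1_r by (trivial; apply pt1_torus).
    apply Rplus_le_compat_l, Rmult_le_compat_l; trivial.
    rewrite (dmean_rsum m l l (fun p w => kernel N l z w * Cmod (z p - w p)%C ^ 2)) by (apply pt1_torus || lia).
    rewrite <- rsum_const; apply rsum_le; intros p Hp; apply kernel_second_moment; trivial.
Qed.

(** * Kernels averaged over the characters *)

Definition Avg (q : nat) (g : (Z -> C) -> R) : R := / INR (q - 2) * rsum (enum (X q)) g.

(** The value [1] is a filler for the primes dividing the modulus, where [chi] vanishes. *)
Definition char_pt (chi : Z -> C) : nat -> C :=
  fun p => if excluded_middle_informative (Cmod (on_nat chi p) = 1) then on_nat chi p else RtoC 1.

Lemma char_pt_torus chi : torus (char_pt chi).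
Proof.
  intros p; unfold char_pt; destruct (excluded_middle_informative _); [trivial|apply Cmod_1].
Qed.

Lemma char_pt_eq q chi p : prime (Z.of_nat q) -> X q chi -> (0 < p < q)%nat -> char_pt chi p = on_nat chi p.
Proof.
  intros Hq Hchi Hp; unfold char_pt; destruct (excluded_middle_informative _) as [_|H]; trivial.
  exfalso; apply H, (X_Cmod_1 q); trivial; intros Hd; apply Z.divide_pos_le in Hd; lia.
Qed.

Definition cprod {T : Type} (l : list T) (f : T -> C) : C :=
  fold_right (fun x s => (f x * s)%C) (RtoC 1) l.

Lemma cprod_ext {T} (l : list T) f g :
  (forall x, In x l -> f x = g x) -> cprod l f = cprod l g.
Proof.
  induction l as [|x l IH]; intros H; simpl; trivial.
  rewrite (H x), IH; trivial; [intros; apply H|]; simpl; auto.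
Qed.

Lemma cprod_mult {T} (l : list T) f g : cprod l (fun x => (f x * g x)%C) = (cprod l f * cprod l g)%C.
Proof. induction l as [|x l IH]; simpl; [|rewrite IH]; ring. Qed.

Lemma Cmod_cprod {T} (l : list T) f : Cmod (cprod l f) = rprod l (fun x => Cmod (f x)).
Proof. induction l as [|x l IH]; simpl; [apply Cmod_1|rewrite Cmod_mult, IH; trivial]. Qed.

Lemma cprod_1 {T} (l : list T) f : (forall x, In x l -> f x = RtoC 1) -> cprod l f = RtoC 1.
Proof.
  induction l as [|x l IH]; intros H; simpl; trivial.
  rewrite (H x), IH; [ring|intros; apply H|]; simpl; auto.
Qed.

Lemma csum_flat_map {S T} (g : S -> list T) (l : list S) f :
  csum (flat_map g l) f = csum l (fun x => csum (g x) f).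
Proof. induction l as [|x l IH]; simpl; trivial. rewrite csum_app, IH; trivial. Qed.

(** The integers composed of the primes of [l] with all exponents below [N]. Expanding a product
    over [l] of the geometric sums in the Fejer kernels gives one sum over them. *)
Fixpoint box (N : nat) (l : list nat) : list nat :=
  match l with
  | nil => 1%nat :: nil
  | p :: l' => flat_map (fun k => map (fun n => (p ^ k * n)%nat) (box N l')) (seq 0 N)
  end.

Lemma box_pos N l n : all_prime l -> In n (box N l) -> (0 < n)%nat.
Proof.
  revert n; induction l as [|p l IH]; intros n Hl Hn.
  { simpl in Hn; lia. }
  simpl in Hn; apply in_flat_map in Hn; destruct Hn as [k [_ Hn]]; apply in_map_iff in Hn.
  destruct Hn as [n' [<- Hn']]; assert (Hp := prime_ge_2 _ (Hl p (or_introl eq_refl))).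
  assert (H : (p ^ k <> 0)%nat) by (apply Nat.pow_nonzero; lia).
  assert (0 < n')%nat by (apply IH; trivial; intros x Hx; apply Hl; simpl; auto); nia.
Qed.

Lemma valuation_pow p p' k : prime (Z.of_nat p') ->
  PrimeFieldUnits.valuation p (p' ^ k) = (if Nat.eq_dec p p' then k else 0)%nat.
Proof.
  intros Hp; assert (H2 := prime_ge_2 _ Hp); induction k as [|k IH]; simpl.
  - rewrite PrimeFieldUnits.valuation_1; destruct (Nat.eq_dec p p'); trivial.
  - assert (H : (p' ^ k <> 0)%nat) by (apply Nat.pow_nonzero; lia).
    rewrite PrimeFieldUnits.valuation_mult, IH, PrimeFieldUnits.valuation_prime by (trivial; lia).
    destruct (Nat.eqb_spec p p'), (Nat.eq_dec p p'); lia.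
Qed.

Lemma box_valuation N l p n : all_prime l -> ~ In p l -> In n (box N l) ->
  PrimeFieldUnits.valuation p n = 0%nat.
Proof.
  revert n; induction l as [|p' l IH]; intros n Hl Hp Hn.
  { simpl in Hn; destruct Hn as [<-|[]]; apply PrimeFieldUnits.valuation_1. }
  assert (Hl' : all_prime l) by (intros x Hx; apply Hl; simpl; auto).
  assert (Hpp := Hl p' (or_introl eq_refl)); assert (H2 := prime_ge_2 _ Hpp).
  simpl in Hn; apply in_flat_map in Hn; destruct Hn as [k [_ Hn]]; apply in_map_iff in Hn.
  destruct Hn as [n' [<- Hn']].
  assert (H : (p' ^ k <> 0)%nat) by (apply Nat.pow_nonzero; lia).
  assert (Hn0 := box_pos N l n' Hl' Hn').
  rewrite PrimeFieldUnits.valuation_mult, valuation_pow by (trivial; lia).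
  rewrite IH by (trivial; simpl in Hp; tauto).
  destruct (Nat.eq_dec p p') as [->|_]; [simpl in Hp; tauto|trivial].
Qed.

(** Unique factorisation: the valuation at the head prime recovers its exponent. *)
Lemma box_NoDup N l : all_prime l -> NoDup l -> NoDup (box N l).
Proof.
  intros Hl Hnd; induction l as [|p l IH].
  { simpl; constructor; [simpl; tauto|constructor]. }
  inversion Hnd; subst.
  assert (Hl' : all_prime l) by (intros x Hx; apply Hl; simpl; auto).
  assert (Hpp := Hl p (or_introl eq_refl)); assert (H4 := prime_ge_2 _ Hpp).
  specialize (IH Hl' ltac:(trivial)); simpl.
  assert (Hpk : forall k, (p ^ k <> 0)%nat) by (intros; apply Nat.pow_nonzero; lia).
  assert (Hval : forall k n, In n (box N l) -> PrimeFieldUnits.valuation p (p ^ k * n) = k).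
  { intros k n Hn; assert (Hn0 := box_pos N l n Hl' Hn); specialize (Hpk k).
    rewrite PrimeFieldUnits.valuation_mult, valuation_pow, (box_valuation N l) by (trivial; lia).
    destruct (Nat.eq_dec p p); [lia|contradiction]. }
  assert (Hgen : forall ks, NoDup ks -> NoDup (flat_map (fun k => map (fun n => (p ^ k * n)%nat) (box N l)) ks)).
  { induction ks as [|k ks IHk]; intros Hk; simpl; [constructor|]; inversion Hk; subst.
    apply NoDup_app; [|auto|].
    - apply NoDup_map_NoDup_ForallPairs; trivial; intros n n' _ _ E.
      specialize (Hpk k); nia.
    - intros x Hx Hx'; apply in_map_iff in Hx; destruct Hx as [n [<- Hn]].
      apply in_flat_map in Hx'; destruct Hx' as [k' [Hk' Hx']]; apply in_map_iff in Hx'.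
      destruct Hx' as [n' [E Hn']].
      apply (f_equal (PrimeFieldUnits.valuation p)) in E; rewrite !Hval in E by trivial; congruence. }
  apply Hgen, seq_NoDup.
Qed.

Lemma box_length N l : length (box N l) = (N ^ length l)%nat.
Proof.
  induction l as [|p l IH]; [trivial|]; simpl.
  assert (H : forall ks, length (flat_map (fun k => map (fun n => (p ^ k * n)%nat) (box N l)) ks)
                          = (length ks * N ^ length l)%nat).
  { induction ks as [|k ks IHk]; simpl; trivial; rewrite length_app, length_map, IHk, IH; trivial. }
  rewrite H, length_seq; trivial.
Qed.

Lemma box_expand N l (h : nat -> C) : all_prime l -> h 1%nat = RtoC 1 ->
  (forall m n, (0 < m)%nat -> (0 < n)%nat -> h (m * n)%nat = (h m * h n)%C) ->
  csum (box N l) h = cprod l (fun p => csum (seq 0 N) (fun k => Cpow (h p) k)).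
Proof.
  intros Hl H1 Hm; induction l as [|p l IH].
  { simpl; rewrite H1; ring. }
  assert (Hl' : all_prime l) by (intros x Hx; apply Hl; simpl; auto).
  assert (H2 := prime_ge_2 _ (Hl p (or_introl eq_refl))).
  assert (Hpk : forall k, (p ^ k <> 0)%nat) by (intros; apply Nat.pow_nonzero; lia).
  assert (Hhp : forall k, h (p ^ k)%nat = Cpow (h p) k).
  { induction k as [|k IHk]; simpl; [trivial|]; rewrite Hm, IHk; trivial; [lia|specialize (Hpk k); lia]. }
  simpl; rewrite csum_flat_map, <- IH, Cmult_comm, <- csum_scal by trivial; apply csum_ext; intros k _.
  rewrite csum_map, Cmult_comm, <- csum_scal; apply csum_ext; intros n Hn.
  rewrite Hm, Hhp; trivial; [specialize (Hpk k); lia|apply (box_pos N l); trivial].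
Qed.

(** The completely multiplicative function with value [w p] at each [p] of [l]. It carries the
    translation by [w] in the kernel, so that the expansion over [box] still applies. *)
Definition unit_mult (l : list nat) (w : nat -> C) (n : nat) : C :=
  cprod l (fun p => Cpow (w p) (PrimeFieldUnits.valuation p n)).

Lemma unit_mult_mult l w m n : (0 < m)%nat -> (0 < n)%nat ->
  unit_mult l w (m * n) = (unit_mult l w m * unit_mult l w n)%C.
Proof.
  intros Hm Hn; unfold unit_mult; rewrite <- cprod_mult; apply cprod_ext; intros p _.
  rewrite PrimeFieldUnits.valuation_mult, Cpow_add_r by trivial; trivial.
Qed.

Lemma unit_mult_1 l w : unit_mult l w 1 = RtoC 1.
Proof. apply cprod_1; intros p _; rewrite PrimeFieldUnits.valuation_1; trivial. Qed.

Lemma unit_mult_prime l w p : NoDup l -> In p l -> all_prime l -> unit_mult l w p = w p.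
Proof.
  intros Hnd Hp Hl; unfold unit_mult.
  rewrite (cprod_ext _ _ (fun p' => if Nat.eq_dec p' p then w p else RtoC 1)).
  2:{ intros p' _; rewrite PrimeFieldUnits.valuation_prime by auto.
      destruct (Nat.eqb_spec p' p) as [E|E], (Nat.eq_dec p' p) as [E'|E']; try congruence; simpl; rewrite ?E; ring. }
  clear Hl; induction l as [|p' l IH]; [contradiction|]; inversion Hnd; subst; simpl.
  destruct (Nat.eq_dec p' p) as [->|E].
  - rewrite cprod_1; [ring|]; intros y Hy; destruct (Nat.eq_dec y p); congruence.
  - rewrite IH; [ring|trivial|]; destruct Hp; [contradiction|trivial].
Qed.

Lemma Cmod_unit_mult l w n : torus w -> Cmod (unit_mult l w n) = 1.
Proof.
  intros Hw; unfold unit_mult; rewrite Cmod_cprod; apply rprod_1; intros p _.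
  rewrite Cmod_pow, Hw, pow1; trivial.
Qed.

(** Brings the kernel at a character to the form of a squared character sum with unimodular
    coefficients, ready for Parseval's identity. *)
Lemma kernel_eq N l q chi w : prime (Z.of_nat q) -> X q chi -> all_prime l -> NoDup l ->
  (1 <= N)%nat -> (forall p, In p l -> (p < q)%nat) ->
  kernel N l (char_pt chi) w = / INR N ^ length l *
    Cmod (csum (box N l) (fun n => unit_mult l (fun p => Cconj (w p)) n * chi (Z.of_nat n))%C) ^ 2.
Proof.
  intros Hq Hchi Hl Hnd HN Hlq; set (u := unit_mult l (fun p => Cconj (w p))).
  assert (Hm := proj1 (proj1 Hchi)).
  rewrite (box_expand N l (fun n => u n * chi (Z.of_nat n))%C Hl).
  - rewrite Cmod_cprod; unfold kernel, fejer.
    assert (HNl : / INR N ^ length l = rprod l (fun _ => / INR N)).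
    { rewrite <- pow_inv; clear; induction l as [|p l IH]; simpl; [trivial|rewrite IH; trivial]. }
    rewrite HNl; simpl; rewrite Rmult_1_r, <- !rprod_mult.
    apply rprod_ext; intros p Hp; rewrite Rmult_1_r.
    assert (Hp2 := prime_ge_2 _ (Hl p Hp)).
    rewrite (char_pt_eq q) by (trivial; specialize (Hlq p Hp); lia).
    unfold u; rewrite unit_mult_prime by trivial; rewrite Cmult_comm; trivial.
  - unfold u; rewrite unit_mult_1; simpl Z.of_nat; rewrite (dirichlet_character_1 q chi (proj1 Hchi)); ring.
  - intros m n Hm0 Hn0; unfold u; rewrite unit_mult_mult, Nat2Z.inj_mul, Hm by trivial; ring.
Qed.

Lemma exists_bound (l : list nat) : exists M, forall n, In n l -> (n < M)%nat.
Proof.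
  induction l as [|x l [M HM]]; [exists 0%nat; contradiction|].
  exists (S x + M)%nat; intros n [->|Hn]; [lia|specialize (HM n Hn); lia].
Qed.

(** Once [q] exceeds every integer of the box, these are distinct nonzero residues and Parseval's
    identity is exact. The error comes only from the missing principal character and from dividing
    by [q - 2] in place of [q - 1]; it is uniform in [w]. *)
Lemma kernel_Avg N l : all_prime l -> NoDup l -> (1 <= N)%nat ->
  exists q0, (3 <= q0)%nat /\ forall q w, (q0 <= q)%nat -> prime (Z.of_nat q) -> torus w ->
    Rabs (Avg q (fun chi => kernel N l (char_pt chi) w) - 1) <= INR N ^ length l / INR (q - 2).
Proof.
  intros Hl Hnd HN.
  destruct (exists_bound (l ++ box N l)) as [M HM].
  exists (3 + M)%nat; split; [lia|]; intros q w Hq0 Hq Hw.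
  set (u := unit_mult l (fun p => Cconj (w p))).
  assert (Hu : forall n, Cmod (u n) = 1).
  { intros n; apply Cmod_unit_mult; intros p; rewrite Cmod_conj; apply Hw. }
  assert (HP := X_Parseval q (box N l) u Hq (box_NoDup N l Hl Hnd)).
  assert (Hbd : forall n, In n (box N l) -> (0 < n < q)%nat).
  { intros n Hn; split; [apply (box_pos N l); trivial|].
    specialize (HM n (in_or_app _ _ _ (or_intror Hn))); lia. }
  specialize (HP Hbd).
  set (T := rsum (enum (X q)) (fun chi => Cmod (csum (box N l) (fun n => u n * chi (Z.of_nat n))%C) ^ 2)) in *.
  set (E := Cmod (csum (box N l) u)) in *.
  rewrite (rsum_ext (box N l) _ (fun _ => 1)) in HP by (intros; rewrite Hu; ring).
  rewrite rsum_const, box_length, pow_INR, Rmult_1_r in HP.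
  set (D := INR N ^ length l) in *.
  assert (HD : 1 <= D) by (apply pow_R1_Rle, (le_INR 1); trivial).
  assert (HE : 0 <= E ^ 2 <= D * D).
  { split; [apply pow2_ge_0|].
    assert (HE1 : E <= D).
    { unfold E; eapply Rle_trans; [apply Cmod_csum|].
      rewrite (rsum_ext (box N l) _ (fun _ => 1)) by (intros; apply Hu).
      rewrite rsum_const, box_length, pow_INR; fold D; lra. }
    assert (HE0 : 0 <= E) by apply Cmod_ge_0; nra. }
  assert (HA : Avg q (fun chi => kernel N l (char_pt chi) w) = / INR (q - 2) * (/ D * T)).
  { unfold Avg, T; rewrite <- (rsum_scal (enum (X q)) (/ D)); f_equal; apply rsum_ext; intros chi Hchi.
    apply (X_enumerates q Hq) in Hchi; apply (kernel_eq N l q); trivial.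
    intros p Hp; specialize (HM p (in_or_app _ _ _ (or_introl Hp))); lia. }
  assert (Hq2 : 1 <= INR (q - 2)) by (apply (le_INR 1); lia).
  assert (Hq1 : INR (q - 1) = INR (q - 2) + 1) by (rewrite <- S_INR; f_equal; lia).
  rewrite HA.
  replace T with (INR (q - 1) * D - E ^ 2) by lra; rewrite Hq1.
  replace (/ INR (q - 2) * (/ D * ((INR (q - 2) + 1) * D - E ^ 2)) - 1) with
    ((1 - E ^ 2 / D) * / INR (q - 2)) by (field; lra).
  unfold Rdiv at 2; rewrite Rabs_mult, (Rabs_pos_eq (/ INR (q - 2))) by (apply Rlt_le, Rinv_0_lt_compat; lra).
  apply Rmult_le_compat_r; [apply Rlt_le, Rinv_0_lt_compat; lra|].
  assert (H1 : 0 <= E ^ 2 / D <= D).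
  { split; [apply Rdiv_le_0_compat; lra|].
    apply (Rmult_le_reg_r D); [lra|]; unfold Rdiv; rewrite Rmult_assoc, Rinv_l by lra; lra. }
  apply Rabs_le; lra.
Qed.

Lemma Avg_le q f g : (forall chi, In chi (enum (X q)) -> f chi <= g chi) -> Avg q f <= Avg q g.
Proof.
  intros H; apply Rmult_le_compat_l; [|apply rsum_le; trivial].
  destruct (Nat.eq_dec (q - 2) 0) as [->|E]; [simpl; rewrite Rinv_0; lra|].
  apply Rlt_le, Rinv_0_lt_compat, lt_0_INR; lia.
Qed.

Lemma Avg_ext q f g : (forall chi, In chi (enum (X q)) -> f chi = g chi) -> Avg q f = Avg q g.
Proof. intros H; unfold Avg; f_equal; apply rsum_ext; trivial. Qed.

Lemma Avg_plus q f g : Avg q (fun chi => f chi + g chi) = Avg q f + Avg q g.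
Proof. unfold Avg; rewrite rsum_plus; ring. Qed.

Lemma Avg_minus q f g : Avg q (fun chi => f chi - g chi) = Avg q f - Avg q g.
Proof. unfold Avg; rewrite rsum_minus; ring. Qed.

Lemma Avg_scal q c f : Avg q (fun chi => c * f chi) = c * Avg q f.
Proof. unfold Avg; rewrite rsum_scal; ring. Qed.

Lemma Avg_abs q f : Rabs (Avg q f) <= Avg q (fun chi => Rabs (f chi)).
Proof.
  unfold Avg; rewrite Rabs_mult, Rabs_pos_eq.
  - apply Rmult_le_compat_l; [|apply rsum_abs].
    destruct (Nat.eq_dec (q - 2) 0) as [->|E]; [simpl; rewrite Rinv_0; lra|].
    apply Rlt_le, Rinv_0_lt_compat, lt_0_INR; lia.
  - destruct (Nat.eq_dec (q - 2) 0) as [->|E]; [simpl; rewrite Rinv_0; lra|].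
    apply Rlt_le, Rinv_0_lt_compat, lt_0_INR; lia.
Qed.

Lemma Avg_const q c : prime (Z.of_nat q) -> (3 <= q)%nat -> Avg q (fun _ => c) = c.
Proof.
  intros Hq Hq3; unfold Avg; rewrite rsum_const, X_length by trivial; field.
  apply not_0_INR; lia.
Qed.

Lemma Avg_abs_le q f c : prime (Z.of_nat q) -> (3 <= q)%nat ->
  (forall chi, In chi (enum (X q)) -> Rabs (f chi) <= c) -> Rabs (Avg q f) <= c.
Proof.
  intros Hq Hq3 H; eapply Rle_trans; [apply Avg_abs|].
  rewrite <- (Avg_const q c) by trivial; apply Avg_le; trivial.
Qed.

Lemma Avg_nonneg q f : (forall chi, In chi (enum (X q)) -> 0 <= f chi) -> 0 <= Avg q f.
Proof.
  intros H; replace 0 with (Avg q (fun _ => 0)); [apply Avg_le; trivial|].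
  unfold Avg; rewrite rsum_const; ring.
Qed.

Lemma dmean_Avg q m l (f : (Z -> C) -> (nat -> C) -> R) z : (1 <= m)%nat -> torus z ->
  dmean m l (fun w => Avg q (fun chi => f chi w)) z = Avg q (fun chi => dmean m l (f chi) z).
Proof.
  intros Hm Hz; unfold Avg; rewrite dmean_scal, (dmean_rsum m l (enum (X q)) f) by trivial; trivial.
Qed.

(** Convolving with a product of Fejer kernels moves the average over [chi] to the uniform mean. *)
Lemma equidistribution l eps delta B : all_prime l -> NoDup l -> 0 < eps -> 0 < delta -> 0 <= B ->
  exists q0 m0, (3 <= q0)%nat /\ (1 <= m0)%nat /\
    forall q m f, (q0 <= q)%nat -> prime (Z.of_nat q) -> (m0 <= m)%nat ->
      torus_bounded B f -> torus_modulus l eps delta f ->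
      Rabs (Avg q (fun chi => f (char_pt chi)) - dmean m l f pt1) <= 3 * eps.
Proof.
  intros Hl Hnd He Hd HB.
  set (c := 2 * B / delta ^ 2 * (INR (length l) * 4)).
  assert (Hc : 0 <= c).
  { apply Rmult_le_pos; [apply Rdiv_le_0_compat; [lra|apply pow_lt; trivial]|].
    assert (H := pos_INR (length l)); lra. }
  (* The degree [N] brings the smoothing error [c / N] below [eps]. Only afterwards is [q] chosen,
     because the size of the box depends on [N]. *)
  destruct (nfloor_ex (c / eps)) as [N0 [_ HN0]]; [apply Rdiv_le_0_compat; trivial|].
  set (N := S N0).
  assert (HN : 0 < INR N) by (apply lt_0_INR; unfold N; lia).
  assert (HcN : c / INR N <= eps).
  { apply (Rmult_le_reg_r (INR N)); trivial; unfold Rdiv; rewrite Rmult_assoc, Rinv_l, Rmult_1_r by lra.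
    unfold N; rewrite S_INR; apply (Rmult_lt_compat_l eps) in HN0; trivial.
    replace (eps * (c / eps)) with c in HN0 by (field; lra); lra. }
  destruct (kernel_Avg N l Hl Hnd ltac:(unfold N; lia)) as [q1 [Hq1 HK]].
  set (D := B * INR N ^ length l).
  assert (HD : 0 <= D) by (apply Rmult_le_pos; [trivial|apply pow_le; lra]).
  destruct (nfloor_ex (D / eps)) as [Q [_ HQ]]; [apply Rdiv_le_0_compat; trivial|].
  exists (q1 + Q + 3)%nat, N; split; [lia|split; [unfold N; lia|]].
  intros q m f Hq0 Hq Hm Hfb Hfm.
  assert (HNm : (1 <= N <= m)%nat) by (unfold N in *; lia).
  set (F := fun chi w => f w * kernel N l (char_pt chi) w).
  (* The first term is the smoothing error at each character; the second is the deviation from 1 of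
     the kernel averaged over characters. *)
  assert (E : Avg q (fun chi => f (char_pt chi)) - dmean m l f pt1 =
    Avg q (fun chi => f (char_pt chi) - dmean m l (F chi) pt1) +
    dmean m l (fun w => f w * (Avg q (fun chi => kernel N l (char_pt chi) w) - 1)) pt1).
  { rewrite Avg_minus, <- (dmean_Avg q m l F pt1) by (lia || apply pt1_torus).
    rewrite (dmean_ext m l (fun w => f w * (Avg q (fun chi => kernel N l (char_pt chi) w) - 1))
      (fun w => Avg q (fun chi => F chi w) + -1 * f w)); [|apply pt1_torus|].
    - rewrite dmean_plus, dmean_scal by apply pt1_torus; ring.
    - intros w _; unfold F; rewrite Avg_scal; ring. }
  rewrite E; eapply Rle_trans; [apply Rabs_triang|].
  replace (3 * eps) with (2 * eps + eps) by ring; apply Rplus_le_compat.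
  - apply Avg_abs_le; trivial; [lia|]; intros chi _.
    eapply Rle_trans; [apply (kernel_approx N m l _ f B eps delta); trivial; [apply char_pt_torus|lra]|].
    replace (2 * B / delta ^ 2 * (INR (length l) * (4 / INR N))) with (c / INR N) by (unfold c; field; lra).
    lra.
  - rewrite <- (dmean_const m l eps pt1) by (lia || apply pt1_torus).
    apply dmean_abs; [apply pt1_torus|]; intros w Hw; rewrite Rabs_mult.
    specialize (HK q w ltac:(lia) Hq Hw).
    apply Rle_trans with (B * (INR N ^ length l / INR (q - 2))).
    + apply Rmult_le_compat; try apply Rabs_pos; trivial; apply Hfb; trivial.
    + replace (B * (INR N ^ length l / INR (q - 2))) with (D / INR (q - 2)) by (unfold D, Rdiv; ring).
      assert (HqQ : INR Q + 1 <= INR (q - 2)) by (rewrite <- S_INR; apply le_INR; lia).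
      assert (0 <= INR Q) by apply pos_INR.
      apply (Rmult_le_reg_r (INR (q - 2))); [lra|]; unfold Rdiv; rewrite Rmult_assoc, Rinv_l, Rmult_1_r by lra.
      apply (Rmult_lt_compat_l eps) in HQ; trivial.
      replace (eps * (D / eps)) with D in HQ by (field; lra); nra.
Qed.

(** * Integration over one coordinate *)

Lemma cos_Lipschitz a b : Rabs (cos a - cos b) <= Rabs (a - b).
Proof.
  destruct (MVT_abs cos (fun x => - sin x) b a) as [c [Hc _]].
  { intros; apply derivable_pt_lim_cos. }
  rewrite Hc, Rabs_Ropp; assert (H := SIN_bound c).
  assert (Rabs (sin c) <= 1) by (apply Rabs_le; lra); assert (H1 := Rabs_pos (a - b)); nra.
Qed.

Lemma sin_Lipschitz a b : Rabs (sin a - sin b) <= Rabs (a - b).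
Proof.
  destruct (MVT_abs sin cos b a) as [c [Hc _]].
  { intros; apply derivable_pt_lim_sin. }
  rewrite Hc; assert (H := COS_bound c).
  assert (Rabs (cos c) <= 1) by (apply Rabs_le; lra); assert (H1 := Rabs_pos (a - b)); nra.
Qed.

Lemma ce_Lipschitz x y : Cmod (ce x - ce y)%C <= 4 * PI * Rabs (x - y).
Proof.
  eapply Rle_trans; [apply Cmod_le_Re_Im|].
  replace (Re (ce x - ce y)) with (cos (2 * PI * x) - cos (2 * PI * y)) by (unfold Re; simpl; ring).
  replace (Im (ce x - ce y)) with (sin (2 * PI * x) - sin (2 * PI * y)) by (unfold Im; simpl; ring).
  assert (H1 := cos_Lipschitz (2 * PI * x) (2 * PI * y)).
  assert (H2 := sin_Lipschitz (2 * PI * x) (2 * PI * y)).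
  replace (2 * PI * x - 2 * PI * y) with (2 * PI * (x - y)) in * by ring.
  assert (HP := PI_RGT_0).
  rewrite Rabs_mult, (Rabs_pos_eq (2 * PI)) in * by lra; lra.
Qed.

Lemma continuous_eps (f : R -> R) x :
  (forall eps, 0 < eps -> exists delta, 0 < delta /\
     forall y, Rabs (y - x) < delta -> Rabs (f y - f x) <= eps) -> continuous f x.
Proof.
  intros H P [eps HP]; destruct (H (eps / 2)) as [delta [Hd H1]]; [assert (He := cond_pos eps); lra|].
  exists (mkposreal delta Hd); intros y Hy; apply HP.
  specialize (H1 y Hy); unfold ball; simpl; unfold AbsRing_ball, abs, minus, plus, opp; simpl.
  fold (Rminus (f y) (f x)); assert (He := cond_pos eps); lra.
Qed.

Lemma ex_RInt_cont (f : R -> R) a b : (forall x, continuous f x) -> ex_RInt f a b.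
Proof. intros H; apply (ex_RInt_continuous (V := R_CompleteNormedModule)); auto. Qed.

Lemma Riemann_sum_bound (g : R -> R) m eps : (1 <= m)%nat -> (forall x, continuous g x) ->
  (forall x y, Rabs (x - y) <= / INR m -> Rabs (g x - g y) <= eps) ->
  Rabs (/ INR m * rsum (seq 0 m) (fun j => g (INR j / INR m)) - RInt g 0 1) <= eps.
Proof.
  intros Hm Hg Hu; assert (Hm' : 0 < INR m) by (apply lt_0_INR; lia).
  assert (Hi : 0 < / INR m) by (apply Rinv_0_lt_compat; trivial).
  assert (He : 0 <= eps).
  { eapply Rle_trans; [apply Rabs_pos|apply (Hu 0 0)]; rewrite Rminus_diag, Rabs_R0; lra. }
  assert (H : forall k, Rabs (/ INR m * rsum (seq 0 k) (fun j => g (INR j / INR m)) - RInt g 0 (INR k / INR m))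
                 <= INR k * (/ INR m * eps)).
  { induction k as [|k IH].
    - simpl; unfold Rdiv; rewrite Rmult_0_l, Rmult_0_l, RInt_point, Rmult_0_r; unfold zero; simpl.
      rewrite Rminus_0_r, Rabs_R0; lra.
    - rewrite S_INR, seq_S, rsum_app; rewrite rsum_cons; simpl (rsum nil _); rewrite Nat.add_0_l, Rplus_0_r.
      rewrite <- (RInt_Chasles g 0 (INR k / INR m) ((INR k + 1) / INR m)) by (apply ex_RInt_cont; trivial).
      change plus with Rplus; set (I0 := RInt g 0 _) in *; set (S0 := rsum _ _) in *.
      assert (HI : Rabs (RInt (fun x => g x - g (INR k / INR m)) (INR k / INR m) ((INR k + 1) / INR m)) <= / INR m * eps).
      { replace (/ INR m * eps) with (((INR k + 1) / INR m - INR k / INR m) * eps) by (field; lra).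
        apply abs_RInt_le_const.
        - apply Rmult_le_compat_r; [lra|lra].
        - apply ex_RInt_cont; intros x; apply (continuous_minus (V := R_NormedModule)); [apply Hg|apply continuous_const].
        - intros t Ht; apply Hu; apply Rabs_le; unfold Rdiv in *; lra. }
      rewrite (RInt_minus (V := R_CompleteNormedModule)) in HI; [|apply ex_RInt_cont; trivial|apply ex_RInt_const].
      rewrite RInt_const in HI; unfold minus, plus, opp, scal in HI; simpl in HI; unfold mult in HI; simpl in HI.
      replace ((INR k + 1) / INR m - INR k / INR m) with (/ INR m) in HI by (field; lra).
      set (I1 := RInt g (INR k / INR m) ((INR k + 1) / INR m)) in *.
      replace (/ INR m * (S0 + g (INR k / INR m)) - (I0 + I1)) with
        ((/ INR m * S0 - I0) + - (I1 + - (/ INR m * g (INR k / INR m)))) by ring.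
      eapply Rle_trans; [apply Rabs_triang|]; rewrite Rabs_Ropp; lra. }
  specialize (H m); replace (INR m / INR m) with 1 in H by (field; lra).
  replace (INR m * (/ INR m * eps)) with eps in H by (field; lra); exact H.
Qed.

Definition torus_cont (l : list nat) (f : (nat -> C) -> R) : Prop :=
  forall eps, 0 < eps -> exists delta, 0 < delta /\ torus_modulus l eps delta f.

(** The conditional expectation of [f] given all coordinates other than [p]. *)
Definition torus_int (p : nat) (f : (nat -> C) -> R) (z : nat -> C) : R :=
  RInt (fun x => f (upd z p (ce x))) 0 1.

Lemma upd_modulus l eps delta f p z c c' : torus_modulus l eps delta f -> 0 < delta -> torus z ->
  Cmod c = 1 -> Cmod c' = 1 -> Cmod (c - c')%C < delta -> Rabs (f (upd z p c) - f (upd z p c')) <= eps.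
Proof.
  intros Hf Hd Hz Hc Hc' Hcc; apply Hf; try apply upd_torus; trivial.
  intros p' _; unfold upd; destruct (Nat.eq_dec p' p); trivial.
  replace (z p' - z p')%C with (RtoC 0) by ring; rewrite Cmod_0; trivial.
Qed.

Lemma torus_slice_cont l f p z : torus_cont l f -> torus z ->
  forall x, continuous (fun x => f (upd z p (ce x))) x.
Proof.
  intros Hf Hz x; apply continuous_eps; intros eps He; destruct (Hf eps He) as [delta [Hd Hm]].
  assert (HP := PI_RGT_0).
  exists (delta / (4 * PI)); split; [apply Rdiv_lt_0_compat; lra|]; intros y Hy.
  apply (upd_modulus l eps delta); trivial; try apply Cmod_ce.
  eapply Rle_lt_trans; [apply ce_Lipschitz|].
  apply (Rmult_lt_compat_l (4 * PI)) in Hy; [|lra].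
  replace (4 * PI * (delta / (4 * PI))) with delta in Hy by (field; lra); trivial.
Qed.

Lemma torus_int_bounded l f p B : torus_cont l f -> torus_bounded B f -> torus_bounded B (torus_int p f).
Proof.
  intros Hf HB z Hz; unfold torus_int; replace B with ((1 - 0) * B) by ring.
  apply abs_RInt_le_const; [lra|apply ex_RInt_cont, (torus_slice_cont l); trivial|].
  intros t _; apply HB, upd_torus; trivial; apply Cmod_ce.
Qed.

Lemma torus_int_modulus l f p eps delta : torus_cont l f -> 0 < delta ->
  torus_modulus l eps delta f -> torus_modulus l eps delta (torus_int p f).
Proof.
  intros Hf Hd Hm z w Hz Hw Hzw; unfold torus_int.
  assert (H1 := torus_slice_cont l f p z Hf Hz); assert (H2 := torus_slice_cont l f p w Hf Hw).
  assert (E := RInt_minus (V := R_CompleteNormedModule) _ _ 0 1 (ex_RInt_cont _ 0 1 H1) (ex_RInt_cont _ 0 1 H2)).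
  unfold minus, plus, opp in E; simpl in E; unfold Rminus; rewrite <- E.
  replace eps with ((1 - 0) * eps) by ring; apply abs_RInt_le_const; [lra| |].
  - apply ex_RInt_cont; intros x; apply (continuous_minus (V := R_NormedModule)); trivial.
  - intros t _; apply Hm; try (apply upd_torus; trivial; apply Cmod_ce).
    intros p' Hp'; unfold upd; destruct (Nat.eq_dec p' p); auto.
    replace (ce t - ce t)%C with (RtoC 0) by ring; rewrite Cmod_0; trivial.
Qed.

Lemma torus_int_dmean l p m f eps delta : (1 <= m)%nat -> torus_cont (p :: l) f -> 0 < delta ->
  torus_modulus (p :: l) eps delta f -> 4 * PI / INR m < delta ->
  Rabs (dmean m (p :: l) f pt1 - dmean m (p :: l) (torus_int p f) pt1) <= eps.
Proof.
  intros Hm Hf Hd Hmod Hmd; simpl.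
  assert (Hm' : 0 < INR m) by (apply lt_0_INR; lia).
  rewrite (dmean_ext m l (fun z => cmean m (fun c => torus_int p f (upd z p c))) (torus_int p f)); [|apply pt1_torus|].
  2:{ intros w _; rewrite <- (cmean_const m (torus_int p f w) Hm); unfold cmean; f_equal.
      apply rsum_ext; intros j _; unfold torus_int.
      apply RInt_ext; intros x _; rewrite upd_upd; trivial. }
  rewrite <- (dmean_const m l eps pt1 Hm pt1_torus).
  replace (dmean m l (fun z => cmean m (fun c => f (upd z p c))) pt1 - dmean m l (torus_int p f) pt1) with
    (dmean m l (fun z => cmean m (fun c => f (upd z p c)) + -1 * torus_int p f z) pt1)
    by (rewrite dmean_plus, dmean_scal by apply pt1_torus; ring).
  apply dmean_abs; [apply pt1_torus|]; intros w Hw.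
  replace (cmean m (fun c => f (upd w p c)) + -1 * torus_int p f w) with
    (cmean m (fun c => f (upd w p c)) - torus_int p f w) by ring.
  apply (Riemann_sum_bound (fun x => f (upd w p (ce x)))); trivial.
  - apply (torus_slice_cont (p :: l)); trivial.
  - intros x y Hxy; apply (upd_modulus (p :: l) eps delta); trivial; try apply Cmod_ce.
    eapply Rle_lt_trans; [apply ce_Lipschitz|].
    eapply Rle_lt_trans; [|exact Hmd]; assert (HP := PI_RGT_0).
    unfold Rdiv; apply Rmult_le_compat_l; [lra|trivial].
Qed.

Lemma torus_modulus_incl l l' eps delta f : incl l l' -> torus_modulus l eps delta f -> torus_modulus l' eps delta f.
Proof. intros Hi Hm z w Hz Hw H; apply Hm; auto. Qed.

Lemma torus_cont_incl l l' f : incl l l' -> torus_cont l f -> torus_cont l' f.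
Proof.
  intros Hi Hf eps He; destruct (Hf eps He) as [delta [Hd Hm]]; exists delta; split; trivial.
  apply (torus_modulus_incl l); trivial.
Qed.

(** In the limit [chi p] is uniform and independent of the other values. Both averages are compared
    with discrete means of fine mesh, at a cost of [3 * eps] each, and the two discrete means differ
    by a Riemann sum error of at most [eps]. *)
Lemma torus_int_Avg l p eps delta B : all_prime l -> NoDup l -> In p l -> 0 < eps -> 0 < delta -> 0 <= B ->
  exists q0, (3 <= q0)%nat /\ forall q f, (q0 <= q)%nat -> prime (Z.of_nat q) ->
    torus_bounded B f -> torus_modulus l eps delta f -> torus_cont l f ->
    Rabs (Avg q (fun chi => f (char_pt chi)) - Avg q (fun chi => torus_int p f (char_pt chi))) <= 7 * eps.
Proof.
  intros Hl Hnd Hp He Hd HB.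
  destruct (in_split p l Hp) as [l1 [l2 E]].
  (* [p] is moved to the head because [dmean] treats the head as the innermost variable. *)
  assert (HP : Permutation l (p :: l1 ++ l2)) by (rewrite E; apply Permutation_sym, Permutation_middle).
  set (l' := l1 ++ l2) in *.
  assert (Hnd' : NoDup (p :: l')) by (apply (Permutation_NoDup HP); trivial).
  assert (Hl' : all_prime (p :: l')) by (intros x Hx; apply Hl; apply (Permutation_in _ (Permutation_sym HP)); trivial).
  assert (Hi : incl l (p :: l')) by (intros x Hx; apply (Permutation_in _ HP); trivial).
  destruct (equidistribution (p :: l') eps delta B Hl' Hnd' He Hd HB) as [q0 [m0 [Hq0 [Hm0 H]]]].
  exists q0; split; trivial; intros q f Hq Hqp Hfb Hfm Hfc.
  assert (Hpi := PI_RGT_0).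
  destruct (nfloor_ex (4 * PI / delta)) as [M [_ HM]]; [apply Rdiv_le_0_compat; lra|].
  set (m := (m0 + S M)%nat).
  assert (Hfm' := torus_modulus_incl l _ _ _ _ Hi Hfm); assert (Hfc' := torus_cont_incl l _ _ Hi Hfc).
  assert (A1 := H q m f Hq Hqp ltac:(unfold m; lia) Hfb Hfm').
  assert (A2 := H q m (torus_int p f) Hq Hqp ltac:(unfold m; lia) (torus_int_bounded _ _ _ _ Hfc' Hfb)
    (torus_int_modulus _ _ _ _ _ Hfc' Hd Hfm')).
  assert (A3 := torus_int_dmean l' p m f eps delta ltac:(unfold m; lia) Hfc' Hd Hfm').
  assert (Hmd : 4 * PI / INR m < delta).
  { assert (HmM : INR M + 1 <= INR m) by (rewrite <- S_INR; apply le_INR; unfold m; lia).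
    assert (0 <= INR M) by apply pos_INR.
    apply (Rmult_lt_reg_r (INR m)); [lra|]; unfold Rdiv; rewrite Rmult_assoc, Rinv_l, Rmult_1_r by lra.
    apply (Rmult_lt_compat_l delta) in HM; trivial.
    replace (delta * (4 * PI / delta)) with (4 * PI) in HM by (field; lra); nra. }
  specialize (A3 Hmd).
  apply Rabs_le_between in A1; apply Rabs_le_between in A2; apply Rabs_le_between in A3.
  apply Rabs_le; lra.
Qed.

Lemma Avg_Cauchy l eps delta B : all_prime l -> NoDup l -> 0 < eps -> 0 < delta -> 0 <= B ->
  exists q0, (3 <= q0)%nat /\ forall q q' f, (q0 <= q)%nat -> prime (Z.of_nat q) ->
    (q0 <= q')%nat -> prime (Z.of_nat q') ->
    torus_bounded B f -> torus_modulus l eps delta f ->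
    Rabs (Avg q (fun chi => f (char_pt chi)) - Avg q' (fun chi => f (char_pt chi))) <= 6 * eps.
Proof.
  intros Hl Hnd He Hd HB.
  destruct (equidistribution l eps delta B Hl Hnd He Hd HB) as [q0 [m0 [Hq0 [Hm0 H]]]].
  exists q0; split; trivial; intros q q' f Hq Hqp Hq' Hqp' Hfb Hfm.
  assert (A1 := H q m0 f Hq Hqp (Nat.le_refl _) Hfb Hfm).
  assert (A2 := H q' m0 f Hq' Hqp' (Nat.le_refl _) Hfb Hfm).
  apply Rabs_le_between in A1; apply Rabs_le_between in A2; apply Rabs_le; lra.
Qed.

(** The limit is taken along chosen primes [pr i > i]; the Cauchy condition then transfers it to all
    primes, with the same rate for every [u]. *)
Lemma uniform_limit_along_primes {U : Type} (s : nat -> U -> R) :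
  (forall eps, 0 < eps -> exists q0, forall q q' u, (q0 <= q)%nat -> prime (Z.of_nat q) ->
     (q0 <= q')%nat -> prime (Z.of_nat q') -> Rabs (s q u - s q' u) <= eps) ->
  exists m : U -> R, forall eps, 0 < eps -> exists q0, forall q u, (q0 <= q)%nat -> prime (Z.of_nat q) ->
     Rabs (s q u - m u) <= eps.
Proof.
  intros H.
  set (pr := fun i => epsilon (inhabits 0%nat) (fun q => (i < q)%nat /\ prime (Z.of_nat q))).
  assert (Hpr : forall i, (i < pr i)%nat /\ prime (Z.of_nat (pr i))).
  { intros i; unfold pr; apply epsilon_spec, PrimeFieldUnits.prime_above. }
  exists (fun u => real (Lim_seq (fun i => s (pr i) u))).
  intros eps He; destruct (H eps He) as [q0 Hq0]; exists q0; intros q u Hq Hqp.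
  assert (Hlim : is_lim_seq (fun i => s (pr i) u) (real (Lim_seq (fun i => s (pr i) u)))).
  { apply Lim_seq_correct', ex_lim_seq_cauchy_corr; intros e.
    destruct (H (e / 2)) as [q1 Hq1]; [assert (He' := cond_pos e); lra|].
    exists q1; intros n n' Hn Hn'; destruct (Hpr n), (Hpr n').
    assert (He' := cond_pos e); apply Rle_lt_trans with (e / 2); [|lra]; apply Hq1; trivial; lia. }
  apply Rabs_le; split.
  - assert (L : Rbar_le (real (Lim_seq (fun i => s (pr i) u))) (s q u + eps)).
    { refine (is_lim_seq_le_loc _ _ _ _ _ Hlim (is_lim_seq_const _)); exists q0; intros n Hn.
      destruct (Hpr n); assert (B := Hq0 q (pr n) u Hq Hqp ltac:(lia) ltac:(trivial)).
      apply Rabs_le_between in B; lra. }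
    simpl in L; lra.
  - assert (L : Rbar_le (s q u - eps) (real (Lim_seq (fun i => s (pr i) u)))).
    { refine (is_lim_seq_le_loc _ _ _ _ _ (is_lim_seq_const _) Hlim); exists q0; intros n Hn.
      destruct (Hpr n); assert (B := Hq0 q (pr n) u Hq Hqp ltac:(lia) ltac:(trivial)).
      apply Rabs_le_between in B; lra. }
    simpl in L; lra.
Qed.

(** * The smoothed density of one local factor *)

(* Coquelicot integrals have type [R_CompleteNormedModule], which hides the field structure. *)
Ltac eq_in_R := match goal with |- @eq _ ?a ?b => change (@eq R a b) end.

Lemma cont_plus (f g : R -> R) x : continuous f x -> continuous g x -> continuous (fun y => f y + g y) x.
Proof. apply (continuous_plus (V := R_NormedModule)). Qed.

Lemma cont_opp (f : R -> R) x : continuous f x -> continuous (fun y => - f y) x.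
Proof. apply (continuous_opp (V := R_NormedModule)). Qed.

Lemma cont_minus (f g : R -> R) x : continuous f x -> continuous g x -> continuous (fun y => f y - g y) x.
Proof. apply (continuous_minus (V := R_NormedModule)). Qed.

Lemma cont_mult (f g : R -> R) x : continuous f x -> continuous g x -> continuous (fun y => f y * g y) x.
Proof. apply (continuous_mult (K := R_AbsRing)). Qed.

Lemma cont_max (f g : R -> R) x : continuous f x -> continuous g x -> continuous (fun y => Rmax (f y) (g y)) x.
Proof.
  intros Hf Hg; apply (continuous_ext (fun y => (f y + g y + Rabs (f y - g y)) * / 2)).
  - intros y; unfold Rmax, Rabs; destruct (Rle_dec _ _), (Rcase_abs _); lra.
  - apply cont_mult; [|apply continuous_const]; apply cont_plus; [apply cont_plus; trivial|].
    apply continuous_Rabs_comp, cont_minus; trivial.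
Qed.

Lemma continuous_derive (f : R -> R) df x : is_derive f x df -> continuous f x.
Proof. intros H; apply (ex_derive_continuous (V := R_NormedModule)); eexists; exact H. Qed.

(** The mean over the circle of [1 / (1 + A * sin ^ 2)] is [1 / sqrt (1 + A)]. This choice of [A]
    makes the mean of [bad k] exactly [/ 2 ^ k], and makes [bad 0] constantly 1. *)
Definition bad_level (k : nat) : R := 4 ^ k - 1.

Lemma bad_level_nonneg k : 0 <= bad_level k.
Proof. unfold bad_level; assert (H : 1 <= 4 ^ k) by (apply pow_R1_Rle; lra); lra. Qed.

Lemma bad_level_incr k : bad_level k <= bad_level (S k).
Proof. unfold bad_level; assert (H : 1 <= 4 ^ k) by (apply pow_R1_Rle; lra); simpl; lra. Qed.

(** As [k] grows, [bad k] concentrates near the critical points [1] and [-1] of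
    [local_log r] on the circle; the increment [bad k - bad (S k)] vanishes
    to second order there. *)
Definition bad (k : nat) (z : C) : R := / (1 + bad_level k * Im z ^ 2).

Definition gap (k : nat) (z : C) : R := bad k z - bad (S k) z.

(** The quotient of [gap k] by the squared sine, as a function [t] of that square. It stays regular
    at [t = 0], so the sine that the change of variable puts in the denominator is cancelled with
    one to spare. *)
Definition gap_ratio (k : nat) (t : R) : R :=
  (bad_level (S k) - bad_level k) * / ((1 + bad_level k * t) * (1 + bad_level (S k) * t)).

Lemma bad_pos k z : 0 < bad k z.
Proof.
  apply Rinv_0_lt_compat; assert (H := bad_level_nonneg k); assert (H1 := pow2_ge_0 (Im z)); nra.
Qed.

Lemma bad_le_1 k z : bad k z <= 1.
Proof.
  unfold bad; assert (H := bad_level_nonneg k); assert (H1 := pow2_ge_0 (Im z)).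
  apply Rle_trans with (/ 1); [apply Rinv_le_contravar; [lra|nra]|rewrite Rinv_1; lra].
Qed.

Lemma bad_0 z : bad 0 z = 1.
Proof. unfold bad, bad_level; simpl; field. Qed.

Lemma gap_eq k z : gap k z = Im z ^ 2 * gap_ratio k (Im z ^ 2).
Proof.
  unfold gap, bad, gap_ratio; assert (H1 := pow2_ge_0 (Im z)).
  assert (H := bad_level_nonneg k); assert (H' := bad_level_nonneg (S k)); field; split; nra.
Qed.

Lemma gap_ratio_nonneg k t : 0 <= t -> 0 <= gap_ratio k t.
Proof.
  intros Ht; assert (H := bad_level_nonneg k); assert (H' := bad_level_nonneg (S k)).
  assert (Hi := bad_level_incr k).
  apply Rmult_le_pos; [lra|apply Rlt_le, Rinv_0_lt_compat, Rmult_lt_0_compat; nra].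
Qed.

Lemma gap_nonneg k z : 0 <= gap k z.
Proof.
  rewrite gap_eq; apply Rmult_le_pos; [apply pow2_ge_0|apply gap_ratio_nonneg, pow2_ge_0].
Qed.

(** Discarding the lower level leaves [b / (1 + b * t)] with [b = 4 ^ (S k) - 1]. By the inequality
    of arithmetic and geometric means, [sqrt t] times this is at most [sqrt b / 2], which is below
    [2 ^ k]. *)
Lemma gap_ratio_bound k t : 0 <= t -> sqrt t * gap_ratio k t <= 2 ^ k.
Proof.
  intros Ht; set (s := sqrt t); assert (Hs : 0 <= s) by apply sqrt_pos.
  assert (Hst : t = s * s) by (unfold s; rewrite sqrt_sqrt; trivial).
  set (a := bad_level k); set (b := bad_level (S k)); set (c := 2 ^ k).
  assert (Ha : 0 <= a) by apply bad_level_nonneg.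
  assert (Hc : 0 < c) by (apply pow_lt; lra).
  assert (Hb : b = 4 * (c * c) - 1).
  { unfold b, bad_level, c; simpl; rewrite <- Rpow_mult_distr; replace (2 * 2) with 4 by ring; ring. }
  assert (Hb0 : 0 <= b) by apply bad_level_nonneg.
  assert (H1 : gap_ratio k t <= b * / (1 + b * t)).
  { unfold gap_ratio; fold a b; rewrite Rinv_mult, <- Rmult_assoc.
    apply Rmult_le_compat_r; [apply Rlt_le, Rinv_0_lt_compat; nra|].
    apply (Rmult_le_reg_r (1 + a * t)); [nra|]; rewrite Rmult_assoc, Rinv_l by nra.
    assert (0 <= a * t) by nra; nra. }
  apply Rle_trans with (s * (b * / (1 + b * t))); [apply Rmult_le_compat_l; trivial|].
  apply (Rmult_le_reg_r (1 + b * t)); [nra|].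
  replace (s * (b * / (1 + b * t)) * (1 + b * t)) with (s * b) by (field; nra).
  rewrite Hst; assert (H2 : 0 <= b * ((2 * c * s - 1) * (2 * c * s - 1))) by (apply Rmult_le_pos; [trivial|apply Rle_0_sqr]).
  apply (Rmult_le_reg_l (4 * c)); [lra|]; lra.
Qed.

Lemma local_log_ce r x : local_log r (ce x) = - ln (1 + r ^ 2 - 2 * r * cos (2 * PI * x)).
Proof.
  unfold local_log; rewrite Cmod_sqr; do 2 f_equal; unfold Re, Im, ce; simpl.
  assert (H := sin2_cos2 (2 * PI * x)); unfold Rsqr in H; nra.
Qed.

Lemma Im_ce x : Im (ce x) = sin (2 * PI * x).
Proof. reflexivity. Qed.

Lemma log_arg_pos r t : 0 < r < 1 -> 0 < 1 + r ^ 2 - 2 * r * cos t.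
Proof. intros Hr; assert (H := COS_bound t); nra. Qed.

(** The density of [local_log r] under the measure [gap k] times arc length: [K] is the cosine of
    the two angles at which [local_log r] equals [u], and [T] the square of their sine. *)
Definition local_density (k : nat) (r u : R) : R :=
  let K := (1 + r ^ 2 - exp (- u)) * / (2 * r) in
  let T := Rmax 0 (1 - K ^ 2) in
  sqrt T * gap_ratio k T * (exp (- u) * / (2 * PI * r)).

Lemma local_density_cont k r u : 0 < r -> continuous (local_density k r) u.
Proof.
  intros Hr; unfold local_density.
  assert (HE : continuous (fun u => exp (- u)) u) by (apply continuous_exp_comp, cont_opp, continuous_id).
  assert (HT : continuous (fun u => Rmax 0 (1 - ((1 + r ^ 2 - exp (- u)) * / (2 * r)) ^ 2)) u).
  { apply cont_max; [apply continuous_const|].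
    apply cont_minus; [apply continuous_const|]; simpl.
    assert (HK : continuous (fun u => (1 + r * (r * 1) - exp (- u)) * / (2 * r)) u).
    { apply cont_mult; [|apply continuous_const]; apply cont_minus; [apply continuous_const|trivial]. }
    apply cont_mult; [trivial|apply cont_mult; [trivial|apply continuous_const]]. }
  apply cont_mult; [|apply cont_mult; [trivial|apply continuous_const]].
  apply cont_mult; [apply continuous_sqrt_comp; trivial|].
  unfold gap_ratio; apply cont_mult; [apply continuous_const|].
  assert (H := bad_level_nonneg k); assert (H' := bad_level_nonneg (S k)).
  apply continuous_Rinv_comp.
  - apply cont_mult; apply cont_plus; try apply continuous_const;
      (apply cont_mult; [apply continuous_const|trivial]).
  - assert (H0 := Rmax_l 0 (1 - ((1 + r ^ 2 - exp (- u)) * / (2 * r)) ^ 2)).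
    apply Rmult_integral_contrapositive_currified; nra.
Qed.

Lemma local_density_nonneg k r u : 0 < r -> 0 <= local_density k r u.
Proof.
  intros Hr; unfold local_density; apply Rmult_le_pos.
  - apply Rmult_le_pos; [apply sqrt_pos|apply gap_ratio_nonneg, Rmax_l].
  - apply Rmult_le_pos; [apply Rlt_le, exp_pos|]; assert (HP := PI_RGT_0).
    apply Rlt_le, Rinv_0_lt_compat; nra.
Qed.

(** Beyond the range of [local_log r] the cosine [K] leaves the interval from -1 to 1; then [T] is
    truncated to 0 and the factor [sqrt T] vanishes. *)
Lemma local_density_support k r u : 0 < r < 1 ->
  exp (- u) <= (1 - r) ^ 2 \/ (1 + r) ^ 2 <= exp (- u) -> local_density k r u = 0.
Proof.
  intros Hr Hu; unfold local_density.
  set (K := (1 + r ^ 2 - exp (- u)) * / (2 * r)).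
  assert (HK : K * (2 * r) = 1 + r ^ 2 - exp (- u)) by (unfold K; field; lra).
  assert (HK1 : 1 <= K \/ K <= -1) by (destruct Hu; [left|right]; nra).
  rewrite (Rmax_left 0) by (destruct HK1; nra); rewrite sqrt_0; ring.
Qed.

(** On the support [exp (- u)] is at most [(1 + r) ^ 2 <= 4], which is less than [2 * PI]. *)
Lemma local_density_bound k r u : 0 < r < 1 -> local_density k r u <= 2 ^ k * / r.
Proof.
  intros Hr; assert (H2 : 0 < 2 ^ k) by (apply pow_lt; lra); assert (Hi := Rinv_0_lt_compat r (proj1 Hr)).
  destruct (Rle_lt_dec ((1 + r) ^ 2) (exp (- u))) as [H|H].
  { rewrite local_density_support by auto; nra. }
  unfold local_density; set (T := Rmax _ _).
  assert (HT : 0 <= T) by apply Rmax_l.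
  apply Rmult_le_compat.
  - apply Rmult_le_pos; [apply sqrt_pos|apply gap_ratio_nonneg; trivial].
  - assert (HP := PI_RGT_0); apply Rmult_le_pos; [apply Rlt_le, exp_pos|apply Rlt_le, Rinv_0_lt_compat; nra].
  - apply gap_ratio_bound; trivial.
  - assert (HP : 3 < PI) by (assert (HP := PI2_3_2); lra).
    assert (He : exp (- u) <= 4) by nra.
    rewrite Rinv_mult, <- Rmult_assoc; rewrite <- (Rmult_1_l (/ r)) at 2.
    apply Rmult_le_compat_r; [lra|].
    apply (Rmult_le_reg_r (2 * PI)); [lra|]; rewrite Rmult_assoc, Rinv_l by lra; lra.
Qed.

Lemma local_log_derive r x : 0 < r < 1 ->
  is_derive (fun x => - ln (1 + r ^ 2 - 2 * r * cos (2 * PI * x))) x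
    (- (4 * PI * r * sin (2 * PI * x)) * / (1 + r ^ 2 - 2 * r * cos (2 * PI * x))).
Proof.
  intros Hr; assert (H := log_arg_pos r (2 * PI * x) Hr).
  auto_derive; [simpl in H; lra|field; simpl in H; lra].
Qed.

(** [local_log r] is monotone on each half of the circle. Each half contributes one half of the
    integral against [local_density], with the orientation reversed on the first. *)
Lemma local_density_substitution k r (G : R -> R) : 0 < r < 1 -> (forall u, continuous G u) ->
  RInt (fun x => G (local_log r (ce x)) * gap k (ce x)) 0 1 =
  RInt (fun u => G u * local_density k r u) (- ln ((1 + r) ^ 2)) (- ln ((1 - r) ^ 2)).
Proof.
  intros Hr HG; assert (HP := PI_RGT_0).
  set (h := fun x => - ln (1 + r ^ 2 - 2 * r * cos (2 * PI * x))).
  set (h' := fun x => - (4 * PI * r * sin (2 * PI * x)) * / (1 + r ^ 2 - 2 * r * cos (2 * PI * x))).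
  set (Gf := fun u => G u * local_density k r u).
  assert (HGf : forall u, continuous Gf u) by (intros u; apply cont_mult; [apply HG|apply local_density_cont; lra]).
  assert (Hh : forall x, is_derive h x (h' x)) by (intros; apply local_log_derive; trivial).
  assert (Hsincos : forall t, sin t ^ 2 = 1 - cos t ^ 2).
  { intros t; assert (E := sin2_cos2 t); unfold Rsqr in E; nra. }
  assert (Hsc : forall t x, continuous (fun x => sin (t * x)) x /\ continuous (fun x => cos (t * x)) x).
  { intros t x; split.
    - apply (continuous_derive _ (t * cos (t * x))); auto_derive; trivial; ring.
    - apply (continuous_derive _ (- t * sin (t * x))); auto_derive; trivial; ring. }
  assert (Hh' : forall x, continuous h' x).
  { intros x; unfold h'; destruct (Hsc (2 * PI) x) as [H1 H2]; apply cont_mult.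
    - apply cont_opp, cont_mult; [apply continuous_const|trivial].
    - apply continuous_Rinv_comp; [|assert (H := log_arg_pos r (2 * PI * x) Hr); lra].
      apply cont_minus; [apply continuous_const|apply cont_mult; [apply continuous_const|trivial]]. }
  (* The derivative supplies the sine with its sign and [sqrt T] supplies its absolute value, so
     their product is plus or minus the squared sine in [gap k] according to the half of the
     circle. *)
  assert (Hval : forall x, h' x * Gf (h x) =
    - 2 * (G (h x) * (sin (2 * PI * x) * Rabs (sin (2 * PI * x)) * gap_ratio k (sin (2 * PI * x) ^ 2)))).
  { intros x; unfold Gf, local_density, h'; assert (Hp := log_arg_pos r (2 * PI * x) Hr).
    replace (exp (- h x)) with (1 + r ^ 2 - 2 * r * cos (2 * PI * x))
      by (unfold h; rewrite Ropp_involutive, exp_ln; trivial).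
    replace ((1 + r ^ 2 - (1 + r ^ 2 - 2 * r * cos (2 * PI * x))) * / (2 * r)) with (cos (2 * PI * x)) by (field; lra).
    rewrite <- Hsincos, Rmax_right by apply pow2_ge_0.
    replace (sqrt (sin (2 * PI * x) ^ 2)) with (Rabs (sin (2 * PI * x)))
      by (rewrite <- sqrt_Rsqr_abs, Rsqr_pow2; trivial).
    field; lra. }
  assert (Hloc : forall x, G (local_log r (ce x)) * gap k (ce x) =
    G (h x) * (sin (2 * PI * x) ^ 2 * gap_ratio k (sin (2 * PI * x) ^ 2))).
  { intros x; rewrite local_log_ce, gap_eq, Im_ce; trivial. }
  assert (Hint : forall a b, RInt (fun x => h' x * Gf (h x)) a b = RInt Gf (h a) (h b)).
  { intros a b; apply (RInt_comp Gf h h'); auto. }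
  assert (Hcont : forall x, continuous (fun x => h' x * Gf (h x)) x).
  { intros x; apply cont_mult; [apply Hh'|].
    apply (continuous_comp h Gf); [apply (continuous_derive _ (h' x)), Hh|apply HGf]. }
  assert (Hscal : forall c a b, RInt (fun x => c * (h' x * Gf (h x))) a b = c * RInt (fun x => h' x * Gf (h x)) a b).
  { intros c a b; apply (RInt_scal (V := R_CompleteNormedModule)), ex_RInt_cont, Hcont. }
  assert (H0 : h 0 = - ln ((1 - r) ^ 2)).
  { unfold h; rewrite Rmult_0_r, cos_0; do 2 f_equal; ring. }
  assert (H1 : h 1 = - ln ((1 - r) ^ 2)).
  { unfold h; rewrite Rmult_1_r, cos_2PI; do 2 f_equal; ring. }
  assert (H2 : h (1 / 2) = - ln ((1 + r) ^ 2)).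
  { unfold h; replace (2 * PI * (1 / 2)) with PI by field; rewrite cos_PI; do 2 f_equal; ring. }
  assert (Hex : forall a b, ex_RInt (fun x => G (local_log r (ce x)) * gap k (ce x)) a b).
  { intros a b; apply ex_RInt_cont; intros x.
    apply (continuous_ext (fun x => G (h x) * (sin (2 * PI * x) ^ 2 * gap_ratio k (sin (2 * PI * x) ^ 2)))).
    { intros y; symmetry; apply Hloc. }
    assert (Hs2 : continuous (fun x => sin (2 * PI * x) ^ 2) x).
    { destruct (Hsc (2 * PI) x) as [Hs _]; simpl.
      apply cont_mult; [exact Hs|apply cont_mult; [exact Hs|apply continuous_const]]. }
    apply cont_mult; [apply (continuous_comp h G); [apply (continuous_derive _ (h' x)), Hh|apply HG]|].
    apply cont_mult; [trivial|]; unfold gap_ratio; apply cont_mult; [apply continuous_const|].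
    assert (B := bad_level_nonneg k); assert (B' := bad_level_nonneg (S k)).
    assert (B2 := pow2_ge_0 (sin (2 * PI * x))).
    apply continuous_Rinv_comp.
    - apply cont_mult; apply cont_plus; try apply continuous_const;
      (apply cont_mult; [apply continuous_const|trivial]).
    - apply Rmult_integral_contrapositive_currified; nra. }
  rewrite <- (RInt_Chasles _ 0 (1 / 2) 1) by apply Hex.
  change plus with Rplus.
  rewrite (RInt_ext _ (fun x => - / 2 * (h' x * Gf (h x))) 0 (1 / 2)).
  2:{ intros x; rewrite Rmin_left, Rmax_right by lra; intros Hx; rewrite Hloc, Hval.
      assert (Hs : 0 <= sin (2 * PI * x)) by (apply sin_ge_0; nra).
      rewrite (Rabs_pos_eq _ Hs); eq_in_R; field. }
  rewrite (RInt_ext _ (fun x => / 2 * (h' x * Gf (h x))) (1 / 2) 1).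
  2:{ intros x; rewrite Rmin_left, Rmax_right by lra; intros Hx; rewrite Hloc, Hval.
      assert (Hs : sin (2 * PI * x) <= 0) by (apply sin_le_0; nra).
      rewrite (Rabs_left1 _ Hs); eq_in_R; field. }
  rewrite !Hscal, !Hint, H0, H1, H2.
  rewrite <- (opp_RInt_swap Gf (- ln ((1 + r) ^ 2))) by (apply ex_RInt_cont; trivial).
  change opp with Ropp; unfold Gf; lra.
Qed.

Lemma bad_integral k : is_RInt (fun x => bad k (ce x)) 0 1 (/ 2 ^ k).
Proof.
  set (b := 2 ^ k); assert (HP := PI_RGT_0).
  assert (Hb : 1 <= b) by (apply pow_R1_Rle; lra).
  assert (Hlev : bad_level k = b * b - 1).
  { unfold bad_level, b; rewrite <- Rpow_mult_distr; do 2 f_equal; ring. }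
  (* For this radius, [bad k (ce x)] is [/ b] times the Poisson kernel at the angle [4 * PI * x]. *)
  set (rho := (b - 1) / (b + 1)).
  assert (Hrho : 0 <= rho < 1).
  { unfold rho; split; [apply Rdiv_le_0_compat; lra|].
    apply (Rmult_lt_reg_r (b + 1)); [lra|]; unfold Rdiv; rewrite Rmult_assoc, Rinv_l; lra. }
  (* The Poisson kernel 1 + 2 (rho cos t + rho^2 cos 2t + ...), integrated termwise. *)
  set (F := fun x => / (2 * PI * b) * (2 * PI * x + atan (rho * sin (4 * PI * x) / (1 - rho * cos (4 * PI * x))))).
  assert (E : minus (F 1) (F 0) = / b).
  { unfold F, minus, plus, opp; simpl; rewrite !Rmult_1_r, !Rmult_0_r, sin_0.
    replace (4 * PI) with (0 + 2 * INR 2 * PI) by (simpl; ring); rewrite sin_period, sin_0.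
    unfold Rdiv; rewrite Rmult_0_r, !Rmult_0_l, atan_0; field; lra. }
  rewrite <- E; apply (is_RInt_derive (V := R_CompleteNormedModule)).
  - intros x _; unfold bad; rewrite Im_ce, Hlev.
    assert (Hc := COS_bound (4 * PI * x)).
    assert (Hd : 0 < 1 - rho * cos (4 * PI * x)) by nra.
    assert (Hcs : sin (2 * PI * x) ^ 2 = (1 - cos (4 * PI * x)) / 2).
    { replace (4 * PI * x) with (2 * (2 * PI * x)) by ring; rewrite cos_2a_sin; lra. }
    assert (Hss : sin (4 * PI * x) ^ 2 = 1 - cos (4 * PI * x) ^ 2).
    { assert (Es := sin2_cos2 (4 * PI * x)); unfold Rsqr in Es; nra. }
    rewrite Hcs.
    assert (HD1 : 0 < 1 - 2 * rho * cos (4 * PI * x) + rho ^ 2) by nra.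
    unfold F; auto_derive; [lra|].
    set (c := cos (4 * PI * x)) in *; set (s := sin (4 * PI * x)) in *.
    set (Q := 1 - 2 * rho * c + rho ^ 2) in *.
    match goal with |- context [/ (1 + rho * s * ?w * ?y)] => replace (1 + rho * s * w * y) with (Q * / ((1 - rho * c) * (1 - rho * c))) end.
    2:{ transitivity (((1 - rho * c) * (1 - rho * c) + rho ^ 2 * s ^ 2) * / ((1 - rho * c) * (1 - rho * c)));
          [rewrite Hss; f_equal; unfold Q; ring|field; lra]. }
    transitivity ((1 - rho ^ 2) / (b * Q)).
    + transitivity (/ (2 * PI * b) * (2 * PI + 4 * PI * rho * (c * (1 - rho * c) - rho * s ^ 2) * / Q)).
      * field; repeat split; lra.
      * rewrite Hss; replace (c * (1 - rho * c) - rho * (1 - c ^ 2)) with (c - rho) by ring.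
        transitivity ((Q + 2 * rho * (c - rho)) / (b * Q)); [field; repeat split; lra|].
        unfold Rdiv; f_equal; unfold Q; ring.
    + assert (HQ : Q = (2 * b ^ 2 + 2 - 2 * (b ^ 2 - 1) * c) / (b + 1) ^ 2) by (unfold Q, rho; field; lra).
      assert (HR : 1 - rho ^ 2 = 4 * b / (b + 1) ^ 2) by (unfold rho; field; lra).
      assert (HQ2 : 0 < 2 * b ^ 2 + 2 - 2 * (b ^ 2 - 1) * c).
      { rewrite HQ in HD1; apply (Rmult_lt_compat_r ((b + 1) ^ 2)) in HD1; [|nra].
        unfold Rdiv in HD1; rewrite Rmult_assoc, Rinv_l, Rmult_0_l, Rmult_1_r in HD1 by nra; exact HD1. }
      rewrite HQ, HR; field; repeat split; nra.
  - intros x _; unfold bad; assert (B := bad_level_nonneg k); assert (B2 := pow2_ge_0 (Im (ce x))).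
    apply continuous_Rinv_comp; [|nra].
    apply cont_plus; [apply continuous_const|]; apply cont_mult; [apply continuous_const|].
    assert (Hs : continuous (fun x => sin (2 * PI * x)) x).
    { apply (continuous_derive _ (2 * PI * cos (2 * PI * x))); auto_derive; trivial; ring. }
    simpl; apply cont_mult; [exact Hs|apply cont_mult; [exact Hs|apply continuous_const]].
Qed.

(** * Uniform continuity, limits and integrals *)

Definition ucont (f : R -> R) : Prop :=
  forall eps, 0 < eps -> exists delta, 0 < delta /\
    forall x y, Rabs (x - y) < delta -> Rabs (f x - f y) <= eps.

Definition csupp (f : R -> R) (a b : R) : Prop :=
  (forall x, continuous f x) /\ (forall x, x < a \/ b < x -> f x = 0).

Lemma csupp_ucont f a b : csupp f a b -> ucont f.
Proof.
  intros [Hc H0] eps He.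
  (* The interval is widened by 1: of two points at distance less than 1, if one lies outside it
     then [f] vanishes at both. *)
  assert (Hcc : forall x, a - 1 <= x <= b + 1 -> continuity_pt f x).
  { intros x _; apply continuity_pt_filterlim, Hc. }
  destruct (Heine_cor2 Hcc (mkposreal eps He)) as [[d Hd] H].
  simpl in H; exists (Rmin d 1); split; [apply Rmin_glb_lt; lra|].
  intros x y Hxy; assert (H1 := Rmin_l d 1); assert (H2 := Rmin_r d 1).
  assert (Hxy' : -1 < x - y < 1) by (apply Rabs_lt_between; lra).
  destruct (Rle_dec (a - 1) x) as [A1|A1]; [|rewrite !H0 by lra; rewrite Rminus_diag, Rabs_R0; lra].
  destruct (Rle_dec x (b + 1)) as [A2|A2]; [|rewrite !H0 by lra; rewrite Rminus_diag, Rabs_R0; lra].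
  destruct (Rle_dec (a - 1) y) as [A3|A3]; [|rewrite !H0 by lra; rewrite Rminus_diag, Rabs_R0; lra].
  destruct (Rle_dec y (b + 1)) as [A4|A4]; [|rewrite !H0 by lra; rewrite Rminus_diag, Rabs_R0; lra].
  apply Rlt_le, H; lra.
Qed.

Lemma csupp_bounded f a b : csupp f a b -> exists B, 0 <= B /\ forall x, Rabs (f x) <= B.
Proof.
  intros [Hc H0]; destruct (Rle_dec a b) as [Hab|Hab].
  - destruct (continuity_ab_maj (fun x => Rabs (f x)) a b Hab) as [m [Hm _]].
    { intros x _; apply continuity_pt_filterlim, (continuous_Rabs_comp f), Hc. }
    exists (Rabs (f m)); split; [apply Rabs_pos|]; intros x.
    destruct (Rle_dec a x), (Rle_dec x b); [apply Hm; lra| | |];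
      rewrite (H0 x), Rabs_R0 by lra; apply Rabs_pos.
  - exists 0; split; [lra|]; intros x; rewrite H0, Rabs_R0 by lra; lra.
Qed.

Lemma ucont_opp_arg f : ucont f -> ucont (fun x => f (- x)).
Proof.
  intros H eps He; destruct (H eps He) as [d [Hd Hf]]; exists d; split; trivial.
  intros x y Hxy; apply Hf; replace (- x - - y) with (- (x - y)) by ring; rewrite Rabs_Ropp; trivial.
Qed.

Lemma RInt_zero_ext f a b : (forall x, Rmin a b < x < Rmax a b -> f x = 0) -> RInt f a b = 0.
Proof.
  intros H; rewrite (RInt_ext f (fun _ => 0)) by trivial.
  rewrite RInt_const; unfold scal; simpl; unfold mult; simpl; eq_in_R; ring.
Qed.

Lemma RInt_enlarge f a b A B : csupp f a b -> A <= a -> a <= b -> b <= B -> RInt f A B = RInt f a b.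
Proof.
  intros [Hc H0] H1 H2 H3.
  rewrite <- (RInt_Chasles f A a B), <- (RInt_Chasles f a b B) by (apply ex_RInt_cont; trivial).
  rewrite (RInt_zero_ext f A a), (RInt_zero_ext f b B).
  - change plus with Rplus; eq_in_R; ring.
  - intros x; rewrite Rmin_left, Rmax_right by lra; intros Hx; apply H0; lra.
  - intros x; rewrite Rmin_left, Rmax_right by lra; intros Hx; apply H0; lra.
Qed.

Lemma RInt_csupp_eq f a b c d : csupp f a b -> csupp f c d -> a <= b -> c <= d -> RInt f a b = RInt f c d.
Proof.
  intros H1 H2 Hab Hcd.
  rewrite <- (RInt_enlarge f a b (Rmin a c) (Rmax b d)), <- (RInt_enlarge f c d (Rmin a c) (Rmax b d));
    trivial; try apply Rmin_l; try apply Rmin_r; try apply Rmax_l; apply Rmax_r.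
Qed.

(** A translation, after which the interval may be changed because the integrand vanishes outside
    the support of either factor. *)
Lemma RInt_shift_support F f a b c d X : csupp F a b -> csupp f c d -> a <= b -> c <= d ->
  RInt (fun u => F (u + X) * f u) c d = RInt (fun u => F u * f (u - X)) a b.
Proof.
  intros [HF HF0] [Hf Hf0] Hab Hcd.
  set (phi := fun u => F u * f (u - X)).
  assert (Hphi : forall u, continuous phi u).
  { intros u; apply cont_mult; [apply HF|]; apply (continuous_comp (fun u => u - X) f); [|apply Hf].
    apply cont_minus; [apply continuous_id|apply continuous_const]. }
  transitivity (RInt phi (1 * c + X) (1 * d + X)).
  - rewrite <- (RInt_comp_lin phi 1 X c d) by (apply ex_RInt_cont; trivial).
    apply RInt_ext; intros u _; unfold phi, scal; simpl; unfold mult; simpl.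
    rewrite !Rmult_1_l; do 2 f_equal; ring.
  - apply RInt_csupp_eq; [split; trivial|split; trivial| |trivial]; try lra.
    + intros u Hu; unfold phi; rewrite Hf0; [ring|]; lra.
    + intros u Hu; unfold phi; rewrite HF0; [ring|]; lra.
Qed.

Lemma cont_rsum {T} (J : list T) (f : T -> R -> R) u :
  (forall t, In t J -> continuous (f t) u) -> continuous (fun u => rsum J (fun t => f t u)) u.
Proof.
  induction J as [|t J IH]; intros H; simpl; [apply continuous_const|].
  apply (cont_plus (f t)); [apply H; simpl; auto|apply IH; intros; apply H; simpl; auto].
Qed.

Lemma RInt_rsum {T} (J : list T) (f : T -> R -> R) a b : (forall t u, continuous (f t) u) ->
  RInt (fun u => rsum J (fun t => f t u)) a b = rsum J (fun t => RInt (f t) a b).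
Proof.
  intros H; induction J as [|t J IH]; simpl.
  - rewrite RInt_const; unfold scal; simpl; unfold mult; simpl; eq_in_R; ring.
  - rewrite <- IH; apply (RInt_plus (V := R_CompleteNormedModule)); apply ex_RInt_cont; [apply H|].
    intros u; apply cont_rsum; auto.
Qed.

Lemma RInt_Rmult c f a b : (forall u, continuous f u) -> RInt (fun u => c * f u) a b = c * RInt f a b.
Proof. intros H; apply (RInt_scal (V := R_CompleteNormedModule)), ex_RInt_cont, H. Qed.

Lemma RInt_Avg q (f : (Z -> C) -> R -> R) a b : (forall chi u, continuous (f chi) u) ->
  RInt (fun u => Avg q (fun chi => f chi u)) a b = Avg q (fun chi => RInt (f chi) a b).
Proof.
  intros H; unfold Avg; rewrite <- RInt_rsum by trivial.
  apply RInt_Rmult; intros u; apply cont_rsum; auto.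
Qed.

Lemma cont_Avg q (f : (Z -> C) -> R -> R) u : (forall chi, continuous (f chi) u) ->
  continuous (fun u => Avg q (fun chi => f chi u)) u.
Proof. intros H; unfold Avg; apply cont_mult; [apply continuous_const|apply cont_rsum; auto]. Qed.

Lemma RInt_close f g a b e : a <= b -> (forall u, continuous f u) -> (forall u, continuous g u) ->
  (forall u, Rabs (f u - g u) <= e) -> Rabs (RInt f a b - RInt g a b) <= (b - a) * e.
Proof.
  intros Hab Hf Hg H.
  assert (E := RInt_minus (V := R_CompleteNormedModule) f g a b (ex_RInt_cont f a b Hf) (ex_RInt_cont g a b Hg)).
  unfold minus, plus, opp in E; simpl in E; unfold Rminus; rewrite <- E.
  apply abs_RInt_le_const; [trivial|apply ex_RInt_cont; intros u; apply cont_minus; auto|].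
  intros t _; apply H.
Qed.

(** * Limits along the primes *)

Definition plim (s : nat -> R) (L : R) : Prop :=
  forall eps, 0 < eps -> exists q0, forall q, (q0 <= q)%nat -> prime (Z.of_nat q) -> Rabs (s q - L) <= eps.

(** Rests on the infinitude of the primes, without which [plim] would be vacuous. *)
Lemma plim_le s L c q1 : plim s L -> (forall q, (q1 <= q)%nat -> prime (Z.of_nat q) -> s q <= c) -> L <= c.
Proof.
  intros H Hc; apply le_epsilon; intros eps He; destruct (H eps He) as [q0 Hq0].
  destruct (PrimeFieldUnits.prime_above (q0 + q1)) as [q [Hq Hqp]].
  assert (A := Hq0 q ltac:(lia) Hqp); assert (A' := Hc q ltac:(lia) Hqp).
  apply Rabs_le_between in A; lra.
Qed.

Lemma plim_ge s L c q1 : plim s L -> (forall q, (q1 <= q)%nat -> prime (Z.of_nat q) -> c <= s q) -> c <= L.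
Proof.
  intros H Hc; apply le_epsilon; intros eps He; destruct (H eps He) as [q0 Hq0].
  destruct (PrimeFieldUnits.prime_above (q0 + q1)) as [q [Hq Hqp]].
  assert (A := Hq0 q ltac:(lia) Hqp); assert (A' := Hc q ltac:(lia) Hqp).
  apply Rabs_le_between in A; lra.
Qed.

Lemma plim_plus s t L L' : plim s L -> plim t L' -> plim (fun q => s q + t q) (L + L').
Proof.
  intros H H' eps He; destruct (H (eps / 2)) as [q0 H0]; [lra|]; destruct (H' (eps / 2)) as [q1 H1]; [lra|].
  exists (q0 + q1)%nat; intros q Hq Hqp.
  assert (A := H0 q ltac:(lia) Hqp); assert (A' := H1 q ltac:(lia) Hqp).
  apply Rabs_le_between in A; apply Rabs_le_between in A'; apply Rabs_le; lra.
Qed.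

Lemma plim_scal c s L : plim s L -> plim (fun q => c * s q) (c * L).
Proof.
  intros H eps He; assert (Hc : 0 < Rabs c + 1) by (assert (P := Rabs_pos c); lra).
  destruct (H (eps / (Rabs c + 1))) as [q0 H0]; [apply Rdiv_lt_0_compat; trivial|].
  exists q0; intros q Hq Hqp; specialize (H0 q Hq Hqp).
  rewrite <- Rmult_minus_distr_l, Rabs_mult.
  apply Rle_trans with ((Rabs c + 1) * (eps / (Rabs c + 1))); [|right; field; lra].
  assert (P := Rabs_pos c); assert (P' := Rabs_pos (s q - L)); apply Rmult_le_compat; lra.
Qed.

Lemma plim_const c : plim (fun _ => c) c.
Proof. intros eps He; exists 0%nat; intros; rewrite Rminus_diag, Rabs_R0; lra. Qed.

Lemma plim_ext_loc s t L q1 : (forall q, (q1 <= q)%nat -> prime (Z.of_nat q) -> s q = t q) -> plim s L -> plim t L.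
Proof.
  intros E H eps He; destruct (H eps He) as [q0 H0]; exists (q0 + q1)%nat; intros q Hq Hqp.
  rewrite <- E by (trivial; lia); apply H0; trivial; lia.
Qed.

(** * Uniform continuity on the circle and on the torus *)

Definition circle_ucont (f : C -> R) : Prop :=
  forall eps, 0 < eps -> exists delta, 0 < delta /\
    forall c c', Cmod c = 1 -> Cmod c' = 1 -> Cmod (c - c')%C < delta -> Rabs (f c - f c') <= eps.

Lemma circle_Lipschitz f K : 0 <= K ->
  (forall c c', Cmod c = 1 -> Cmod c' = 1 -> Rabs (f c - f c') <= K * Cmod (c - c')%C) -> circle_ucont f.
Proof.
  intros HK H eps He; exists (eps / (K + 1)); split; [apply Rdiv_lt_0_compat; lra|].
  intros c c' Hc Hc' Hcc; eapply Rle_trans; [apply H; trivial|].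
  assert (H0 := Cmod_ge_0 (c - c')%C); apply (Rmult_lt_compat_l (K + 1)) in Hcc; [|lra].
  replace ((K + 1) * (eps / (K + 1))) with eps in Hcc by (field; lra); lra.
Qed.

Lemma ln_Lipschitz m x y : 0 < m -> m <= x -> m <= y -> Rabs (ln x - ln y) <= / m * Rabs (x - y).
Proof.
  intros Hm Hx Hy.
  assert (H : forall x y, m <= x -> m <= y -> ln x - ln y <= / m * Rabs (x - y)).
  { clear x y Hx Hy; intros x y Hx Hy; assert (He := exp_ineq1_le (ln (x / y))).
    assert (Hi := Rinv_0_lt_compat _ Hm).
    rewrite exp_ln in He by (apply Rdiv_lt_0_compat; lra); rewrite ln_div in He by lra.
    assert (Hq : x / y - 1 <= / m * Rabs (x - y)).
    { replace (x / y - 1) with (/ y * (x - y)) by (field; lra).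
      apply Rle_trans with (/ y * Rabs (x - y)).
      - apply Rmult_le_compat_l; [apply Rlt_le, Rinv_0_lt_compat; lra|apply Rle_abs].
      - apply Rmult_le_compat_r; [apply Rabs_pos|apply Rinv_le_contravar; lra]. }
    lra. }
  assert (H1 := H x y Hx Hy); assert (H2 := H y x Hy Hx); rewrite Rabs_minus_sym in H2.
  apply Rabs_le; lra.
Qed.

(** The modulus of [1 - r * c] is at least [1 - r], where the logarithm is Lipschitz with constant
    [/ (1 - r)]. *)
Lemma local_log_ucont r : 0 < r < 1 -> circle_ucont (local_log r).
Proof.
  intros Hr; apply (circle_Lipschitz _ (2 * / (1 - r))).
  { assert (H := Rinv_0_lt_compat (1 - r) ltac:(lra)); lra. }
  intros c c' Hc Hc'.
  assert (H1 := one_minus_pos r c ltac:(lra) ltac:(lra)); assert (H2 := one_minus_pos r c' ltac:(lra) ltac:(lra)).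
  unfold local_log; rewrite !ln_pow by lra; simpl INR.
  set (x := Cmod (1 - RtoC r * c)%C) in *; set (y := Cmod (1 - RtoC r * c')%C) in *.
  replace (- ((1 + 1) * ln x) - - ((1 + 1) * ln y)) with (2 * (ln y - ln x)) by ring.
  rewrite Rabs_mult, (Rabs_pos_eq 2), Rmult_assoc by lra; apply Rmult_le_compat_l; [lra|].
  eapply Rle_trans; [apply (ln_Lipschitz (1 - r)); lra|].
  apply Rmult_le_compat_l; [apply Rlt_le, Rinv_0_lt_compat; lra|].
  assert (H3 : Cmod (RtoC r * (c - c'))%C <= Cmod (c - c')%C).
  { rewrite Cmod_mult, Cmod_R, Rabs_pos_eq by lra; assert (P := Cmod_ge_0 (c - c')%C); nra. }
  apply Rabs_le; split.
  - assert (x <= y + Cmod (RtoC r * (c - c'))%C); [|lra]; unfold x, y.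
    replace (1 - RtoC r * c)%C with ((1 - RtoC r * c') + - (RtoC r * (c - c')))%C by ring.
    rewrite <- (Cmod_opp (RtoC r * (c - c'))%C); apply Cmod_triangle.
  - assert (y <= x + Cmod (RtoC r * (c - c'))%C); [|lra]; unfold x, y.
    replace (1 - RtoC r * c')%C with ((1 - RtoC r * c) + RtoC r * (c - c'))%C by ring.
    apply Cmod_triangle.
Qed.

Lemma bad_ucont k : circle_ucont (bad k).
Proof.
  assert (Ha := bad_level_nonneg k).
  apply (circle_Lipschitz _ (2 * bad_level k)); [lra|].
  intros c c' Hc Hc'; unfold bad.
  assert (P1 := pow2_ge_0 (Im c)); assert (P2 := pow2_ge_0 (Im c')).
  assert (D1 : 1 <= 1 + bad_level k * Im c ^ 2) by nra; assert (D2 : 1 <= 1 + bad_level k * Im c' ^ 2) by nra.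
  replace (/ (1 + bad_level k * Im c ^ 2) - / (1 + bad_level k * Im c' ^ 2)) with
    (bad_level k * (Im c' ^ 2 - Im c ^ 2) * (/ (1 + bad_level k * Im c ^ 2) * / (1 + bad_level k * Im c' ^ 2)))
    by (field; lra).
  assert (Q : forall d, 1 <= d -> 0 < / d <= 1).
  { intros d Hd; split; [apply Rinv_0_lt_compat; lra|]; rewrite <- Rinv_1; apply Rinv_le_contravar; lra. }
  assert (Q1 := Q _ D1); assert (Q2 := Q _ D2).
  set (i1 := / (1 + bad_level k * Im c ^ 2)) in *; set (i2 := / (1 + bad_level k * Im c' ^ 2)) in *.
  assert (Q12 : 0 <= i1 * i2 <= 1) by nra.
  rewrite Rabs_mult, (Rabs_pos_eq (i1 * i2)) by lra.
  apply Rle_trans with (Rabs (bad_level k * (Im c' ^ 2 - Im c ^ 2))).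
  { rewrite <- Rmult_1_r; apply Rmult_le_compat_l; [apply Rabs_pos|lra]. }
  rewrite Rabs_mult, (Rabs_pos_eq (bad_level k)), (Rmult_comm 2), Rmult_assoc by lra.
  apply Rmult_le_compat_l; trivial.
  assert (B1 : forall z, Cmod z = 1 -> Rabs (Im z) <= 1).
  { intros z Hz; rewrite <- Hz; eapply Rle_trans; [|apply Rmax_Cmod]; apply Rmax_r. }
  replace (Im c' ^ 2 - Im c ^ 2) with ((Im c' + Im c) * (Im c' - Im c)) by ring.
  rewrite Rabs_mult; apply Rmult_le_compat; try apply Rabs_pos.
  - eapply Rle_trans; [apply Rabs_triang|]; assert (U := B1 c Hc); assert (U' := B1 c' Hc'); lra.
  - rewrite Rabs_minus_sym; replace (Im c - Im c') with (Im (c - c')%C) by (unfold Im; simpl; ring).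
    eapply Rle_trans; [|apply Rmax_Cmod]; apply Rmax_r.
Qed.

Lemma torus_cont_coord l p f : In p l -> circle_ucont f -> torus_cont l (fun z => f (z p)).
Proof.
  intros Hp Hf eps He; destruct (Hf eps He) as [d [Hd H]]; exists d; split; trivial.
  intros z w Hz Hw Hzw; apply H; auto.
Qed.

Lemma torus_cont_const l c : torus_cont l (fun _ => c).
Proof. intros eps He; exists 1; split; [lra|]; intros z w _ _ _; rewrite Rminus_diag, Rabs_R0; lra. Qed.

Lemma torus_modulus_le l eps d d' f : d <= d' -> torus_modulus l eps d' f -> torus_modulus l eps d f.
Proof. intros Hd H z w Hz Hw Hzw; apply H; trivial; intros p Hp; specialize (Hzw p Hp); lra. Qed.

Lemma torus_cont_plus l f g : torus_cont l f -> torus_cont l g -> torus_cont l (fun z => f z + g z).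
Proof.
  intros Hf Hg eps He; destruct (Hf (eps / 2)) as [d [Hd H]]; [lra|]; destruct (Hg (eps / 2)) as [d' [Hd' H']]; [lra|].
  exists (Rmin d d'); split; [apply Rmin_glb_lt; trivial|].
  apply (torus_modulus_le _ _ _ _ _ (Rmin_l d d')) in H; apply (torus_modulus_le _ _ _ _ _ (Rmin_r d d')) in H'.
  intros z w Hz Hw Hzw; specialize (H z w Hz Hw Hzw); specialize (H' z w Hz Hw Hzw).
  replace (f z + g z - (f w + g w)) with ((f z - f w) + (g z - g w)) by ring.
  eapply Rle_trans; [apply Rabs_triang|lra].
Qed.

Lemma torus_cont_mult l f g B : 0 <= B -> torus_bounded B f -> torus_bounded B g ->
  torus_cont l f -> torus_cont l g -> torus_cont l (fun z => f z * g z).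
Proof.
  intros HB Bf Bg Hf Hg eps He; set (e := eps / (2 * B + 1)).
  assert (He' : 0 < e) by (apply Rdiv_lt_0_compat; lra).
  destruct (Hf e He') as [d [Hd H]]; destruct (Hg e He') as [d' [Hd' H']].
  exists (Rmin d d'); split; [apply Rmin_glb_lt; trivial|].
  apply (torus_modulus_le _ _ _ _ _ (Rmin_l d d')) in H; apply (torus_modulus_le _ _ _ _ _ (Rmin_r d d')) in H'.
  intros z w Hz Hw Hzw; specialize (H z w Hz Hw Hzw); specialize (H' z w Hz Hw Hzw).
  replace (f z * g z - f w * g w) with ((f z - f w) * g z + f w * (g z - g w)) by ring.
  eapply Rle_trans; [apply Rabs_triang|]; rewrite !Rabs_mult.
  assert (E : (2 * B + 1) * e = eps) by (unfold e; field; lra).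
  specialize (Bg z Hz); specialize (Bf w Hw).
  assert (P1 := Rabs_pos (f z - f w)); assert (P2 := Rabs_pos (g z - g w));
  assert (P3 := Rabs_pos (g z)); assert (P4 := Rabs_pos (f w)); nra.
Qed.

Lemma torus_cont_rsum {T} l (J : list T) f :
  (forall t, In t J -> torus_cont l (f t)) -> torus_cont l (fun z => rsum J (fun t => f t z)).
Proof.
  induction J as [|t J IH]; intros H; simpl; [apply torus_cont_const|].
  apply (torus_cont_plus l (f t)); [apply H; simpl; auto|apply IH; intros; apply H; simpl; auto].
Qed.

Lemma torus_cont_scal l c f : torus_cont l f -> torus_cont l (fun z => c * f z).
Proof.
  intros Hf eps He; assert (Hc : 0 < Rabs c + 1) by (assert (P := Rabs_pos c); lra).
  destruct (Hf (eps / (Rabs c + 1))) as [d [Hd H]]; [apply Rdiv_lt_0_compat; trivial|].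
  exists d; split; trivial; intros z w Hz Hw Hzw; specialize (H z w Hz Hw Hzw).
  rewrite <- Rmult_minus_distr_l, Rabs_mult.
  apply Rle_trans with ((Rabs c + 1) * (eps / (Rabs c + 1))); [|right; field; lra].
  assert (P := Rabs_pos c); assert (P' := Rabs_pos (f z - f w)); apply Rmult_le_compat; lra.
Qed.

(** Uniform continuity is invariant under translation, so one [delta] serves every [u]. This is the
    source of uniformity in [u] for the densities. *)
Lemma translate_modulus l f B X W eps : 0 < eps -> 0 <= B -> ucont f -> (forall x, Rabs (f x) <= B) ->
  torus_cont l X -> torus_cont l W -> torus_bounded 1 W ->
  exists delta, 0 < delta /\ forall u, torus_modulus l eps delta (fun z => f (u + X z) * W z).
Proof.
  intros He HB Hf HfB HX HW HW1; destruct (Hf (eps / 2)) as [d1 [Hd1 H1]]; [lra|].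
  destruct (HX (d1 / 2)) as [d2 [Hd2 H2]]; [lra|].
  destruct (HW (eps / (2 * (B + 1)))) as [d3 [Hd3 H3]]; [apply Rdiv_lt_0_compat; lra|].
  exists (Rmin d2 d3); split; [apply Rmin_glb_lt; trivial|].
  apply (torus_modulus_le _ _ _ _ _ (Rmin_l d2 d3)) in H2; apply (torus_modulus_le _ _ _ _ _ (Rmin_r d2 d3)) in H3.
  intros u z w Hz Hw Hzw; specialize (H2 z w Hz Hw Hzw); specialize (H3 z w Hz Hw Hzw).
  replace (f (u + X z) * W z - f (u + X w) * W w) with
    ((f (u + X z) - f (u + X w)) * W z + f (u + X w) * (W z - W w)) by ring.
  eapply Rle_trans; [apply Rabs_triang|]; rewrite !Rabs_mult.
  assert (H4 : Rabs (f (u + X z) - f (u + X w)) <= eps / 2).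
  { apply H1; replace (u + X z - (u + X w)) with (X z - X w) by ring; lra. }
  specialize (HW1 z Hz); specialize (HfB (u + X w)).
  assert (P1 := Rabs_pos (f (u + X z) - f (u + X w))); assert (P2 := Rabs_pos (W z));
  assert (P3 := Rabs_pos (f (u + X w))); assert (P4 := Rabs_pos (W z - W w)).
  assert (E : (B + 1) * (eps / (2 * (B + 1))) = eps / 2) by (field; lra).
  assert (H5 : Rabs (f (u + X w)) * Rabs (W z - W w) <= (B + 1) * (eps / (2 * (B + 1)))).
  { apply Rmult_le_compat; lra. }
  nra.
Qed.

(** * Existence of a continuous limiting density *)

Definition log_euler (sigma : R) (l : list nat) (z : nat -> C) : R :=
  rsum l (fun p => local_log (npow sigma p) (z p)).

Definition log_euler_but (sigma : R) (l : list nat) (p : nat) (z : nat -> C) : R :=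
  rsum l (fun p' => if Nat.eq_dec p' p then 0 else local_log (npow sigma p') (z p')).

Lemma log_euler_split sigma l p z : NoDup l -> In p l ->
  log_euler sigma l z = log_euler_but sigma l p z + local_log (npow sigma p) (z p).
Proof.
  intros Hnd Hp; unfold log_euler, log_euler_but; induction l as [|p' l IH]; [contradiction|].
  inversion Hnd; subst; simpl; destruct (Nat.eq_dec p' p) as [->|E].
  - rewrite (rsum_ext l (fun p' => if Nat.eq_dec p' p then 0 else _) (fun p' => local_log (npow sigma p') (z p'))); [ring|].
    intros x Hx; destruct (Nat.eq_dec x p); [congruence|trivial].
  - rewrite IH; [ring|trivial|]; destruct Hp; [contradiction|trivial].
Qed.

Lemma log_euler_but_upd sigma l p z c : log_euler_but sigma l p (upd z p c) = log_euler_but sigma l p z.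
Proof.
  apply rsum_ext; intros p' _; unfold upd; destruct (Nat.eq_dec p' p); trivial.
Qed.

Lemma npow_prime_range sigma p : 0 < sigma -> prime (Z.of_nat p) -> 0 < npow sigma p < 1.
Proof.
  intros Hs Hp; assert (H := prime_ge_2 _ Hp); split; [apply npow_pos|apply npow_lt_1; [trivial|lia]].
Qed.

Lemma log_euler_but_cont sigma l p : 0 < sigma -> all_prime l -> torus_cont l (log_euler_but sigma l p).
Proof.
  intros Hs Hl; apply (torus_cont_rsum l l (fun p' z => if Nat.eq_dec p' p then 0 else local_log (npow sigma p') (z p'))).
  intros p' Hp'; destruct (Nat.eq_dec p' p); [apply torus_cont_const|].
  apply (torus_cont_coord l p'); trivial; apply local_log_ucont, npow_prime_range; auto.
Qed.

Lemma log_euler_cont sigma l : 0 < sigma -> all_prime l -> torus_cont l (log_euler sigma l).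
Proof.
  intros Hs Hl; apply (torus_cont_rsum l l (fun p' z => local_log (npow sigma p') (z p'))).
  intros p' Hp'; apply (torus_cont_coord l p'); trivial; apply local_log_ucont, npow_prime_range; auto.
Qed.

Lemma log_sum_char_pt q sigma l chi : prime (Z.of_nat q) -> X q chi -> all_prime l ->
  (forall p, In p l -> (p < q)%nat) -> log_sum sigma l chi = log_euler sigma l (char_pt chi).
Proof.
  intros Hq Hchi Hl Hlq; apply rsum_ext; intros p Hp; assert (H := prime_ge_2 _ (Hl p Hp)).
  rewrite (char_pt_eq q) by (trivial; specialize (Hlq p Hp); lia); trivial.
Qed.

(** The factor 2 comes from [q - 1 <= 2 * (q - 2)]. Taking [q > y] ensures that no prime of the list
    divides [q], so [char_pt] agrees with the character there. *)
Lemma log_L_approx_Avg sigma eps : 1 / 2 < sigma -> 0 < eps ->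
  exists Y, forall y, (Y <= y)%nat -> exists q0, (3 <= q0)%nat /\ forall q, (q0 <= q)%nat -> prime (Z.of_nat q) ->
    (forall p, In p (primes_upto y) -> (p < q)%nat) /\
    Avg q (fun chi => indic (~ close_log sigma eps (primes_upto y) chi)) <= 2 * eps.
Proof.
  intros Hs He; destruct (log_L_approx sigma eps Hs He) as [Y HY]; exists Y; intros y Hy.
  destruct (HY y Hy) as [q0 Hq0]; exists (q0 + y + 3)%nat; split; [lia|]; intros q Hq Hqp; split.
  - intros p Hp; apply in_primes_upto in Hp; lia.
  - specialize (Hq0 q ltac:(lia) Hqp); unfold Avg.
    assert (H1 : 1 <= INR (q - 2)) by (apply (le_INR 1); lia).
    assert (H2 : INR (q - 1) = INR (q - 2) + 1) by (rewrite <- S_INR; f_equal; lia).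
    apply (Rmult_le_reg_l (INR (q - 2))); [lra|]; rewrite <- Rmult_assoc, Rinv_r, Rmult_1_l by lra.
    eapply Rle_trans; [exact Hq0|]; rewrite H2; nra.
Qed.

(** The shift [a] and the weight [w] may depend on the character and are quantified after [q0], so
    the threshold is uniform in them. An ordinary character costs at most [eps / 2] by uniform
    continuity; an exceptional one costs [2 * B], in a proportion of at most [2 * e]. *)
Lemma log_L_swap sigma F B eps : 1 / 2 < sigma -> ucont F -> (forall x, Rabs (F x) <= B) -> 0 < eps ->
  exists Y, forall y, (Y <= y)%nat -> exists q0, (3 <= q0)%nat /\
    forall q (a w : (Z -> C) -> R), (q0 <= q)%nat -> prime (Z.of_nat q) -> (forall chi, Rabs (w chi) <= 1) ->
    Rabs (Avg q (fun chi => F (a chi + log_L sigma chi) * w chi) -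
          Avg q (fun chi => F (a chi + log_euler sigma (primes_upto y) (char_pt chi)) * w chi)) <= eps.
Proof.
  intros Hs HF HB He.
  assert (HB0 : 0 <= B) by (eapply Rle_trans; [apply Rabs_pos|apply (HB 0)]).
  destruct (HF (eps / 2)) as [d [Hd Hdd]]; [lra|].
  set (e := Rmin (d / 2) (eps / (8 * (B + 1)))).
  assert (He' : 0 < e) by (apply Rmin_glb_lt; [lra|apply Rdiv_lt_0_compat; lra]).
  destruct (log_L_approx_Avg sigma e Hs He') as [Y HY]; exists Y; intros y Hy.
  destruct (HY y Hy) as [q0 [Hq3 Hq0]]; exists q0; split; trivial; intros q a w Hq Hqp Hw.
  destruct (Hq0 q Hq Hqp) as [Hlq Hbad].
  rewrite <- Avg_minus; eapply Rle_trans; [apply Avg_abs|].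
  apply Rle_trans with (Avg q (fun chi => eps / 2 + 2 * B * indic (~ close_log sigma e (primes_upto y) chi))).
  - apply Avg_le; intros chi Hchi; apply (X_enumerates q Hqp) in Hchi.
    rewrite <- Rmult_minus_distr_r, Rabs_mult.
    set (D := Rabs (F _ - F _)); assert (HD : 0 <= D) by apply Rabs_pos.
    assert (HD2 : D <= eps / 2 + 2 * B * indic (~ close_log sigma e (primes_upto y) chi)).
    { unfold indic; destruct (excluded_middle_informative _) as [N|N].
      - rewrite Rmult_1_r; unfold D, Rminus; eapply Rle_trans; [apply Rabs_triang|]; rewrite Rabs_Ropp.
        assert (U1 := HB (a chi + log_L sigma chi));
        assert (U2 := HB (a chi + log_euler sigma (primes_upto y) (char_pt chi))); lra.
      - rewrite Rmult_0_r, Rplus_0_r; apply Hdd; apply NNPP in N; destruct N as [_ N].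
        rewrite (log_sum_char_pt q) in N by (trivial; apply primes_upto_prime).
        replace (a chi + log_L sigma chi - (a chi + log_euler sigma (primes_upto y) (char_pt chi))) with
          (log_L sigma chi - log_euler sigma (primes_upto y) (char_pt chi)) by ring.
        assert (M := Rmin_l (d / 2) (eps / (8 * (B + 1)))); fold e in M; lra. }
    specialize (Hw chi); assert (P := Rabs_pos (w chi)); nra.
  - rewrite Avg_plus, Avg_scal, Avg_const by (trivial; lia).
    assert (M := Rmin_r (d / 2) (eps / (8 * (B + 1)))); fold e in M.
    assert (E : (8 * (B + 1)) * (eps / (8 * (B + 1))) = eps) by (field; lra).
    assert (Hb2 : 2 * B * Avg q (fun chi => indic (~ close_log sigma e (primes_upto y) chi)) <= 2 * B * (2 * e)).
    { apply Rmult_le_compat_l; lra. }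
    nra.
Qed.

Definition indep_of (p : nat) (W : (nat -> C) -> R) : Prop := forall z c, W (upd z p c) = W z.

Definition weight (l : list nat) (W : (nat -> C) -> R) : Prop :=
  torus_cont l W /\ forall z, torus z -> 0 <= W z <= 1.

Lemma weight_bounded l W : weight l W -> torus_bounded 1 W.
Proof. intros [_ H] z Hz; specialize (H z Hz); apply Rabs_le; lra. Qed.

Lemma primes_upto_incl l y : all_prime l -> (forall p, In p l -> (p <= y)%nat) -> incl l (primes_upto y).
Proof. intros Hl Hy p Hp; apply in_primes_upto; auto. Qed.

(** The factor at [p] is removed from the actual [log_L], not from a finite product, so that no
    truncation parameter enters. *)
Definition piece_density (sigma : R) (p k : nat) (W : (nat -> C) -> R) (q : nat) (u : R) : R :=
  Avg q (fun chi => local_density k (npow sigma p)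
     (u - (log_L sigma chi - local_log (npow sigma p) (char_pt chi p))) * W (char_pt chi)).

Lemma local_density_csupp k r : 0 < r < 1 ->
  csupp (local_density k r) (- ln ((1 + r) ^ 2)) (- ln ((1 - r) ^ 2)).
Proof.
  intros Hr; split; [intros; apply local_density_cont; lra|].
  intros u Hu; apply local_density_support; trivial.
  destruct Hu as [Hu|Hu]; [right|left].
  - rewrite <- (exp_ln ((1 + r) ^ 2)) by (apply pow_lt; lra); apply exp_le; lra.
  - rewrite <- (exp_ln ((1 - r) ^ 2)) by (apply pow_lt; lra); apply exp_le; lra.
Qed.

Lemma local_density_csupp_le r : 0 < r < 1 -> - ln ((1 + r) ^ 2) <= - ln ((1 - r) ^ 2).
Proof.
  intros Hr; apply Ropp_le_contravar, Rlt_le, ln_increasing; [apply pow_lt; lra|nra].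
Qed.

Lemma local_density_abs k r u : 0 < r < 1 -> Rabs (local_density k r u) <= 2 ^ k * / r.
Proof.
  intros Hr; rewrite Rabs_pos_eq by (apply local_density_nonneg; lra); apply local_density_bound; trivial.
Qed.

Lemma piece_density_approx sigma p k W l0 eps : 1 / 2 < sigma -> prime (Z.of_nat p) ->
  weight l0 W -> 0 < eps ->
  exists Y, forall y, (Y <= y)%nat -> exists q0, (3 <= q0)%nat /\ forall q u, (q0 <= q)%nat -> prime (Z.of_nat q) ->
    Rabs (piece_density sigma p k W q u -
      Avg q (fun chi => local_density k (npow sigma p) (u - log_euler_but sigma (primes_upto y) p (char_pt chi)) * W (char_pt chi))) <= eps.
Proof.
  intros Hs Hp HW He; set (r := npow sigma p).
  assert (Hr : 0 < r < 1) by (apply npow_prime_range; [lra|trivial]).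
  (* The argument is negated so that [log_L] enters with a plus sign; [u] and the local factor at
     [p] go into the free shift. *)
  destruct (log_L_swap sigma (fun x => local_density k r (- x)) (2 ^ k * / r) eps Hs) as [Y HY]; trivial.
  - apply ucont_opp_arg, (csupp_ucont _ _ _ (local_density_csupp k r Hr)).
  - intros x; apply local_density_abs; trivial.
  - exists (Y + p)%nat; intros y Hy; destruct (HY y ltac:(lia)) as [q0 [Hq3 Hq0]]; exists q0; split; trivial.
    intros q u Hq Hqp.
    assert (A := Hq0 q (fun chi => - u - local_log r (char_pt chi p)) (fun chi => W (char_pt chi)) Hq Hqp
       (fun chi => weight_bounded _ _ HW _ (char_pt_torus chi))).
    cbv beta in A; fold r.
    rewrite (Avg_ext q _ (fun chi => local_density k r (u - (log_L sigma chi - local_log r (char_pt chi p))) * W (char_pt chi))) in A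
      by (intros chi _; do 2 f_equal; ring).
    rewrite (Avg_ext q (fun chi => local_density k r (- (- u - local_log r (char_pt chi p) + _)) * W (char_pt chi))
      (fun chi => local_density k r (u - log_euler_but sigma (primes_upto y) p (char_pt chi)) * W (char_pt chi))) in A.
    + exact A.
    + intros chi _; do 2 f_equal.
      rewrite (log_euler_split sigma (primes_upto y) p); [fold r; ring|apply primes_upto_NoDup|].
      apply in_primes_upto; split; [lia|trivial].
Qed.

(** For one truncation [y], both densities are within [eps / 8] of averages depending on finitely
    many primes, and equidistribution brings these within [6 * (eps / 8)] of each other for all [u]
    together. *)
Lemma piece_density_Cauchy sigma p k W l0 : 1 / 2 < sigma -> prime (Z.of_nat p) ->
  all_prime l0 -> weight l0 W ->
  forall eps, 0 < eps -> exists q0, forall q q' u, (q0 <= q)%nat -> prime (Z.of_nat q) ->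
     (q0 <= q')%nat -> prime (Z.of_nat q') ->
     Rabs (piece_density sigma p k W q u - piece_density sigma p k W q' u) <= eps.
Proof.
  intros Hs Hp Hl0 HW eps He; set (r := npow sigma p).
  assert (Hr : 0 < r < 1) by (apply npow_prime_range; [lra|trivial]).
  destruct (piece_density_approx sigma p k W l0 (eps / 8) Hs Hp HW ltac:(lra)) as [Y HY].
  destruct (exists_bound l0) as [M HM].
  set (y := (Y + M)%nat); destruct (HY y ltac:(unfold y; lia)) as [q1 [_ Hq1]].
  set (l := primes_upto y).
  assert (Hl : all_prime l) by apply primes_upto_prime.
  assert (Hi : incl l0 l) by (apply primes_upto_incl; trivial; intros x Hx; specialize (HM x Hx); unfold y; lia).
  set (B := 2 ^ k * / r).
  assert (HB : 0 <= B) by (apply Rmult_le_pos; [apply pow_le; lra|apply Rlt_le, Rinv_0_lt_compat; lra]).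
  destruct (translate_modulus l (fun x => local_density k r x) B (fun z => -1 * log_euler_but sigma l p z) W (eps / 8))
    as [d [Hd Hmod]]; trivial; [lra| | | | |apply (weight_bounded l0); trivial|].
  - apply (csupp_ucont _ _ _ (local_density_csupp k r Hr)).
  - intros x; apply local_density_abs; trivial.
  - apply torus_cont_scal, log_euler_but_cont; [lra|trivial].
  - apply (torus_cont_incl l0); [trivial|apply HW].
  - destruct (Avg_Cauchy l (eps / 8) d B Hl (primes_upto_NoDup y) ltac:(lra) Hd HB) as [q2 [_ Hq2]].
    exists (q1 + q2)%nat; intros q q' u Hq Hqp Hq' Hqp'.
    assert (A1 := Hq1 q u ltac:(lia) Hqp); assert (A2 := Hq1 q' u ltac:(lia) Hqp').
    assert (A3 := Hq2 q q' (fun z => local_density k r (u + -1 * log_euler_but sigma l p z) * W z)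
       ltac:(lia) Hqp ltac:(lia) Hqp').
    fold l r in A1, A2.
    assert (E : forall q, Avg q (fun chi => local_density k r (u + -1 * log_euler_but sigma l p (char_pt chi)) * W (char_pt chi)) =
      Avg q (fun chi => local_density k r (u - log_euler_but sigma l p (char_pt chi)) * W (char_pt chi))).
    { intros q3; apply Avg_ext; intros chi _; do 2 f_equal; ring. }
    rewrite !E in A3.
    assert (A4 : Rabs (Avg q (fun chi => local_density k r (u - log_euler_but sigma l p (char_pt chi)) * W (char_pt chi)) -
       Avg q' (fun chi => local_density k r (u - log_euler_but sigma l p (char_pt chi)) * W (char_pt chi))) <= 6 * (eps / 8)).
    { apply A3; [|apply Hmod]; intros z Hz; rewrite Rabs_mult.
      rewrite <- (Rmult_1_r B); apply Rmult_le_compat; try apply Rabs_pos.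
      - apply local_density_abs; trivial.
      - apply (weight_bounded l0); trivial. }
    apply Rabs_le_between in A1; apply Rabs_le_between in A2; apply Rabs_le_between in A4.
    apply Rabs_le; lra.
Qed.

Lemma gap_range k c : 0 <= gap k c <= 1.
Proof.
  split; [apply gap_nonneg|]; unfold gap; assert (H := bad_le_1 k c); assert (H' := bad_pos (S k) c); lra.
Qed.

Lemma gap_ucont k : circle_ucont (gap k).
Proof.
  intros eps He; destruct (bad_ucont k (eps / 2)) as [d [Hd H]]; [lra|].
  destruct (bad_ucont (S k) (eps / 2)) as [d' [Hd' H']]; [lra|].
  exists (Rmin d d'); split; [apply Rmin_glb_lt; trivial|]; intros c c' Hc Hc' Hcc.
  assert (U := Rmin_l d d'); assert (U' := Rmin_r d d').
  specialize (H c c' Hc Hc' ltac:(lra)); specialize (H' c c' Hc Hc' ltac:(lra)).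
  apply Rabs_le_between in H; apply Rabs_le_between in H'; unfold gap; apply Rabs_le; lra.
Qed.

(** With the other coordinates fixed, averaging over the coordinate at [p] turns the weight [gap k]
    into a density; [W] passes through because it ignores that coordinate. Truncation to finitely
    many primes is made on the side of [F] and undone on the side of the density. *)
Lemma piece_integral sigma p k W l0 F a b : 1 / 2 < sigma -> prime (Z.of_nat p) ->
  all_prime l0 -> weight l0 W -> indep_of p W -> csupp F a b -> a <= b ->
  forall eps, 0 < eps -> exists q0, forall q, (q0 <= q)%nat -> prime (Z.of_nat q) ->
    Rabs (Avg q (fun chi => F (log_L sigma chi) * (gap k (char_pt chi p) * W (char_pt chi))) -
          RInt (fun u => F u * piece_density sigma p k W q u) a b) <= eps.
Proof.
  intros Hs Hp Hl0 HW HWp HF Hab eps He; set (r := npow sigma p).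
  assert (Hr : 0 < r < 1) by (apply npow_prime_range; [lra|trivial]).
  destruct (csupp_bounded F a b HF) as [BF [HBF0 HBF]].
  assert (HFu := csupp_ucont F a b HF).
  assert (HFc := proj1 HF).
  set (e3 := eps / (4 * ((b - a) * BF + 1))).
  assert (HBab : 0 <= (b - a) * BF) by (apply Rmult_le_pos; lra).
  assert (He3 : 0 < e3) by (apply Rdiv_lt_0_compat; lra).
  destruct (log_L_swap sigma F BF (eps / 4) Hs HFu HBF ltac:(lra)) as [Y1 HY1].
  destruct (piece_density_approx sigma p k W l0 e3 Hs Hp HW He3) as [Y2 HY2].
  destruct (exists_bound l0) as [M HM].
  set (y := (Y1 + Y2 + M + p)%nat).
  destruct (HY1 y ltac:(unfold y; lia)) as [q1 [_ Hq1]]; destruct (HY2 y ltac:(unfold y; lia)) as [q2 [_ Hq2]].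
  set (l := primes_upto y) in *.
  assert (Hl : all_prime l) by apply primes_upto_prime.
  assert (Hnd : NoDup l) by apply primes_upto_NoDup.
  assert (Hpl : In p l) by (apply in_primes_upto; split; [unfold y; lia|trivial]).
  assert (Hi : incl l0 l) by (apply primes_upto_incl; trivial; intros x Hx; specialize (HM x Hx); unfold y; lia).
  set (W' := fun z => gap k (z p) * W z).
  assert (HW1 := weight_bounded l0 W HW).
  assert (Hg1 : torus_bounded 1 (fun z => gap k (z p))).
  { intros z _; assert (G := gap_range k (z p)); apply Rabs_le; lra. }
  assert (HWl : torus_cont l W) by (apply (torus_cont_incl l0); [trivial|apply HW]).
  assert (HW'c : torus_cont l W').
  { apply (torus_cont_mult l (fun z => gap k (z p)) W 1); trivial; [lra|].
    apply torus_cont_coord; [trivial|apply gap_ucont]. }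
  assert (HW'1 : torus_bounded 1 W').
  { intros z Hz; unfold W'; rewrite Rabs_mult; specialize (Hg1 z Hz); specialize (HW1 z Hz).
    assert (P1 := Rabs_pos (gap k (z p))); assert (P2 := Rabs_pos (W z)); cbv beta in Hg1; nra. }
  set (Theta := fun z => F (0 + log_euler sigma l z) * W' z).
  assert (HTc : torus_cont l Theta).
  { intros e' He'; destruct (translate_modulus l F BF (log_euler sigma l) W' e' He' HBF0 HFu HBF) as [d [Hd Hm]];
      trivial; [apply log_euler_cont; [lra|trivial]|]; exists d; split; trivial; apply (Hm 0). }
  assert (HTb : torus_bounded BF Theta).
  { intros z Hz; unfold Theta; rewrite Rabs_mult, <- (Rmult_1_r BF).
    apply Rmult_le_compat; try apply Rabs_pos; auto. }
  destruct (HTc (eps / 28) ltac:(lra)) as [d [Hd Hm]].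
  destruct (torus_int_Avg l p (eps / 28) d BF Hl Hnd Hpl ltac:(lra) Hd HBF0) as [q3 [_ Hq3]].
  exists (q1 + q2 + q3)%nat; intros q Hq Hqp.
  set (N := fun u => Avg q (fun chi => local_density k r (u - log_euler_but sigma l p (char_pt chi)) * W (char_pt chi))).
  (* The substitution produces the local density, and the contribution [x0] of the other primes then
     acts as a translation. *)
  assert (HTint : forall z, torus z -> torus_int p Theta z =
    RInt (fun u => F u * (local_density k r (u - log_euler_but sigma l p z) * W z)) a b).
  { intros z Hz; unfold torus_int, Theta, W'; set (x0 := log_euler_but sigma l p z).
    assert (Hcd : forall u, continuous (fun u => local_density k r (u - x0)) u).
    { intros u; apply (continuous_comp (fun u => u - x0) (local_density k r)); [|apply local_density_cont; lra].
      apply cont_minus; [apply continuous_id|apply continuous_const]. }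
    rewrite (RInt_ext _ (fun x => W z * (F (local_log r (ce x) + x0) * gap k (ce x)))).
    2:{ intros x _; rewrite (log_euler_split sigma l p) by trivial; rewrite log_euler_but_upd, HWp.
        fold x0; unfold upd; destruct (Nat.eq_dec p p) as [_|E]; [|contradiction].
        fold r; rewrite Rplus_0_l, (Rplus_comm x0); eq_in_R; ring. }
    assert (HFs : forall u, continuous (fun u => F (u + x0)) u).
    { intros u; apply (continuous_comp (fun u => u + x0) F); [|apply HFc].
      apply cont_plus; [apply continuous_id|apply continuous_const]. }
    rewrite RInt_Rmult.
    - rewrite (local_density_substitution k r (fun u => F (u + x0)) Hr HFs).
      rewrite (RInt_shift_support F (local_density k r) a b); trivial.
      + rewrite <- RInt_Rmult.
        * apply RInt_ext; intros; eq_in_R; ring.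
        * intros u; apply cont_mult; auto.
      + apply local_density_csupp; trivial.
      + apply local_density_csupp_le; trivial.
    - intros x; set (f0 := fun z : nat -> C => F (0 + (x0 + local_log r (z p))) * gap k (z p)).
      apply (continuous_ext (fun x => f0 (upd z p (ce x)))).
      { intros t; unfold f0, upd; destruct (Nat.eq_dec p p) as [_|E]; [|contradiction].
        rewrite Rplus_0_l, (Rplus_comm x0); trivial. }
      apply (torus_slice_cont l f0 p z); trivial.
      intros e' He'; destruct (translate_modulus l F BF (fun z => x0 + local_log r (z p)) (fun z => gap k (z p)) e' He' HBF0 HFu HBF)
        as [d' [Hd' Hm']]; trivial.
      + apply torus_cont_plus; [apply torus_cont_const|].
        apply (torus_cont_coord l p (local_log r)); [trivial|apply local_log_ucont; trivial].
      + apply (torus_cont_coord l p (gap k)); [trivial|apply gap_ucont].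
      + exists d'; split; trivial; apply (Hm' 0). }
  assert (A1 := Hq1 q (fun _ => 0) (fun chi => W' (char_pt chi)) ltac:(lia) Hqp (fun chi => HW'1 _ (char_pt_torus chi))).
  assert (A2 := Hq3 q Theta ltac:(lia) Hqp HTb Hm HTc).
  rewrite (Avg_ext q (fun chi => torus_int p Theta (char_pt chi)) (fun chi =>
    RInt (fun u => F u * (local_density k r (u - log_euler_but sigma l p (char_pt chi)) * W (char_pt chi))) a b)) in A2
    by (intros chi _; apply HTint, char_pt_torus).
  assert (Hcd : forall x0 u, continuous (fun u => local_density k r (u - x0)) u).
  { intros x0 u; apply (continuous_comp (fun u => u - x0) (local_density k r)); [|apply local_density_cont; lra].
    apply cont_minus; [apply continuous_id|apply continuous_const]. }
  assert (HcW : forall x0 c u, continuous (fun u => local_density k r (u - x0) * c) u).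
  { intros x0 c u; apply cont_mult; [apply Hcd|apply continuous_const]. }
  rewrite <- (RInt_Avg q (fun chi u => F u * (local_density k r (u - log_euler_but sigma l p (char_pt chi)) * W (char_pt chi)))) in A2
    by (intros chi u; apply cont_mult; [apply HFc|apply HcW]).
  rewrite (RInt_ext _ (fun u => F u * N u)) in A2 by (intros u _; unfold N; rewrite <- Avg_scal; trivial).
  assert (HNc : forall u, continuous N u) by (intros u; apply cont_Avg; intros chi; apply HcW).
  assert (HPc : forall u, continuous (piece_density sigma p k W q) u).
  { intros u; apply cont_Avg; intros chi; apply HcW. }
  assert (A3 : Rabs (RInt (fun u => F u * piece_density sigma p k W q u) a b - RInt (fun u => F u * N u) a b) <= (b - a) * (BF * e3)).
  { apply RInt_close; trivial; try (intros u; apply cont_mult; auto).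
    intros u; rewrite <- Rmult_minus_distr_l, Rabs_mult; apply Rmult_le_compat; try apply Rabs_pos; auto.
    apply (Hq2 q u ltac:(lia) Hqp). }
  assert (A4 : (b - a) * (BF * e3) <= eps / 4).
  { assert (E : (4 * ((b - a) * BF + 1)) * e3 = eps) by (unfold e3; field; lra); nra. }
  cbv beta in A1; rewrite (Avg_ext q (fun chi => F (0 + log_L sigma chi) * W' (char_pt chi))
    (fun chi => F (log_L sigma chi) * (gap k (char_pt chi p) * W (char_pt chi)))) in A1
    by (intros chi _; rewrite Rplus_0_l; trivial).
  fold l in A1; change (Avg q (fun chi => F (0 + log_euler sigma l (char_pt chi)) * W' (char_pt chi)))
    with (Avg q (fun chi => Theta (char_pt chi))) in A1.
  apply Rabs_le_between in A1; apply Rabs_le_between in A2; apply Rabs_le_between in A3.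
  apply Rabs_le; lra.
Qed.

Lemma uniform_limit_continuous (m : R -> R) :
  (forall eps, 0 < eps -> exists g : R -> R, (forall u, continuous g u) /\ forall u, Rabs (g u - m u) <= eps) ->
  forall u, continuous m u.
Proof.
  intros H u; apply continuous_eps; intros eps He; destruct (H (eps / 3)) as [g [Hg Hgm]]; [lra|].
  assert (He3 : 0 < eps / 3) by lra.
  specialize (Hg u (ball (g u) (mkposreal _ He3)) (locally_ball _ _)); destruct Hg as [d Hd].
  exists d; split; [apply cond_pos|]; intros y Hy.
  assert (A : Rabs (g y - g u) < eps / 3) by (apply (Hd y Hy)).
  assert (A1 := Hgm y); assert (A2 := Hgm u).
  apply Rabs_lt_between in A; apply Rabs_le_between in A1; apply Rabs_le_between in A2; apply Rabs_le; lra.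
Qed.

Lemma piece_density_cont sigma p k W q u : 0 < sigma -> prime (Z.of_nat p) ->
  continuous (piece_density sigma p k W q) u.
Proof.
  intros Hs Hp; apply cont_Avg; intros chi; apply cont_mult; [|apply continuous_const].
  set (x0 := log_L sigma chi - _); apply (continuous_comp (fun u => u - x0) (local_density k (npow sigma p))).
  - apply cont_minus; [apply continuous_id|apply continuous_const].
  - apply local_density_cont, npow_pos.
Qed.

(** The local density is bounded whatever the other primes do, so only the mean of [W] remains: a
    weight concentrated on a rare event yields a uniformly small density. *)
Lemma piece_limit sigma p k W l0 omega q1 : 1 / 2 < sigma -> prime (Z.of_nat p) ->
  all_prime l0 -> weight l0 W -> indep_of p W ->
  (forall q, (q1 <= q)%nat -> prime (Z.of_nat q) -> Avg q (fun chi => W (char_pt chi)) <= omega) ->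
  exists m : R -> R, (forall u, continuous m u) /\
    (forall u, 0 <= m u <= 2 ^ k * / npow sigma p * omega) /\
    forall F a b, csupp F a b -> a <= b ->
      plim (fun q => Avg q (fun chi => F (log_L sigma chi) * (gap k (char_pt chi p) * W (char_pt chi))))
           (RInt (fun u => F u * m u) a b).
Proof.
  intros Hs Hp Hl0 HW HWp Homega.
  assert (Hr : 0 < npow sigma p < 1) by (apply npow_prime_range; [lra|trivial]).
  destruct (uniform_limit_along_primes (piece_density sigma p k W)) as [m Hm].
  { apply (piece_density_Cauchy sigma p k W l0); trivial. }
  assert (Hmc : forall u, continuous m u).
  { apply uniform_limit_continuous; intros eps He; destruct (Hm eps He) as [q0 Hq0].
    destruct (PrimeFieldUnits.prime_above q0) as [q [Hq Hqp]].
    exists (piece_density sigma p k W q); split.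
    - intros u; apply piece_density_cont; [lra|trivial].
    - intros u; apply Hq0; trivial; lia. }
  assert (Hlim : forall u, plim (fun q => piece_density sigma p k W q u) (m u)).
  { intros u eps He; destruct (Hm eps He) as [q0 Hq0]; exists q0; auto. }
  exists m; split; [trivial|split].
  - intros u; split.
    + apply (plim_ge _ _ _ 0%nat (Hlim u)); intros q _ _; apply Avg_nonneg; intros chi _.
      apply Rmult_le_pos; [apply local_density_nonneg; lra|apply HW, char_pt_torus].
    + apply (plim_le _ _ _ q1 (Hlim u)); intros q Hq Hqp.
      apply Rle_trans with (Avg q (fun chi => 2 ^ k * / npow sigma p * W (char_pt chi))).
      * apply Avg_le; intros chi _; apply Rmult_le_compat_r; [apply HW, char_pt_torus|].
        apply local_density_bound; trivial.
      * rewrite Avg_scal; apply Rmult_le_compat_l; [|apply Homega; trivial].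
        apply Rmult_le_pos; [apply pow_le; lra|apply Rlt_le, Rinv_0_lt_compat; lra].
  - intros F a b HF Hab eps He.
    destruct (csupp_bounded F a b HF) as [BF [HBF0 HBF]].
    set (e := eps / (2 * ((b - a) * BF + 1))).
    assert (HBab : 0 <= (b - a) * BF) by (apply Rmult_le_pos; lra).
    assert (He' : 0 < e) by (apply Rdiv_lt_0_compat; lra).
    destruct (piece_integral sigma p k W l0 F a b Hs Hp Hl0 HW HWp HF Hab (eps / 2) ltac:(lra)) as [q2 Hq2].
    destruct (Hm e He') as [q3 Hq3].
    exists (q2 + q3)%nat; intros q Hq Hqp; specialize (Hq2 q ltac:(lia) Hqp).
    assert (HFc := proj1 HF).
    assert (A : Rabs (RInt (fun u => F u * piece_density sigma p k W q u) a b - RInt (fun u => F u * m u) a b) <= (b - a) * (BF * e)).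
    { apply RInt_close; trivial; try (intros u; apply cont_mult; auto).
      - apply piece_density_cont; [lra|trivial].
      - intros u; rewrite <- Rmult_minus_distr_l, Rabs_mult; apply Rmult_le_compat; try apply Rabs_pos; auto.
        apply (Hq3 q u ltac:(lia) Hqp). }
    assert (E : (2 * ((b - a) * BF + 1)) * e = eps) by (unfold e; field; lra).
    assert (A' : (b - a) * (BF * e) <= eps / 2) by nra.
    apply Rabs_le_between in A; apply Rabs_le_between in Hq2; apply Rabs_le; lra.
Qed.

Lemma weight_mult l W W' : weight l W -> weight l W' -> weight l (fun z => W z * W' z).
Proof.
  intros HW HW'; split.
  - apply (torus_cont_mult l W W' 1); [lra| | |apply HW|apply HW']; apply (weight_bounded l); trivial.
  - intros z Hz; assert (A := proj2 HW z Hz); assert (A' := proj2 HW' z Hz); nra.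
Qed.

Lemma weight_bad l p k : In p l -> weight l (fun z => bad k (z p)).
Proof.
  intros Hp; split; [apply torus_cont_coord; [trivial|apply bad_ucont]|].
  intros z _; split; [apply Rlt_le, bad_pos|apply bad_le_1].
Qed.

Lemma indep_bad p p' k : p <> p' -> indep_of p (fun z => bad k (z p')).
Proof. intros H z c; unfold upd; destruct (Nat.eq_dec p' p); [congruence|trivial]. Qed.

Lemma indep_mult p W W' : indep_of p W -> indep_of p W' -> indep_of p (fun z => W z * W' z).
Proof. intros H H' z c; rewrite H, H'; trivial. Qed.

(** Integrating out the coordinate at [p] replaces [bad k] by its mean over the circle. Applied
    repeatedly, this evaluates products of cutoffs at distinct primes. *)
Lemma bad_Avg p k W l0 L : prime (Z.of_nat p) -> all_prime l0 -> weight l0 W -> indep_of p W ->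
  plim (fun q => Avg q (fun chi => W (char_pt chi))) L ->
  plim (fun q => Avg q (fun chi => bad k (char_pt chi p) * W (char_pt chi))) (/ 2 ^ k * L).
Proof.
  intros Hp Hl0 HW HWp HL eps He.
  destruct (exists_bound l0) as [M HM]; set (l := primes_upto (M + p)).
  assert (Hl : all_prime l) by apply primes_upto_prime.
  assert (Hnd : NoDup l) by apply primes_upto_NoDup.
  assert (Hpl : In p l) by (apply in_primes_upto; split; [lia|trivial]).
  assert (Hi : incl l0 l) by (apply primes_upto_incl; trivial; intros x Hx; specialize (HM x Hx); lia).
  assert (HWl : weight l W) by (split; [apply (torus_cont_incl l0); [trivial|apply HW]|apply HW]).
  assert (HT := weight_mult l (fun z => bad k (z p)) W (weight_bad l p k Hpl) HWl).
  set (f := fun z => bad k (z p) * W z) in *.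
  destruct (proj1 HT (eps / 14)) as [d [Hd Hm]]; [lra|].
  destruct (torus_int_Avg l p (eps / 14) d 1 Hl Hnd Hpl ltac:(lra) Hd ltac:(lra)) as [q1 [_ Hq1]].
  destruct (plim_scal (/ 2 ^ k) _ _ HL (eps / 2) ltac:(lra)) as [q2 Hq2].
  exists (q1 + q2)%nat; intros q Hq Hqp.
  assert (A := Hq1 q f ltac:(lia) Hqp (weight_bounded _ _ HT) Hm (proj1 HT)).
  specialize (Hq2 q ltac:(lia) Hqp).
  rewrite (Avg_ext q (fun chi => torus_int p f (char_pt chi)) (fun chi => / 2 ^ k * W (char_pt chi))) in A.
  - rewrite Avg_scal in A; change (Avg q (fun chi => bad k (char_pt chi p) * W (char_pt chi))) with (Avg q (fun chi => f (char_pt chi))).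
    apply Rabs_le_between in A; apply Rabs_le_between in Hq2; apply Rabs_le; lra.
  - intros chi _; unfold torus_int, f.
    rewrite (RInt_ext _ (fun x => W (char_pt chi) * bad k (ce x))).
    + rewrite RInt_Rmult.
      * rewrite (is_RInt_unique _ _ _ _ (bad_integral k)); apply Rmult_comm.
      * intros x; apply (continuous_ext (fun x => (fun z : nat -> C => bad k (z p)) (upd (char_pt chi) p (ce x)))).
        { intros t; unfold upd; destruct (Nat.eq_dec p p); [trivial|contradiction]. }
        apply (torus_slice_cont l (fun z => bad k (z p))); [apply weight_bad; trivial|apply char_pt_torus].
    + intros x _; rewrite HWp; unfold upd; destruct (Nat.eq_dec p p); [|contradiction]; eq_in_R; ring.
Qed.

Lemma plim_Avg_1 : plim (fun q => Avg q (fun _ => 1)) 1.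
Proof.
  intros eps He; exists 3%nat; intros q Hq Hqp.
  rewrite Avg_const, Rminus_diag, Rabs_R0 by trivial; lra.
Qed.

Lemma bad1_Avg p k : prime (Z.of_nat p) ->
  plim (fun q => Avg q (fun chi => bad k (char_pt chi p))) (/ 2 ^ k).
Proof.
  intros Hp; rewrite <- (Rmult_1_r (/ 2 ^ k)).
  apply (plim_ext_loc (fun q => Avg q (fun chi => bad k (char_pt chi p) * 1)) _ _ 0%nat).
  { intros q _ _; apply Avg_ext; intros; ring. }
  apply (bad_Avg p k (fun _ => 1) nil); trivial.
  - intros x [].
  - split; [apply torus_cont_const|intros; lra].
  - intros z c; trivial.
  - apply plim_Avg_1.
Qed.

Lemma all_prime_2 p p' : prime (Z.of_nat p) -> prime (Z.of_nat p') -> all_prime (p :: p' :: nil).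
Proof. intros H H' x [<-|[<-|[]]]; trivial. Qed.

Lemma bad2_Avg p p' i j : prime (Z.of_nat p) -> prime (Z.of_nat p') -> p <> p' ->
  plim (fun q => Avg q (fun chi => bad i (char_pt chi p) * bad j (char_pt chi p'))) (/ 2 ^ i * / 2 ^ j).
Proof.
  intros Hp Hp' Hpp; apply (bad_Avg p i (fun z => bad j (z p')) (p' :: nil)); trivial.
  - intros x [<-|[]]; trivial.
  - apply weight_bad; simpl; auto.
  - apply indep_bad; trivial.
  - apply bad1_Avg; trivial.
Qed.

(** The levels [i] and [j] are free above [k] because telescoping one factor at a time mixes the
    levels [k] and [S k]. *)
Lemma piece2_limit sigma p p' p'' k i j : 1 / 2 < sigma ->
  prime (Z.of_nat p) -> prime (Z.of_nat p') -> prime (Z.of_nat p'') -> p <> p' -> p <> p'' -> p' <> p'' ->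
  (k <= i)%nat -> (k <= j)%nat ->
  exists m : R -> R, (forall u, continuous m u) /\
    (forall u, 0 <= m u <= 2 * / npow sigma p * / 2 ^ k) /\
    forall F a b, csupp F a b -> a <= b ->
      plim (fun q => Avg q (fun chi => F (log_L sigma chi) *
             (gap k (char_pt chi p) * (bad i (char_pt chi p') * bad j (char_pt chi p'')))))
           (RInt (fun u => F u * m u) a b).
Proof.
  intros Hs Hp Hp' Hp'' H1 H2 H3 Hi Hj.
  assert (H2k : 0 < 2 ^ k) by (apply pow_lt; lra).
  set (W := fun z : nat -> C => bad i (z p') * bad j (z p'')).
  assert (HW : weight (p' :: p'' :: nil) W).
  { apply weight_mult; apply weight_bad; simpl; auto. }
  (* The tolerance equals the bound on the limit itself; this is the factor 2 in the conclusion. *)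
  destruct (bad2_Avg p' p'' i j Hp' Hp'' H3 (/ 2 ^ k * / 2 ^ k)) as [q1 Hq1].
  { apply Rmult_lt_0_compat; apply Rinv_0_lt_compat; trivial. }
  destruct (piece_limit sigma p k W (p' :: p'' :: nil) (2 * (/ 2 ^ k * / 2 ^ k)) q1 Hs Hp) as [m [Hm1 [Hm2 Hm3]]]; trivial.
  - apply all_prime_2; trivial.
  - apply indep_mult; apply indep_bad; trivial.
  - intros q Hq Hqp; specialize (Hq1 q Hq Hqp); apply Rabs_le_between in Hq1.
    assert (G : forall i, (k <= i)%nat -> 0 < / 2 ^ i <= / 2 ^ k).
    { intros i' Hi'; split; [apply Rinv_0_lt_compat, pow_lt; lra|].
      apply Rinv_le_contravar; [trivial|apply Rle_pow; [lra|trivial]]. }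
    assert (G1 := G i Hi); assert (G2 := G j Hj).
    assert (G3 : / 2 ^ i * / 2 ^ j <= / 2 ^ k * / 2 ^ k) by (apply Rmult_le_compat; lra).
    unfold W; lra.
  - exists m; split; [trivial|split; [|trivial]].
    intros u; specialize (Hm2 u); replace (2 * / npow sigma p * / 2 ^ k) with
      (2 ^ k * / npow sigma p * (2 * (/ 2 ^ k * / 2 ^ k))); trivial.
    field; split; [lra|apply Rgt_not_eq, npow_pos].
Qed.

Definition remainder (k : nat) (z : nat -> C) : R :=
  bad k (z 2%nat) * (bad k (z 3%nat) * bad k (z 5%nat)).

Lemma prime_5 : prime 5.
Proof.
  apply prime_alt; split; [lia|]; intros n Hn [c Hc].
  assert (n = 2 \/ n = 3 \/ n = 4)%Z as [E|[E|E]] by lia; subst n; lia.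
Qed.

Lemma remainder_telescope k z :
  gap k (z 2%nat) * (bad k (z 3%nat) * bad k (z 5%nat)) +
  (gap k (z 3%nat) * (bad (S k) (z 2%nat) * bad k (z 5%nat)) +
   gap k (z 5%nat) * (bad (S k) (z 2%nat) * bad (S k) (z 3%nat))) = remainder k z - remainder (S k) z.
Proof. unfold gap, remainder; ring. Qed.

Lemma csupp_mult_RInt_plus F m m' a b : (forall u, continuous F u) ->
  (forall u, continuous m u) -> (forall u, continuous m' u) ->
  RInt (fun u => F u * (m u + m' u)) a b = RInt (fun u => F u * m u) a b + RInt (fun u => F u * m' u) a b.
Proof.
  intros HF Hm Hm'; rewrite (RInt_ext _ (fun u => F u * m u + F u * m' u)) by (intros; eq_in_R; ring).
  apply (RInt_plus (V := R_CompleteNormedModule)); apply ex_RInt_cont; intros u; apply cont_mult; auto.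
Qed.

Lemma level_limit sigma : 1 / 2 < sigma -> exists K, 0 <= K /\ forall k,
  exists m : R -> R, (forall u, continuous m u) /\ (forall u, 0 <= m u <= K * / 2 ^ k) /\
    forall F a b, csupp F a b -> a <= b ->
      plim (fun q => Avg q (fun chi => F (log_L sigma chi) *
             (remainder k (char_pt chi) - remainder (S k) (char_pt chi))))
           (RInt (fun u => F u * m u) a b).
Proof.
  intros Hs.
  assert (P2 : prime (Z.of_nat 2)) by apply prime_2.
  assert (P3 : prime (Z.of_nat 3)) by apply prime_3.
  assert (P5 : prime (Z.of_nat 5)) by apply prime_5.
  exists (2 * / npow sigma 2 + (2 * / npow sigma 3 + 2 * / npow sigma 5)); split.
  { assert (Q := fun p => Rinv_0_lt_compat _ (npow_pos sigma p)).
    assert (Q2 := Q 2%nat); assert (Q3 := Q 3%nat); assert (Q5 := Q 5%nat); lra. }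
  intros k.
  destruct (piece2_limit sigma 2 3 5 k k k Hs P2 P3 P5) as [m1 [A1 [B1 C1]]]; try lia.
  destruct (piece2_limit sigma 3 2 5 k (S k) k Hs P3 P2 P5) as [m2 [A2 [B2 C2]]]; try lia.
  destruct (piece2_limit sigma 5 2 3 k (S k) (S k) Hs P5 P2 P3) as [m3 [A3 [B3 C3]]]; try lia.
  exists (fun u => m1 u + (m2 u + m3 u)); split; [|split].
  - intros u; apply cont_plus; [apply A1|apply cont_plus; [apply A2|apply A3]].
  - intros u; specialize (B1 u); specialize (B2 u); specialize (B3 u); rewrite !Rmult_plus_distr_r; lra.
  - intros F a b HF Hab.
    assert (A23 : forall u, continuous (fun u => m2 u + m3 u) u) by (intros u; apply cont_plus; auto).
    rewrite (csupp_mult_RInt_plus F m1 (fun u => m2 u + m3 u)), csupp_mult_RInt_plus by (trivial; apply HF).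
    apply (plim_ext_loc (fun q => Avg q (fun chi => F (log_L sigma chi) * (gap k (char_pt chi 2%nat) * (bad k (char_pt chi 3%nat) * bad k (char_pt chi 5%nat)))) +
      (Avg q (fun chi => F (log_L sigma chi) * (gap k (char_pt chi 3%nat) * (bad (S k) (char_pt chi 2%nat) * bad k (char_pt chi 5%nat)))) +
       Avg q (fun chi => F (log_L sigma chi) * (gap k (char_pt chi 5%nat) * (bad (S k) (char_pt chi 2%nat) * bad (S k) (char_pt chi 3%nat)))))) _ _ 0%nat).
    + intros q _ _; rewrite <- !Avg_plus; apply Avg_ext; intros chi _; rewrite <- remainder_telescope; ring.
    + apply plim_plus; [auto|apply plim_plus; auto].
Qed.

Lemma remainder_Avg k : plim (fun q => Avg q (fun chi => remainder k (char_pt chi))) (/ 2 ^ k * (/ 2 ^ k * / 2 ^ k)).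
Proof.
  assert (P2 : prime (Z.of_nat 2)) by apply prime_2.
  assert (P3 : prime (Z.of_nat 3)) by apply prime_3.
  assert (P5 : prime (Z.of_nat 5)) by apply prime_5.
  apply (bad_Avg 2 k (fun z => bad k (z 3%nat) * bad k (z 5%nat)) (3 :: 5 :: nil)%nat); trivial.
  - apply all_prime_2; trivial.
  - apply weight_mult; apply weight_bad; simpl; auto.
  - apply indep_mult; apply indep_bad; lia.
  - apply bad2_Avg; trivial; lia.
Qed.

Lemma half_pow_small c eps : 0 < eps -> exists K, c * / 2 ^ K <= eps.
Proof.
  intros He; destruct (nfloor_ex (Rabs c / eps)) as [N [_ HN]]; [apply Rdiv_le_0_compat; [apply Rabs_pos|trivial]|].
  exists (S N); assert (H2 : 0 < 2 ^ S N) by (apply pow_lt; lra).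
  apply (Rmult_le_reg_r (2 ^ S N)); trivial; rewrite Rmult_assoc, Rinv_l, Rmult_1_r by lra.
  assert (H3 : INR N + 1 <= 2 ^ S N).
  { rewrite <- S_INR; clear; induction (S N) as [|n IH]; [simpl; lra|].
    rewrite S_INR; simpl; assert (1 <= 2 ^ n) by (apply pow_R1_Rle; lra); lra. }
  apply (Rmult_lt_compat_l eps) in HN; trivial.
  replace (eps * (Rabs c / eps)) with (Rabs c) in HN by (field; lra).
  assert (H4 := Rle_abs c); nra.
Qed.

Lemma rsum_half_pow K a b : rsum (seq a b) (fun k => K * / 2 ^ k) = 2 * K * (/ 2 ^ a - / 2 ^ (a + b)).
Proof.
  rewrite <- (rsum_telescope (fun k => / 2 ^ k)), <- rsum_scal; apply rsum_ext; intros k _; simpl.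
  field; apply pow_nonzero; lra.
Qed.

(** The cutoff [bad k] has mean [2 ^ - k], while a density with cutoff [gap k] is [O(2 ^ k)]; two
    further primes with the cutoff [bad k] make the level [k] density [O(2 ^ - k)], hence summable. *)
Lemma limit_density sigma : 1 / 2 < sigma -> exists mu : R -> R,
  (forall u, continuous mu u) /\ (forall u, 0 <= mu u) /\ (exists B, forall u, mu u <= B) /\
  forall F a b, csupp F a b -> a <= b ->
    plim (fun q => Avg q (fun chi => F (log_L sigma chi))) (RInt (fun u => F u * mu u) a b).
Proof.
  intros Hs; destruct (level_limit sigma Hs) as [K [HK Hlev]].
  destruct (functional_choice _ Hlev) as [m Hm].
  assert (H2 : forall k, 0 < / 2 ^ k) by (intros; apply Rinv_0_lt_compat, pow_lt; lra).
  set (M := fun n u => rsum (seq 0 n) (fun k => m k u)).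
  assert (HMc : forall n u, continuous (M n) u).
  { intros n u; apply (cont_rsum (seq 0 n) (fun k u => m k u)); intros k _; apply Hm. }
  assert (HMd : forall n j u, 0 <= M (n + j)%nat u - M n u <= 2 * K * / 2 ^ n).
  { intros n j u; unfold M; rewrite seq_app, rsum_app, Nat.add_0_l.
    match goal with |- 0 <= ?A + ?B - ?A <= _ => replace (A + B - A) with B by ring end; split.
    - apply rsum_nonneg; intros k _; apply Hm.
    - eapply Rle_trans; [apply rsum_le; intros k _; apply Hm|].
      rewrite rsum_half_pow; apply Rmult_le_compat_l; [lra|]; assert (Q := H2 (n + j)%nat); lra. }
  assert (Hlim : forall u, is_lim_seq (fun n => M n u) (real (Lim_seq (fun n => M n u)))).
  { intros u; apply Lim_seq_correct', (ex_finite_lim_seq_incr _ (2 * K)).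
    - intros n; assert (Q := HMd n 1%nat u); rewrite Nat.add_1_r in Q; lra.
    - intros n; assert (Q := HMd 0%nat n u); rewrite Nat.add_0_l, pow_O, Rinv_1 in Q.
      change (M 0%nat u) with 0 in Q; lra. }
  set (mu := fun u => real (Lim_seq (fun n => M n u))).
  assert (Hmu : forall n u, 0 <= mu u - M n u <= 2 * K * / 2 ^ n).
  { intros n u; split.
    - assert (L : Rbar_le (M n u) (mu u)).
      { refine (is_lim_seq_le_loc _ _ _ _ _ (is_lim_seq_const _) (Hlim u)); exists n; intros j Hj.
        assert (Q := HMd n (j - n)%nat u); replace (n + (j - n))%nat with j in Q by lia; lra. }
      simpl in L; lra.
    - assert (L : Rbar_le (mu u) (M n u + 2 * K * / 2 ^ n)).
      { refine (is_lim_seq_le_loc _ _ _ _ _ (Hlim u) (is_lim_seq_const _)); exists n; intros j Hj.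
        assert (Q := HMd n (j - n)%nat u); replace (n + (j - n))%nat with j in Q by lia; lra. }
      simpl in L; lra. }
  assert (Hmuc : forall u, continuous mu u).
  { apply uniform_limit_continuous; intros eps He; destruct (half_pow_small (2 * K) eps He) as [n Hn].
    exists (M n); split; [apply HMc|]; intros u; assert (Q := Hmu n u); apply Rabs_le; lra. }
  exists mu; split; [trivial|split; [|split]].
  { intros u; assert (Q := Hmu 0%nat u); change (M 0%nat u) with 0 in Q; lra. }
  { exists (2 * K); intros u; assert (Q := Hmu 0%nat u); change (M 0%nat u) with 0 in Q; rewrite pow_O, Rinv_1 in Q; lra. }
  intros F a b HF Hab eps He.
  destruct (csupp_bounded F a b HF) as [BF [HBF0 HBF]].
  assert (HFc := proj1 HF).
  assert (HBab : 0 <= (b - a) * BF) by (apply Rmult_le_pos; lra).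
  (* The first summand covers the tail of the series of densities, the second the part of the law
     not yet decomposed. *)
  destruct (half_pow_small ((b - a) * BF * (2 * K) + 2 * BF) (eps / 3)) as [n Hn]; [lra|].
  (* The levels below [n] telescope to [1 - remainder n], since every [bad 0] is 1. *)
  assert (Hsum : plim (fun q => Avg q (fun chi => F (log_L sigma chi) * (1 - remainder n (char_pt chi)))) (RInt (fun u => F u * M n u) a b)).
  { clear Hn; induction n as [|n IH].
    - apply (plim_ext_loc (fun _ => 0) _ _ 0%nat).
      + intros q _ _; rewrite (Avg_ext q _ (fun _ => 0 * 0)); [rewrite Avg_scal; ring|].
        intros chi _; unfold remainder; rewrite !bad_0; ring.
      + rewrite (RInt_ext _ (fun _ => 0)); [|intros; unfold M; simpl; eq_in_R; ring].
        rewrite RInt_const; unfold scal; simpl; unfold mult; simpl; rewrite Rmult_0_r; apply plim_const.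
    - rewrite (RInt_ext _ (fun u => F u * (M n u + m n u))).
      2:{ intros u _; unfold M; rewrite seq_S, rsum_app; simpl; eq_in_R; ring. }
      rewrite csupp_mult_RInt_plus by (trivial; apply Hm).
      apply (plim_ext_loc (fun q => Avg q (fun chi => F (log_L sigma chi) * (1 - remainder n (char_pt chi))) +
         Avg q (fun chi => F (log_L sigma chi) * (remainder n (char_pt chi) - remainder (S n) (char_pt chi)))) _ _ 0%nat).
      + intros q _ _; rewrite <- Avg_plus; apply Avg_ext; intros; ring.
      + apply plim_plus; [apply IH|apply Hm; trivial]. }
  destruct (Hsum (eps / 3)) as [q1 Hq1]; [lra|].
  destruct (remainder_Avg n (/ 2 ^ n) (H2 n)) as [q2 Hq2].
  exists (q1 + q2)%nat; intros q Hq Hqp; specialize (Hq1 q ltac:(lia) Hqp); specialize (Hq2 q ltac:(lia) Hqp).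
  (* The remainder has limiting mean [/ 8 ^ n], at most [/ 2 ^ n], and the tolerance at finite [q]
     adds another [/ 2 ^ n]. *)
  assert (A1 : Rabs (Avg q (fun chi => F (log_L sigma chi) * remainder n (char_pt chi))) <= BF * (2 * / 2 ^ n)).
  { eapply Rle_trans; [apply Avg_abs|].
    apply Rle_trans with (Avg q (fun chi => BF * remainder n (char_pt chi))).
    - apply Avg_le; intros chi _.
      assert (Q : 0 <= remainder n (char_pt chi)).
      { unfold remainder; assert (B := fun p => bad_pos n (char_pt chi p)).
        apply Rmult_le_pos; [apply Rlt_le, B|apply Rmult_le_pos; apply Rlt_le, B]. }
      rewrite Rabs_mult, (Rabs_pos_eq _ Q); apply Rmult_le_compat_r; trivial.
    - rewrite Avg_scal; apply Rmult_le_compat_l; trivial.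
      apply Rabs_le_between in Hq2.
      assert (Q1 : / 2 ^ n <= 1).
      { rewrite <- Rinv_1; apply Rinv_le_contravar; [lra|apply pow_R1_Rle; lra]. }
      assert (Q := H2 n); assert (Q2 : / 2 ^ n * / 2 ^ n <= 1) by nra; nra. }
  assert (A2 : Rabs (RInt (fun u => F u * M n u) a b - RInt (fun u => F u * mu u) a b) <= (b - a) * (BF * (2 * K * / 2 ^ n))).
  { apply RInt_close; trivial; try (intros u; apply cont_mult; auto).
    intros u; rewrite <- Rmult_minus_distr_l, Rabs_mult; apply Rmult_le_compat; try apply Rabs_pos; auto.
      assert (Q := Hmu n u); apply Rabs_le; lra. }
  assert (E : Avg q (fun chi => F (log_L sigma chi)) =
     Avg q (fun chi => F (log_L sigma chi) * (1 - remainder n (char_pt chi))) + Avg q (fun chi => F (log_L sigma chi) * remainder n (char_pt chi))).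
  { rewrite <- Avg_plus; apply Avg_ext; intros; ring. }
  rewrite E; apply Rabs_le_between in Hq1; apply Rabs_le_between in A1; apply Rabs_le_between in A2.
  apply Rabs_le; nra.
Qed.

(** * Test functions *)

(** The sum over [X'] as a sum over [X] with an indicator, so that the rules for [Avg] apply. *)
Definition AvgG (sigma : R) (Phi : R -> R) (q : nat) : R :=
  Avg q (fun chi => indic (G chi (RtoC sigma)) * Phi (log_L sigma chi)).

Lemma indic_range P : 0 <= indic P <= 1.
Proof. unfold indic; destruct (excluded_middle_informative P); lra. Qed.

Lemma Avg_not_G sigma : 1 / 2 < sigma -> plim (fun q => Avg q (fun chi => 1 - indic (G chi (RtoC sigma)))) 0.
Proof.
  intros Hs eps He; destruct (log_L_approx_Avg sigma (eps / 2) Hs) as [Y HY]; [lra|].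
  destruct (HY Y (Nat.le_refl Y)) as [q0 [_ Hq0]]; exists q0; intros q Hq Hqp.
  destruct (Hq0 q Hq Hqp) as [_ A]; rewrite Rminus_0_r, Rabs_pos_eq.
  - eapply Rle_trans; [|eapply Rle_trans; [exact A|lra]]; apply Avg_le; intros chi _.
    unfold indic; destruct (excluded_middle_informative (G chi (RtoC sigma))) as [H|H];
      destruct (excluded_middle_informative _) as [N|N]; try lra.
    apply NNPP in N; destruct N; contradiction.
  - apply Avg_nonneg; intros chi _; assert (H := indic_range (G chi (RtoC sigma))); lra.
Qed.

Lemma AvgG_close sigma Phi Psi c q :
  (forall x, Rabs (Phi x) <= Psi x) -> c = AvgG sigma Psi q -> Rabs (AvgG sigma Phi q) <= c.
Proof.
  intros H ->; eapply Rle_trans; [apply Avg_abs|]; apply Avg_le; intros chi _.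
  assert (I := indic_range (G chi (RtoC sigma))); rewrite Rabs_mult, (Rabs_pos_eq (indic _)) by lra.
  apply Rmult_le_compat_l; [lra|apply H].
Qed.

(** Cauchy's criterion for Riemann sums: on a fine tagged subdivision the sum of [f] differs from
    that of [g] by at most that of [h], which is close to the small integral of [h]. *)
Lemma ex_RInt_sandwich (f : R -> R) a b : a <= b ->
  (forall eps, 0 < eps -> exists g h : R -> R, ex_RInt g a b /\ ex_RInt h a b /\
     (forall t, a <= t <= b -> Rabs (f t - g t) <= h t) /\ RInt h a b <= eps) -> ex_RInt f a b.
Proof.
  intros [Hab| ->] H; [|apply ex_RInt_point].
  assert (Hsg : sign (b - a) = 1) by (apply sign_eq_1; lra).
  apply (filterlim_locally_cauchy (U := R_CompleteSpace) (F := Riemann_fine a b)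
    (fun ptd => scal (sign (b - a)) (Riemann_sum f ptd))).
  intros eps; assert (He := cond_pos eps); assert (He8 : 0 < eps / 8) by lra.
  destruct (H (eps / 8) He8) as [g [h [[Ig Hg] [[Ih Hh] [Hfg Hh2]]]]].
  rewrite (is_RInt_unique _ _ _ _ Hh) in Hh2.
  assert (Pg := Hg _ (locally_ball Ig (mkposreal _ He8))); assert (Ph := Hh _ (locally_ball Ih (mkposreal _ He8))).
  unfold filtermap in Pg, Ph.
  set (good := fun ptd => pointed_subdiv ptd /\ SF_h ptd = Rmin a b /\ seq.last (SF_h ptd) (SF_lx ptd) = Rmax a b).
  assert (Pd : Riemann_fine a b good).
  { exists (mkposreal 1 Rlt_0_1); intros y _ Hy; exact Hy. }
  exists (fun ptd => good ptd /\ ball Ig (eps / 8) (scal (sign (b - a)) (Riemann_sum g ptd)) /\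
     ball Ih (eps / 8) (scal (sign (b - a)) (Riemann_sum h ptd))).
  split; [apply filter_and; [exact Pd|apply filter_and; [exact Pg|exact Ph]]|].
  (* One part in eight for [g] and two for [h]; two such sums then differ by at most
     [6 * (eps / 8)]. *)
  assert (K : forall ptd, good ptd /\ ball Ig (eps / 8) (scal (sign (b - a)) (Riemann_sum g ptd)) /\
     ball Ih (eps / 8) (scal (sign (b - a)) (Riemann_sum h ptd)) -> Rabs (Riemann_sum f ptd - Ig) <= 3 * (eps / 8)).
  { intros ptd [[G1 [G2 G3]] [B1 B2]]; rewrite Hsg in B1, B2.
    change (Rabs (1 * Riemann_sum g ptd - Ig) < eps / 8) in B1.
    change (Rabs (1 * Riemann_sum h ptd - Ih) < eps / 8) in B2.
    rewrite Rmult_1_l in B1, B2.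
    assert (N : Rabs (Riemann_sum f ptd - Riemann_sum g ptd) <= Riemann_sum h ptd).
    { assert (E := Riemann_sum_minus (V := R_NormedModule) f g ptd).
      change (minus (Riemann_sum f ptd) (Riemann_sum g ptd)) with (Riemann_sum f ptd - Riemann_sum g ptd) in E.
      rewrite <- E; apply (Riemann_sum_norm (V := R_NormedModule) (fun x => minus (f x) (g x)) h ptd G1).
      intros t Ht; rewrite G3, G2, Rmin_left, Rmax_right in Ht by lra; apply Hfg; trivial. }
    apply Rabs_lt_between in B1; apply Rabs_lt_between in B2; apply Rabs_le_between in N; apply Rabs_le; lra. }
  intros u v Hu Hv; apply K in Hu; apply K in Hv; rewrite Hsg.
  change (Rabs (1 * Riemann_sum f v - 1 * Riemann_sum f u) < eps); rewrite !Rmult_1_l.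
  apply Rabs_le_between in Hu; apply Rabs_le_between in Hv; apply Rabs_lt_between; lra.
Qed.

(** Integrability belongs to the property, so that it is inherited together with the limit under
    linear combinations and squeezing. *)
Definition good_test (sigma : R) (mu : R -> R) (a b : R) (Phi : R -> R) : Prop :=
  (forall x, x < a \/ b < x -> Phi x = 0) /\
  ex_RInt (fun u => Phi u * mu u) a b /\
  plim (AvgG sigma Phi) (RInt (fun u => Phi u * mu u) a b).

Lemma good_test_ext sigma mu a b Phi Psi : (forall x, Phi x = Psi x) ->
  good_test sigma mu a b Phi -> good_test sigma mu a b Psi.
Proof. intros H; replace Psi with Phi; trivial; apply functional_extensionality; trivial. Qed.

Lemma good_test_0 sigma mu a b : good_test sigma mu a b (fun _ => 0).
Proof.
  assert (E : forall u, 0 * mu u = 0) by (intros; ring).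
  split; [trivial|split].
  - apply (ex_RInt_ext (fun _ => 0)); [intros; symmetry; apply E|apply ex_RInt_const].
  - rewrite RInt_zero_ext by (intros; apply E).
    apply (plim_ext_loc (fun _ => 0) _ _ 0%nat); [|apply plim_const].
    intros q _ _; unfold AvgG; rewrite (Avg_ext q _ (fun _ => 0 * 0)); [rewrite Avg_scal; ring|intros; ring].
Qed.

Lemma good_test_plus sigma mu a b Phi Psi : good_test sigma mu a b Phi -> good_test sigma mu a b Psi ->
  good_test sigma mu a b (fun x => Phi x + Psi x) /\
  RInt (fun u => (Phi u + Psi u) * mu u) a b = RInt (fun u => Phi u * mu u) a b + RInt (fun u => Psi u * mu u) a b.
Proof.
  intros [A1 [A2 A3]] [B1 [B2 B3]].
  assert (E : RInt (fun u => (Phi u + Psi u) * mu u) a b = RInt (fun u => Phi u * mu u) a b + RInt (fun u => Psi u * mu u) a b).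
  { rewrite (RInt_ext _ (fun u => Phi u * mu u + Psi u * mu u)) by (intros; eq_in_R; ring).
    apply (RInt_plus (V := R_CompleteNormedModule)); trivial. }
  split; [|exact E]; split; [|split].
  - intros x Hx; rewrite A1, B1 by trivial; ring.
  - apply (ex_RInt_ext (fun u => Phi u * mu u + Psi u * mu u)); [intros; eq_in_R; ring|].
    apply (ex_RInt_plus (V := R_NormedModule)); trivial.
  - rewrite E; apply (plim_ext_loc (fun q => AvgG sigma Phi q + AvgG sigma Psi q) _ _ 0%nat).
    + intros q _ _; unfold AvgG; rewrite <- Avg_plus; apply Avg_ext; intros; ring.
    + apply plim_plus; trivial.
Qed.

Lemma good_test_scal sigma mu a b c Phi : good_test sigma mu a b Phi ->
  good_test sigma mu a b (fun x => c * Phi x) /\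
  RInt (fun u => c * Phi u * mu u) a b = c * RInt (fun u => Phi u * mu u) a b.
Proof.
  intros [A1 [A2 A3]].
  assert (E : RInt (fun u => c * Phi u * mu u) a b = c * RInt (fun u => Phi u * mu u) a b).
  { rewrite (RInt_ext _ (fun u => c * (Phi u * mu u))) by (intros; eq_in_R; ring).
    apply (RInt_scal (V := R_CompleteNormedModule)); trivial. }
  split; [|exact E]; split; [|split].
  - intros x Hx; rewrite A1 by trivial; ring.
  - apply (ex_RInt_ext (fun u => c * (Phi u * mu u))); [intros; eq_in_R; ring|].
    apply (ex_RInt_scal (V := R_NormedModule)); trivial.
  - rewrite E; apply (plim_ext_loc (fun q => c * AvgG sigma Phi q) _ _ 0%nat).
    + intros q _ _; unfold AvgG; rewrite <- Avg_scal; apply Avg_ext; intros; ring.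
    + apply plim_scal; trivial.
Qed.

(** The error function [psi] must itself be good: the smallness of its integral then carries over to
    its averages for large [q], and these bound the averages of [Phi - phi]. *)
Lemma good_test_sandwich sigma mu a b Phi : a <= b -> (forall u, 0 <= mu u) ->
  (forall x, x < a \/ b < x -> Phi x = 0) ->
  (forall eps, 0 < eps -> exists phi psi, good_test sigma mu a b phi /\ good_test sigma mu a b psi /\
     (forall x, Rabs (Phi x - phi x) <= psi x) /\ RInt (fun u => psi u * mu u) a b <= eps) ->
  good_test sigma mu a b Phi.
Proof.
  intros Hab Hmu H0 H.
  assert (Hpt : forall phi psi, (forall x, Rabs (Phi x - phi x) <= psi x) ->
    forall u, Rabs (Phi u * mu u - phi u * mu u) <= psi u * mu u).
  { intros phi psi Hp u; rewrite <- Rmult_minus_distr_r, Rabs_mult, (Rabs_pos_eq (mu u)) by apply Hmu.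
    apply Rmult_le_compat_r; [apply Hmu|apply Hp]. }
  assert (Hex : ex_RInt (fun u => Phi u * mu u) a b).
  { apply ex_RInt_sandwich; trivial; intros eps He; destruct (H eps He) as [phi [psi [A [B [C D]]]]].
    exists (fun u => phi u * mu u), (fun u => psi u * mu u); split; [apply A|split; [apply B|split; trivial]].
    intros t _; apply Hpt; trivial. }
  split; [trivial|split; [trivial|]].
  intros eps He; destruct (H (eps / 4)) as [phi [psi [A [B [C D]]]]]; [lra|].
  destruct (proj2 (proj2 A) (eps / 4)) as [q1 Hq1]; [lra|].
  destruct (proj2 (proj2 B) (eps / 4)) as [q2 Hq2]; [lra|].
  exists (q1 + q2)%nat; intros q Hq Hqp; specialize (Hq1 q ltac:(lia) Hqp); specialize (Hq2 q ltac:(lia) Hqp).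
  assert (E1 : Rabs (AvgG sigma Phi q - AvgG sigma phi q) <= AvgG sigma psi q).
  { replace (AvgG sigma Phi q - AvgG sigma phi q) with (AvgG sigma (fun x => Phi x - phi x) q).
    - apply (AvgG_close sigma _ psi); trivial.
    - unfold AvgG; rewrite <- Avg_minus; apply Avg_ext; intros; ring. }
  assert (E2 : Rabs (RInt (fun u => Phi u * mu u) a b - RInt (fun u => phi u * mu u) a b) <= RInt (fun u => psi u * mu u) a b).
  { assert (E := RInt_minus (V := R_CompleteNormedModule) _ _ a b Hex (proj1 (proj2 A))).
    unfold minus, plus, opp in E; simpl in E; unfold Rminus; rewrite <- E.
    assert (Hd := ex_RInt_minus (V := R_NormedModule) _ _ a b Hex (proj1 (proj2 A))).
    eapply Rle_trans; [apply abs_RInt_le; trivial|].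
    apply RInt_le; [trivial|exact (ex_RInt_norm _ a b Hd)|apply B|].
    intros t _; apply Hpt; trivial. }
  apply Rabs_le_between in Hq1; apply Rabs_le_between in Hq2; apply Rabs_le_between in E1; apply Rabs_le_between in E2.
  apply Rabs_le; lra.
Qed.

Definition limit_law (sigma : R) (mu : R -> R) : Prop :=
  (forall u, continuous mu u) /\ (forall u, 0 <= mu u) /\
  forall F a b, csupp F a b -> a <= b ->
    plim (fun q => Avg q (fun chi => F (log_L sigma chi))) (RInt (fun u => F u * mu u) a b).

(** Since [F] is bounded and the excluded characters have proportion tending to 0, their values of
    [log_L], possibly the default value of [ln] at 0, do not affect the limit. *)
Lemma good_test_csupp sigma mu F a b : 1 / 2 < sigma -> limit_law sigma mu -> csupp F a b -> a <= b ->
  good_test sigma mu a b F.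
Proof.
  intros Hs [Hc [_ Hmu]] HF Hab; split; [apply HF|split].
  - apply ex_RInt_cont; intros u; apply cont_mult; [apply HF|apply Hc].
  - destruct (csupp_bounded F a b HF) as [B [HB0 HB]]; intros eps He.
    destruct (Hmu F a b HF Hab (eps / 2)) as [q1 Hq1]; [lra|].
    destruct (plim_scal B _ _ (Avg_not_G sigma Hs) (eps / 2)) as [q2 Hq2]; [lra|].
    exists (q1 + q2)%nat; intros q Hq Hqp; specialize (Hq1 q ltac:(lia) Hqp); specialize (Hq2 q ltac:(lia) Hqp).
    assert (E : Rabs (AvgG sigma F q - Avg q (fun chi => F (log_L sigma chi))) <= B * Avg q (fun chi => 1 - indic (G chi (RtoC sigma)))).
    { unfold AvgG; rewrite <- Avg_minus, <- Avg_scal; eapply Rle_trans; [apply Avg_abs|]; apply Avg_le; intros chi _.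
      assert (I := indic_range (G chi (RtoC sigma))).
      replace (indic (G chi (RtoC sigma)) * F (log_L sigma chi) - F (log_L sigma chi)) with
        (- ((1 - indic (G chi (RtoC sigma))) * F (log_L sigma chi))) by ring.
      rewrite Rabs_Ropp, Rabs_mult, Rabs_pos_eq, Rmult_comm by lra; apply Rmult_le_compat_r; [lra|apply HB]. }
    rewrite Rmult_0_r, Rminus_0_r in Hq2.
    apply Rabs_le_between in Hq1; apply Rabs_le_between in Hq2; apply Rabs_le_between in E; apply Rabs_le; lra.
Qed.

(** Height 2 and half-width [2 * delta]: it is at least 1 within [delta] of [e], enough to absorb
    the error of a continuous approximation at a jump. *)
Definition tent (e delta x : R) : R := Rmax 0 (2 - Rabs (x - e) * / delta).

Lemma tent_csupp e delta : 0 < delta -> csupp (tent e delta) (e - 2 * delta) (e + 2 * delta).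
Proof.
  intros Hd; split.
  - intros x; apply cont_max; [apply continuous_const|]; apply cont_minus; [apply continuous_const|].
    apply cont_mult; [|apply continuous_const]; apply continuous_Rabs_comp, cont_minus; [apply continuous_id|apply continuous_const].
  - intros x Hx; apply Rmax_left.
    assert (H : 2 * delta <= Rabs (x - e)) by (unfold Rabs; destruct (Rcase_abs _); lra).
    apply (Rmult_le_compat_r (/ delta)) in H; [|apply Rlt_le, Rinv_0_lt_compat; trivial].
    rewrite Rmult_assoc, Rinv_r, Rmult_1_r in H by lra; lra.
Qed.

Lemma tent_range e delta x : 0 < delta -> 0 <= tent e delta x <= 2.
Proof.
  intros Hd; split; [apply Rmax_l|]; apply Rmax_lub; [lra|].
  assert (H : 0 <= Rabs (x - e) * / delta).
  { apply Rmult_le_pos; [apply Rabs_pos|apply Rlt_le, Rinv_0_lt_compat; trivial]. }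
  lra.
Qed.

Lemma tent_ge_1 e delta x : 0 < delta -> Rabs (x - e) <= delta -> 1 <= tent e delta x.
Proof.
  intros Hd H; eapply Rle_trans; [|apply Rmax_r].
  apply (Rmult_le_compat_r (/ delta)) in H; [|apply Rlt_le, Rinv_0_lt_compat; trivial].
  rewrite Rinv_r in H by lra; lra.
Qed.

Lemma csupp_weaken F a b a' b' : a' <= a -> b <= b' -> csupp F a b -> csupp F a' b'.
Proof. intros Ha Hb [H1 H2]; split; trivial; intros x Hx; apply H2; lra. Qed.

(** The tent has mass at most [8 * B * delta], from its height 2, its base [4 * delta] and the bound
    [B] on the density. Here boundedness of the density rules out concentration at a point. *)
Lemma tent_good sigma mu a b e B eps : 1 / 2 < sigma -> limit_law sigma mu -> (forall u, mu u <= B) ->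
  a < e < b -> 0 < eps -> exists delta0, 0 < delta0 /\ forall delta, 0 < delta <= delta0 ->
    good_test sigma mu a b (tent e delta) /\ RInt (fun u => tent e delta u * mu u) a b <= eps.
Proof.
  intros Hs Hmu HB He Heps.
  assert (HB0 : 0 <= B) by (eapply Rle_trans; [apply (proj1 (proj2 Hmu) 0)|apply HB]).
  set (d0 := Rmin (Rmin ((e - a) / 2) ((b - e) / 2)) (eps / (8 * (B + 1)))).
  assert (Hd0 : 0 < d0).
  { apply Rmin_glb_lt; [apply Rmin_glb_lt; lra|apply Rdiv_lt_0_compat; lra]. }
  exists d0; split; trivial; intros delta Hd.
  assert (M1 := Rmin_l (Rmin ((e - a) / 2) ((b - e) / 2)) (eps / (8 * (B + 1)))).
  assert (M2 := Rmin_r (Rmin ((e - a) / 2) ((b - e) / 2)) (eps / (8 * (B + 1)))).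
  assert (M3 := Rmin_l ((e - a) / 2) ((b - e) / 2)); assert (M4 := Rmin_r ((e - a) / 2) ((b - e) / 2)).
  fold d0 in M1, M2.
  assert (HT := tent_csupp e delta (proj1 Hd)).
  split.
  - apply good_test_csupp; trivial; [|lra]; apply (csupp_weaken _ (e - 2 * delta) (e + 2 * delta)); trivial; lra.
  - assert (HTm : csupp (fun u => tent e delta u * mu u) (e - 2 * delta) (e + 2 * delta)).
    { split; [intros u; apply cont_mult; [apply HT|apply Hmu]|]; intros x Hx; rewrite (proj2 HT) by trivial; ring. }
    rewrite (RInt_enlarge _ _ _ a b HTm) by lra.
    eapply Rle_trans; [apply Rle_abs|].
    eapply Rle_trans; [apply (abs_RInt_le_const _ _ _ (2 * B)); [lra|apply ex_RInt_cont, HTm|]|].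
    + intros t _; assert (Q := tent_range e delta t (proj1 Hd)).
      assert (Q1 := proj1 (proj2 Hmu) t); assert (Q2 := HB t); rewrite Rabs_pos_eq by nra; nra.
    + assert (E : (8 * (B + 1)) * (eps / (8 * (B + 1))) = eps) by (field; lra); nra.
Qed.

Definition at_point_fun (e x : R) : R := if Req_dec_T x e then 1 else 0.

Definition on_interval (c d x : R) : R :=
  if Rlt_dec c x then if Rlt_dec x d then 1 else 0 else 0.

Lemma good_test_point sigma mu a b e B : 1 / 2 < sigma -> limit_law sigma mu -> (forall u, mu u <= B) ->
  a < e < b -> good_test sigma mu a b (at_point_fun e) /\ RInt (fun u => at_point_fun e u * mu u) a b <= 0.
Proof.
  intros Hs Hmu HB He; split.
  - apply good_test_sandwich; [lra|apply Hmu| |].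
    + intros x Hx; unfold at_point_fun; destruct (Req_dec_T x e); lra.
    + intros eps Heps; destruct (tent_good sigma mu a b e B eps Hs Hmu HB He Heps) as [d [Hd H]].
      destruct (H d ltac:(lra)) as [H1 H2].
      exists (fun _ => 0), (tent e d); split; [apply good_test_0|split; [trivial|split; trivial]].
      intros x; rewrite Rminus_0_r; unfold at_point_fun; destruct (Req_dec_T x e) as [->|N].
      * rewrite Rabs_R1; apply tent_ge_1; trivial; rewrite Rminus_diag, Rabs_R0; lra.
      * rewrite Rabs_R0; apply tent_range; trivial.
  - right; assert (Ex : forall c d, d <= e \/ e <= c -> c <= d -> ex_RInt (fun u => at_point_fun e u * mu u) c d /\ RInt (fun u => at_point_fun e u * mu u) c d = 0).
    { intros c d Hcd Hcd'; assert (Ez : forall x, Rmin c d < x < Rmax c d -> at_point_fun e x * mu x = 0).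
      { intros x; rewrite Rmin_left, Rmax_right by trivial; intros Hx; unfold at_point_fun; destruct (Req_dec_T x e); [lra|ring]. }
      split; [|apply RInt_zero_ext; trivial].
      apply (ex_RInt_ext (fun _ => 0)); [intros x Hx; symmetry; apply Ez; trivial|apply ex_RInt_const]. }
    destruct (Ex a e) as [E1 E2]; [lra|lra|]; destruct (Ex e b) as [E3 E4]; [lra|lra|].
    rewrite <- (RInt_Chasles _ a e b E1 E3), E2, E4; change plus with Rplus; eq_in_R; ring.
Qed.

Lemma good_test_interval sigma mu a b c d B : 1 / 2 < sigma -> limit_law sigma mu -> (forall u, mu u <= B) ->
  a < c -> c <= d -> d < b ->
  good_test sigma mu a b (on_interval c d) /\ RInt (fun u => on_interval c d u * mu u) a b <= B * (d - c).
Proof.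
  intros Hs Hmu HB Hac Hcd Hdb; split.
  - apply good_test_sandwich; [lra|apply Hmu| |].
    + intros x Hx; unfold on_interval; destruct (Rlt_dec c x), (Rlt_dec x d); lra.
    + intros eps Heps.
      destruct (tent_good sigma mu a b c B (eps / 2) Hs Hmu HB ltac:(lra) ltac:(lra)) as [d1 [Hd1 H1]].
      destruct (tent_good sigma mu a b d B (eps / 2) Hs Hmu HB ltac:(lra) ltac:(lra)) as [d2 [Hd2 H2]].
      set (de := Rmin d1 d2); assert (Hde : 0 < de) by (apply Rmin_glb_lt; trivial).
      destruct (H1 de (conj Hde (Rmin_l _ _))) as [A1 A2]; destruct (H2 de (conj Hde (Rmin_r _ _))) as [B1 B2].
      (* A trapezoid vanishing at both ends; it differs from the indicator only within [de] of an
         endpoint, where a tent is at least 1. *)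
      set (phi := fun x => Rmax 0 (Rmin 1 (Rmin (x - c) (d - x) * / de))).
      assert (Hdei : 0 < / de) by (apply Rinv_0_lt_compat; trivial).
      assert (Hphi : csupp phi c d).
      { assert (Hmin : forall f g : R -> R, forall x, continuous f x -> continuous g x -> continuous (fun y => Rmin (f y) (g y)) x).
        { intros f g x Hf Hg; apply (continuous_ext (fun y => - Rmax (- f y) (- g y))).
          - intros y; rewrite <- Ropp_Rmin, Ropp_involutive; trivial.
          - apply cont_opp, cont_max; apply cont_opp; trivial. }
        split.
        - intros x; apply cont_max; [apply continuous_const|]; apply Hmin; [apply continuous_const|].
          apply cont_mult; [|apply continuous_const].
          apply Hmin; apply cont_minus; (apply continuous_id || apply continuous_const).
        - intros x Hx; apply Rmax_left; eapply Rle_trans; [apply Rmin_r|].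
          assert (Hneg : Rmin (x - c) (d - x) <= 0).
          { destruct Hx; [eapply Rle_trans; [apply Rmin_l|lra]|eapply Rle_trans; [apply Rmin_r|lra]]. }
          nra. }
      destruct (good_test_plus _ _ _ _ _ _ A1 B1) as [C1 C2].
      exists phi, (fun x => tent c de x + tent d de x); split; [|split; [trivial|split; [|lra]]].
      * apply good_test_csupp; trivial; [apply (csupp_weaken _ c d); trivial; lra|lra].
      * intros x; assert (T1 := tent_range c de x Hde); assert (T2 := tent_range d de x Hde).
        assert (P1 : 0 <= phi x <= 1).
        { split; [apply Rmax_l|apply Rmax_lub; [lra|apply Rmin_l]]. }
        unfold on_interval; destruct (Rlt_dec c x) as [X1|X1]; [destruct (Rlt_dec x d) as [X2|X2]|].
        -- destruct (Rle_lt_dec (Rabs (x - c)) de) as [Y1|Y1].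
           { assert (Z := tent_ge_1 c de x Hde Y1); apply Rabs_le; lra. }
           destruct (Rle_lt_dec (Rabs (x - d)) de) as [Y2|Y2].
           { assert (Z := tent_ge_1 d de x Hde Y2); apply Rabs_le; lra. }
           rewrite Rabs_pos_eq in Y1 by lra; rewrite Rabs_left1 in Y2 by lra.
           assert (Z : phi x = 1).
           { unfold phi; rewrite Rmin_left; [apply Rmax_right; lra|].
             assert (W : de <= Rmin (x - c) (d - x)) by (apply Rmin_glb; lra).
             apply (Rmult_le_compat_r (/ de)) in W; [|lra]; rewrite Rinv_r in W by lra; exact W. }
           rewrite Z, Rminus_diag, Rabs_R0; lra.
        -- assert (Z : phi x = 0 \/ x = d) by (destruct (Req_dec_T x d); [right; trivial|left; apply Hphi; lra]).
           destruct Z as [Z| ->]; [rewrite Z, Rminus_0_r, Rabs_R0; lra|].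
           assert (Z := tent_ge_1 d de d Hde); rewrite Rminus_diag, Rabs_R0 in Z; specialize (Z ltac:(lra)).
           apply Rabs_le; lra.
        -- assert (Z : phi x = 0 \/ x = c) by (destruct (Req_dec_T x c); [right; trivial|left; apply Hphi; lra]).
           destruct Z as [Z| ->]; [rewrite Z, Rminus_0_r, Rabs_R0; lra|].
           assert (Z := tent_ge_1 c de c Hde); rewrite Rminus_diag, Rabs_R0 in Z; specialize (Z ltac:(lra)).
           apply Rabs_le; lra.
  - assert (Ex : forall s t, t <= c \/ d <= s -> s <= t -> ex_RInt (fun u => on_interval c d u * mu u) s t /\ RInt (fun u => on_interval c d u * mu u) s t = 0).
    { intros s t Hst Hst'; assert (Ez : forall x, Rmin s t < x < Rmax s t -> on_interval c d x * mu x = 0).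
      { intros x; rewrite Rmin_left, Rmax_right by trivial; intros Hx; unfold on_interval.
        destruct (Rlt_dec c x), (Rlt_dec x d); (lra || ring). }
      split; [|apply RInt_zero_ext; trivial].
      apply (ex_RInt_ext (fun _ => 0)); [intros x Hx; symmetry; apply Ez; trivial|apply ex_RInt_const]. }
    assert (Em : forall x, Rmin c d < x < Rmax c d -> mu x = on_interval c d x * mu x).
    { intros x; rewrite Rmin_left, Rmax_right by trivial; intros Hx; unfold on_interval.
      destruct (Rlt_dec c x), (Rlt_dec x d); (lra || ring). }
    assert (E5 : ex_RInt (fun u => on_interval c d u * mu u) c d).
    { apply (ex_RInt_ext mu); [exact Em|apply ex_RInt_cont, Hmu]. }
    destruct (Ex a c) as [E1 E2]; [lra|lra|]; destruct (Ex d b) as [E3 E4]; [lra|lra|].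
    rewrite <- (RInt_Chasles _ a c b E1 (ex_RInt_Chasles _ c d b E5 E3)), <- (RInt_Chasles _ c d b E5 E3), E2, E4.
    rewrite <- (RInt_ext mu _ c d Em); change plus with Rplus.
    assert (H : Rabs (RInt mu c d) <= (d - c) * B).
    { apply abs_RInt_le_const; [trivial|apply ex_RInt_cont, Hmu|]; intros t _.
      rewrite Rabs_pos_eq by apply Hmu; apply HB. }
    assert (H' := Rle_abs (RInt mu c d)).
    apply Rle_trans with (RInt mu c d); [right; eq_in_R; ring|lra].
Qed.

Definition restrict (s t : R) (f : R -> R) (x : R) : R :=
  if Rle_dec s x then if Rle_dec x t then f x else 0 else 0.

(** Each induction step adds one node and one open interval. The value at a node is unrelated to the
    neighbouring constants, so points are treated apart; repeated nodes are allowed and skipped. The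
    mass bound is stated with [Int_SF] because a step function majorising an error is known to be
    small only in that sense. *)
Lemma good_test_step sigma mu a b B f : 1 / 2 < sigma -> limit_law sigma mu -> (forall u, mu u <= B) ->
  forall l lf : list R, RList.ordered_Rlist l -> length l = S (length lf) ->
    (forall i, (i < Init.Nat.pred (length l))%nat ->
       constant_D_eq f (open_interval (RList.pos_Rl l i) (RList.pos_Rl l (S i))) (RList.pos_Rl lf i)) ->
    let s := RList.pos_Rl l 0 in let t := RList.pos_Rl l (Init.Nat.pred (length l)) in
    a < s -> t < b ->
    good_test sigma mu a b (restrict s t f) /\
    ((forall x, s <= x <= t -> 0 <= f x) -> RInt (fun u => restrict s t f u * mu u) a b <= B * Int_SF lf l).
Proof.
  intros Hs Hmu HB; induction l as [|r1 l IH]; intros lf Ho Hlen Hc; [discriminate|].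
  destruct l as [|r2 l].
  - destruct lf as [|v lf]; [|discriminate]; simpl; intros Ha Hb.
    destruct (good_test_point sigma mu a b r1 B Hs Hmu HB (conj Ha Hb)) as [A1 A2].
    destruct (good_test_scal sigma mu a b (f r1) _ A1) as [A3 A4].
    assert (E : forall x, f r1 * at_point_fun r1 x = restrict r1 r1 f x).
    { intros x; unfold at_point_fun, restrict; destruct (Req_dec_T x r1) as [E1|N], (Rle_dec r1 x), (Rle_dec x r1); try rewrite E1; lra. }
    split; [apply (good_test_ext _ _ _ _ _ _ E A3)|]; intros Hp.
    rewrite (RInt_ext _ (fun u => f r1 * at_point_fun r1 u * mu u)) by (intros; rewrite E; trivial).
    rewrite A4; specialize (Hp r1 ltac:(lra)); nra.
  - destruct lf as [|v lf]; [discriminate|].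
    assert (Ho' := RList.RList_P4 (r2 :: l) r1 Ho).
    assert (H12 : r1 <= r2) by (apply (Ho 0%nat); simpl; lia).
    intros s t Ha Hb.
    assert (Et : t = RList.pos_Rl (r2 :: l) (Init.Nat.pred (length (r2 :: l)))) by reflexivity.
    assert (H2t : r2 <= t).
    { rewrite Et; apply (RList.RList_P7 (r2 :: l) r2 Ho'); simpl; auto. }
    unfold s in *; simpl RList.pos_Rl at 1 in Ha; simpl (RList.pos_Rl (r1 :: r2 :: l) 0).
    destruct (IH lf Ho') as [A1 A2].
    { simpl in Hlen; simpl; lia. }
    { intros i Hi; apply (Hc (S i)); simpl in *; lia. }
    { simpl; lra. }
    { rewrite <- Et; trivial. }
    rewrite <- Et in A1, A2; simpl (RList.pos_Rl (r2 :: l) 0) in A1, A2.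
    destruct (Req_dec_T r1 r2) as [->|N].
    + split; [exact A1|]; intros Hp; specialize (A2 Hp); simpl Int_SF; rewrite Rminus_diag, Rmult_0_r, Rplus_0_l; exact A2.
    + assert (Hlt : r1 < r2) by lra.
      assert (Hv := Hc 0%nat ltac:(simpl; lia)); simpl in Hv; unfold constant_D_eq, open_interval in Hv.
      destruct (good_test_point sigma mu a b r1 B Hs Hmu HB ltac:(lra)) as [P1 P2].
      destruct (good_test_interval sigma mu a b r1 r2 B Hs Hmu HB ltac:(lra) H12 ltac:(lra)) as [Q1 Q2].
      destruct (good_test_scal sigma mu a b (f r1) _ P1) as [P3 P4].
      destruct (good_test_scal sigma mu a b v _ Q1) as [Q3 Q4].
      destruct (good_test_plus _ _ _ _ _ _ P3 Q3) as [U1 U2].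
      destruct (good_test_plus _ _ _ _ _ _ U1 A1) as [V1 V2].
      assert (E : forall x, f r1 * at_point_fun r1 x + v * on_interval r1 r2 x + restrict r2 t f x = restrict r1 t f x).
      { intros x; unfold at_point_fun, on_interval, restrict.
        destruct (Req_dec_T x r1) as [E1|N1].
        - rewrite E1; destruct (Rlt_dec r1 r1), (Rle_dec r2 r1), (Rle_dec r1 r1), (Rle_dec r1 t); lra.
        - destruct (Rlt_dec r1 x) as [L1|L1], (Rlt_dec x r2) as [L2|L2], (Rle_dec r2 x), (Rle_dec r1 x), (Rle_dec x t); try lra.
          rewrite (Hv x) by lra; lra. }
      split; [apply (good_test_ext _ _ _ _ _ _ E V1)|]; intros Hp.
      rewrite (RInt_ext _ (fun u => (f r1 * at_point_fun r1 u + v * on_interval r1 r2 u + restrict r2 t f u) * mu u))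
        by (intros; rewrite E; trivial).
      rewrite V2, U2, P4, Q4.
      assert (Hv0 : 0 <= v).
      { rewrite <- (Hv ((r1 + r2) / 2)) by lra; apply Hp; lra. }
      assert (Hf1 := Hp r1 ltac:(lra)).
      specialize (A2 (fun x Hx => Hp x ltac:(lra))).
      change (Int_SF (v :: lf) (r1 :: r2 :: l)) with (v * (r2 - r1) + Int_SF lf (r2 :: l)).
      apply (Rmult_le_compat_l v) in Q2; trivial; apply (Rmult_le_compat_l (f r1)) in P2; trivial.
      replace (B * (v * (r2 - r1) + Int_SF lf (r2 :: l))) with (v * (B * (r2 - r1)) + B * Int_SF lf (r2 :: l)) by ring.
      rewrite Rmult_0_r in P2; lra.
Qed.

(** Riemann integrability supplies step functions [phi] and [psi] with [psi] of small integral, and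
    the bound on the density makes its mass small too. The interval is widened by 1 to leave room
    for tents centred at [a] and [b]. *)
Lemma good_test_Riemann sigma mu a b B Phi : 1 / 2 < sigma -> limit_law sigma mu -> (forall u, mu u <= B) ->
  a <= b -> (forall x, x < a \/ b < x -> Phi x = 0) -> ex_RInt Phi a b ->
  good_test sigma mu (a - 1) (b + 1) Phi.
Proof.
  intros Hs Hmu HB Hab H0 Hex.
  assert (HB0 : 0 <= B) by (eapply Rle_trans; [apply (proj1 (proj2 Hmu) 0)|apply HB]).
  apply good_test_sandwich; [lra|apply Hmu|intros x Hx; apply H0; lra|].
  intros eps He; assert (He' : 0 < eps / (B + 1)) by (apply Rdiv_lt_0_compat; lra).
  destruct (ex_RInt_Reals_0 Phi a b Hex (mkposreal _ He')) as [phi [psi [H1 H2]]]; simpl in H2.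
  rewrite Rmin_left, Rmax_right in H1 by trivial.
  assert (Hstep : forall g : StepFun a b,
    good_test sigma mu (a - 1) (b + 1) (restrict a b g) /\
    ((forall x, a <= x <= b -> 0 <= g x) ->
       RInt (fun u => restrict a b g u * mu u) (a - 1) (b + 1) <= B * RiemannInt_SF g)).
  { intros g; destruct (@StepFun_P1 a b g) as [S1 [S2 [S3 [S4 S5]]]].
    rewrite Rmin_left in S2 by trivial; rewrite Rmax_right in S3 by trivial.
    assert (A := good_test_step sigma mu (a - 1) (b + 1) B g Hs Hmu HB _ _ S1 S4 S5); cbv zeta in A.
    rewrite S2, S3 in A; unfold RiemannInt_SF; destruct (Rle_dec a b); [|contradiction]; apply A; lra. }
  destruct (Hstep phi) as [P1 _]; destruct (Hstep psi) as [P2 P3].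
  assert (Hpsi0 : forall x, a <= x <= b -> 0 <= psi x).
  { intros x Hx; eapply Rle_trans; [apply Rabs_pos|apply H1; trivial]. }
  exists (restrict a b phi), (restrict a b psi); split; [trivial|split; [trivial|split]].
  - intros x; unfold restrict; destruct (Rle_dec a x), (Rle_dec x b); [apply H1; lra| | |];
      rewrite H0, Rminus_diag, Rabs_R0 by lra; lra.
  - eapply Rle_trans; [apply P3; trivial|].
    assert (H3 := Rle_abs (RiemannInt_SF psi)).
    assert (E : (B + 1) * (eps / (B + 1)) = eps) by (field; lra); nra.
Qed.

(** * Tightness and bounded continuous functions *)

Lemma local_log_bound r c : 0 < r < 1 -> Cmod c = 1 -> Rabs (local_log r c) <= 2 * / (1 - r).
Proof.
  intros Hr Hc; assert (H1 := one_minus_pos r c ltac:(lra) ltac:(lra)).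
  assert (H2 : Cmod (1 - RtoC r * c)%C <= 1 + r).
  { unfold Cminus; eapply Rle_trans; [apply Cmod_triangle|].
    rewrite Cmod_opp, Cmod_mult, Cmod_1, Cmod_R, Hc, Rabs_pos_eq; lra. }
  unfold local_log; rewrite ln_pow by lra; simpl INR; set (x := Cmod (1 - RtoC r * c)%C) in *.
  rewrite Rabs_Ropp, Rabs_mult, (Rabs_pos_eq (1 + 1)) by lra.
  apply Rmult_le_compat_l; [lra|].
  replace (ln x) with (ln x - ln 1) by (rewrite ln_1; ring).
  eapply Rle_trans; [apply (ln_Lipschitz (1 - r)); lra|].
  rewrite <- (Rmult_1_r (/ (1 - r))) at 2; apply Rmult_le_compat_l; [apply Rlt_le, Rinv_0_lt_compat; lra|].
  apply Rabs_le; lra.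
Qed.

Definition plateau (K x : R) : R := Rmax 0 (Rmin 1 (K + 1 - Rabs x)).

Lemma plateau_range K x : 0 <= plateau K x <= 1.
Proof. split; [apply Rmax_l|apply Rmax_lub; [lra|apply Rmin_l]]. Qed.

Lemma plateau_1 K x : Rabs x <= K -> plateau K x = 1.
Proof. intros H; unfold plateau; rewrite Rmin_left, Rmax_right; lra. Qed.

Lemma plateau_csupp K : csupp (plateau K) (- (K + 1)) (K + 1).
Proof.
  split.
  - intros x; apply cont_max; [apply continuous_const|].
    apply (continuous_ext (fun y => - Rmax (- 1) (- (K + 1 - Rabs y)))).
    + intros y; unfold Rmax, Rmin; destruct (Rle_dec (- 1) _), (Rle_dec 1 _); lra.
    + apply cont_opp, cont_max; [apply continuous_const|]; apply cont_opp, cont_minus; [apply continuous_const|apply continuous_Rabs].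
  - intros x Hx; apply Rmax_left; eapply Rle_trans; [apply Rmin_r|].
    unfold Rabs; destruct (Rcase_abs x); lra.
Qed.

(** For one fixed truncation, the sum over finitely many primes is bounded by a constant independent
    of the character, and [log_L] stays close to it outside a small proportion of characters. *)
Lemma tightness sigma eps : 1 / 2 < sigma -> 0 < eps -> exists K q0, 0 < K /\
  forall q, (q0 <= q)%nat -> prime (Z.of_nat q) ->
    Avg q (fun chi => 1 - indic (G chi (RtoC sigma)) * plateau K (log_L sigma chi)) <= eps.
Proof.
  intros Hs He; destruct (log_L_approx_Avg sigma (eps / 2) Hs) as [y Hy]; [lra|].
  destruct (Hy y (Nat.le_refl y)) as [q0 [_ Hq0]]; set (l := primes_upto y) in *.
  assert (Hbase : 0 <= rsum l (fun p => 2 * / (1 - npow sigma p))).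
  { apply rsum_nonneg; intros p Hp; assert (Hr := npow_prime_range sigma p ltac:(lra) (primes_upto_prime y p Hp)).
    assert (0 < / (1 - npow sigma p)) by (apply Rinv_0_lt_compat; lra); lra. }
  exists (rsum l (fun p => 2 * / (1 - npow sigma p)) + eps), q0; split; [lra|]; intros q Hq Hqp.
  destruct (Hq0 q Hq Hqp) as [Hlq A]; eapply Rle_trans; [|eapply Rle_trans; [exact A|lra]].
  apply Avg_le; intros chi Hchi; apply (X_enumerates q Hqp) in Hchi.
  assert (I := indic_range (G chi (RtoC sigma))).
  assert (P := plateau_range (rsum l (fun p => 2 * / (1 - npow sigma p)) + eps) (log_L sigma chi)).
  unfold indic at 2; destruct (excluded_middle_informative _) as [N|N]; [nra|].
  apply NNPP in N; destruct N as [N1 N2]; unfold indic; destruct (excluded_middle_informative _); [|contradiction].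
  rewrite plateau_1; [lra|].
  rewrite (log_sum_char_pt q) in N2 by (trivial; apply primes_upto_prime).
  assert (V : Rabs (log_euler sigma l (char_pt chi)) <= rsum l (fun p => 2 * / (1 - npow sigma p))).
  { unfold log_euler; eapply Rle_trans; [apply rsum_abs|apply rsum_le]; intros p Hp.
    apply local_log_bound; [apply npow_prime_range; [lra|apply (primes_upto_prime y); trivial]|apply char_pt_torus]. }
  fold l in N2; apply Rabs_le_between in N2; apply Rabs_le_between in V; apply Rabs_le; lra.
Qed.

Definition converges_to_integral (sigma : R) (mu Phi : R -> R) (I : R) : Prop :=
  plim (AvgG sigma Phi) I /\
  forall eps, 0 < eps -> exists N, forall a b, a <= - N -> N <= b ->
    exists y, is_RInt (fun u => Phi u * mu u) a b y /\ Rabs (y - I) <= eps.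

Lemma good_test_converges sigma mu a b Phi : a <= b -> good_test sigma mu a b Phi ->
  converges_to_integral sigma mu Phi (RInt (fun u => Phi u * mu u) a b).
Proof.
  intros Hab [H0 [Hex Hp]]; split; trivial; intros eps He.
  exists (Rmax (Rabs a) (Rabs b)); intros A B HA HB.
  assert (M1 := Rmax_l (Rabs a) (Rabs b)); assert (M2 := Rmax_r (Rabs a) (Rabs b)).
  assert (Aa : A <= a) by (assert (Q := Rle_abs (- a)); rewrite Rabs_Ropp in Q; lra).
  assert (Bb : b <= B) by (assert (Q := Rle_abs b); lra).
  exists (RInt (fun u => Phi u * mu u) a b); split; [|rewrite Rminus_diag, Rabs_R0; lra].
  assert (Z : forall s t, s <= t -> t <= a \/ b <= s -> is_RInt (fun u => Phi u * mu u) s t 0).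
  { intros s t Hst Hst'; apply (is_RInt_ext (fun _ => 0)).
    - intros x; rewrite Rmin_left, Rmax_right by trivial; intros Hx; rewrite H0 by lra; eq_in_R; ring.
    - assert (Q := is_RInt_const (V := R_NormedModule) s t 0); unfold scal in Q; simpl in Q; unfold mult in Q; simpl in Q.
      rewrite Rmult_0_r in Q; exact Q. }
  assert (E := is_RInt_Chasles (V := R_NormedModule) _ A a B _ _ (Z A a Aa ltac:(lra))
    (is_RInt_Chasles (V := R_NormedModule) _ a b B _ _ (RInt_correct _ _ _ Hex) (Z b B Bb ltac:(lra)))).
  unfold plus in E; simpl in E; rewrite Rplus_0_l, Rplus_0_r in E; exact E.
Qed.

(** A plateau cuts [Phi] off to compact support. Tightness bounds the loss both in the averages and
    in the integral against [mu], and the same tail estimate makes the improper integral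
    converge. *)
Lemma bounded_continuous_converges sigma mu Phi B : 1 / 2 < sigma -> limit_law sigma mu ->
  (forall x, continuous Phi x) -> (forall x, Rabs (Phi x) <= B) ->
  exists I, converges_to_integral sigma mu Phi I.
Proof.
  intros Hs Hmu HPc HPB.
  assert (HB0 : 0 <= B) by (eapply Rle_trans; [apply Rabs_pos|apply (HPB 0)]).
  destruct Hmu as [Hmc [Hm0 Hml]].
  assert (Hmu : limit_law sigma mu) by (split; auto).
  assert (HPm : forall u, continuous (fun u => Phi u * mu u) u) by (intros u; apply cont_mult; auto).
  assert (Hmass : forall F a b, csupp F a b -> a <= b -> (forall x, F x <= 1) -> RInt (fun u => F u * mu u) a b <= 1).
  { intros F a b HF Hab HF1; apply (plim_le _ _ _ 3%nat (Hml F a b HF Hab)); intros q Hq Hqp.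
    rewrite <- (Avg_const q 1) by trivial; apply Avg_le; auto. }
  assert (Htot : forall a b, a <= b -> RInt mu a b <= 1).
  { intros a b Hab; set (K := Rmax (Rabs a) (Rabs b)).
    assert (M1 := Rmax_l (Rabs a) (Rabs b)); assert (M2 := Rmax_r (Rabs a) (Rabs b)); fold K in M1, M2.
    assert (Qa := Rle_abs (- a)); rewrite Rabs_Ropp in Qa; assert (Qb := Rle_abs b).
    assert (Hc : forall u, continuous (fun u => plateau K u * mu u) u) by (intros u; apply cont_mult; [apply plateau_csupp|auto]).
    assert (Hpos : forall s t, s <= t -> 0 <= RInt (fun u => plateau K u * mu u) s t).
    { intros s t Hst; apply RInt_ge_0; [trivial|apply ex_RInt_cont; trivial|].
      intros x _; apply Rmult_le_pos; [apply plateau_range|auto]. }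
    eapply Rle_trans; [|apply (Hmass (plateau K) (- (K + 1)) (K + 1) (plateau_csupp K)); [|intros; apply plateau_range]].
    2:{ assert (0 <= Rabs a) by apply Rabs_pos; lra. }
    rewrite <- (RInt_Chasles _ (- (K + 1)) a (K + 1)), <- (RInt_Chasles _ a b (K + 1)) by (apply ex_RInt_cont; trivial).
    rewrite (RInt_ext mu (fun u => plateau K u * mu u) a b).
    - change plus with Rplus.
      assert (P1 := Hpos (- (K + 1)) a ltac:(lra)); assert (P2 := Hpos b (K + 1) ltac:(lra)).
      eapply Rle_trans; [|apply Rplus_le_compat; [exact P1|apply Rplus_le_compat; [apply Rle_refl|exact P2]]].
      rewrite Rplus_0_l, Rplus_0_r; apply Rle_refl.
    - intros x; rewrite Rmin_left, Rmax_right by trivial; intros Hx; rewrite plateau_1; [eq_in_R; ring|].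
      apply Rabs_le; lra. }
  assert (Htail : forall eps, 0 < eps -> exists K q0, 0 < K /\
    (forall a b, a <= - (K + 1) -> K + 1 <= b ->
      Rabs (RInt (fun u => Phi u * mu u) a b - RInt (fun u => Phi u * plateau K u * mu u) (- (K + 1)) (K + 1)) <= B * eps) /\
    (forall q, (q0 <= q)%nat -> prime (Z.of_nat q) ->
      Rabs (AvgG sigma Phi q - AvgG sigma (fun x => Phi x * plateau K x) q) <= B * eps)).
  { intros eps He; destruct (tightness sigma eps Hs He) as [K [q0 [HK Hq0]]]; exists K, q0; split; [trivial|split].
    - assert (HPl := plateau_csupp K).
      (* Tightness passes to the limit: this lower bound and a total mass of at most 1 leave at most
         [eps] under [1 - plateau K]. *)
      assert (Hge : 1 - eps <= RInt (fun u => plateau K u * mu u) (- (K + 1)) (K + 1)).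
      { apply (plim_ge _ _ _ (q0 + 3)%nat (Hml (plateau K) _ _ HPl ltac:(lra))); intros q Hq Hqp.
        specialize (Hq0 q ltac:(lia) Hqp); rewrite Avg_minus, Avg_const in Hq0 by (trivial; lia).
        assert (E : Avg q (fun chi => indic (G chi (RtoC sigma)) * plateau K (log_L sigma chi)) <= Avg q (fun chi => plateau K (log_L sigma chi))).
        { apply Avg_le; intros chi _; assert (I := indic_range (G chi (RtoC sigma))); assert (P := plateau_range K (log_L sigma chi)); nra. }
        lra. }
      intros a b Ha Hb.
      assert (Hsup : csupp (fun u => Phi u * plateau K u * mu u) (- (K + 1)) (K + 1)).
      { split; [intros u; apply cont_mult; [apply cont_mult; [auto|apply HPl]|auto]|].
        intros x Hx; rewrite (proj2 HPl) by trivial; ring. }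
      assert (Hsup' : csupp (fun u => plateau K u * mu u) (- (K + 1)) (K + 1)).
      { split; [intros u; apply cont_mult; [apply HPl|auto]|]; intros x Hx; rewrite (proj2 HPl) by trivial; ring. }
      rewrite <- (RInt_enlarge _ _ _ a b Hsup) by lra; rewrite <- (RInt_enlarge _ _ _ a b Hsup') in Hge by lra.
      assert (E := RInt_minus (V := R_CompleteNormedModule) _ _ a b (ex_RInt_cont _ a b HPm) (ex_RInt_cont _ a b (proj1 Hsup))).
      unfold minus, plus, opp in E; simpl in E; unfold Rminus; rewrite <- E.
      assert (Hdc : forall u, continuous (fun u => Phi u * mu u + - (Phi u * plateau K u * mu u)) u).
      { intros u; apply cont_minus; [apply HPm|apply Hsup]. }
      eapply Rle_trans; [apply abs_RInt_le; [lra|apply ex_RInt_cont; exact Hdc]|].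
      apply Rle_trans with (RInt (fun u => B * (mu u - plateau K u * mu u)) a b).
      + apply RInt_le; [lra|apply ex_RInt_cont; intros u; apply continuous_Rabs_comp, Hdc| |].
        * apply ex_RInt_cont; intros u; apply cont_mult; [apply continuous_const|]; apply cont_minus; [auto|apply Hsup'].
        * intros u _; assert (P := plateau_range K u); specialize (HPB u); specialize (Hm0 u).
          replace (Phi u * mu u + - (Phi u * plateau K u * mu u)) with (Phi u * (mu u - plateau K u * mu u)) by ring.
          rewrite Rabs_mult, (Rabs_pos_eq (mu u - _)) by nra; apply Rmult_le_compat_r; [nra|trivial].
      + assert (Hcm : forall u, continuous (fun u => mu u - plateau K u * mu u) u) by (intros u; apply cont_minus; [auto|apply Hsup']).
        rewrite (RInt_Rmult B (fun u => mu u - plateau K u * mu u)) by exact Hcm.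
        apply Rmult_le_compat_l; trivial.
        assert (E2 := RInt_minus (V := R_CompleteNormedModule) _ _ a b (ex_RInt_cont _ a b Hmc) (ex_RInt_cont _ a b (proj1 Hsup'))).
        unfold minus, plus, opp in E2; simpl in E2; eapply Rle_trans; [right; exact E2|].
        assert (T := Htot a b ltac:(lra)); lra.
    - intros q Hq Hqp; specialize (Hq0 q Hq Hqp).
      unfold AvgG; rewrite <- Avg_minus; eapply Rle_trans; [apply Avg_abs|].
      apply Rle_trans with (B * Avg q (fun chi => 1 - indic (G chi (RtoC sigma)) * plateau K (log_L sigma chi)));
        [|apply Rmult_le_compat_l; trivial].
      rewrite <- Avg_scal; apply Avg_le; intros chi _.
      assert (I := indic_range (G chi (RtoC sigma))); assert (P := plateau_range K (log_L sigma chi)).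
      replace (indic (G chi (RtoC sigma)) * Phi (log_L sigma chi) - indic (G chi (RtoC sigma)) * (Phi (log_L sigma chi) * plateau K (log_L sigma chi)))
        with (Phi (log_L sigma chi) * (indic (G chi (RtoC sigma)) * (1 - plateau K (log_L sigma chi)))) by ring.
      specialize (HPB (log_L sigma chi)).
      rewrite Rabs_mult, (Rabs_pos_eq (indic _ * _)) by nra; apply Rmult_le_compat; [apply Rabs_pos|nra|trivial|nra]. }
  set (J := fun n => RInt (fun u => Phi u * mu u) (- INR n) (INR n)).
  assert (HJ : forall eps, 0 < eps -> exists N : nat, forall n a b, (N <= n)%nat -> a <= - INR N -> INR N <= b ->
     Rabs (RInt (fun u => Phi u * mu u) a b - J n) <= eps).
  { intros eps He; destruct (Htail (eps / (2 * (B + 1)))) as [K [q0 [HK [H1 _]]]]; [apply Rdiv_lt_0_compat; lra|].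
    destruct (nfloor_ex (K + 1)) as [N0 [_ HN0]]; [lra|]; exists (S N0); intros n a b Hn Ha Hb.
    rewrite S_INR in Ha, Hb; apply le_INR in Hn; rewrite S_INR in Hn.
    assert (A1 := H1 a b ltac:(lra) ltac:(lra)); assert (A2 := H1 (- INR n) (INR n) ltac:(lra) ltac:(lra)); fold (J n) in A2.
    assert (E : (2 * (B + 1)) * (eps / (2 * (B + 1))) = eps) by (field; lra).
    assert (E0 : 0 < eps / (2 * (B + 1))) by (apply Rdiv_lt_0_compat; lra).
    apply Rabs_le_between in A1; apply Rabs_le_between in A2; apply Rabs_le; nra. }
  assert (HJl : is_lim_seq J (real (Lim_seq J))).
  { apply Lim_seq_correct', ex_lim_seq_cauchy_corr; intros eps; assert (He := cond_pos eps).
    destruct (HJ (eps / 2)) as [N HN]; [lra|]; exists N; intros n n' Hn Hn'.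
    apply le_INR in Hn; assert (A := HN n' (- INR n) (INR n) Hn' ltac:(lra) Hn); fold (J n) in A; lra. }
  set (I := real (Lim_seq J)) in *.
  assert (HI : forall eps, 0 < eps -> exists N : nat, forall a b, a <= - INR N -> INR N <= b ->
     Rabs (RInt (fun u => Phi u * mu u) a b - I) <= eps).
  { intros eps He; destruct (HJ (eps / 2)) as [N HN]; [lra|]; exists N; intros a b Ha Hb.
    apply is_lim_seq_spec in HJl; destruct (HJl (mkposreal (eps / 2) ltac:(lra))) as [N2 HN2]; simpl in HN2.
    specialize (HN2 (N + N2)%nat ltac:(lia)); assert (A := HN (N + N2)%nat a b ltac:(lia) Ha Hb).
    apply Rabs_lt_between in HN2; apply Rabs_le_between in A; apply Rabs_le; lra. }
  exists I; split.
  - intros eps He.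
    destruct (Htail (eps / (4 * (B + 1)))) as [K [q0 [HK [H1 H2]]]]; [apply Rdiv_lt_0_compat; lra|].
    assert (E : (4 * (B + 1)) * (eps / (4 * (B + 1))) = eps) by (field; lra).
    assert (E0 : 0 < eps / (4 * (B + 1))) by (apply Rdiv_lt_0_compat; lra).
    assert (E1 : B * (eps / (4 * (B + 1))) <= eps / 4) by nra.
    destruct (HI (eps / 4)) as [N HN]; [lra|].
    assert (HNp := pos_INR N).
    assert (A1 := H1 (- (INR N + (K + 1))) (INR N + (K + 1)) ltac:(lra) ltac:(lra)).
    assert (A2 := HN (- (INR N + (K + 1))) (INR N + (K + 1)) ltac:(lra) ltac:(lra)).
    assert (HPl := plateau_csupp K).
    assert (HF : csupp (fun x => Phi x * plateau K x) (- (K + 1)) (K + 1)).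
    { split; [intros u; apply cont_mult; [auto|apply HPl]|]; intros x Hx; rewrite (proj2 HPl) by trivial; ring. }
    destruct (proj2 (proj2 (good_test_csupp sigma mu _ _ _ Hs Hmu HF ltac:(lra))) (eps / 4)) as [q1 Hq1]; [lra|].
    exists (q0 + q1)%nat; intros q Hq Hqp; specialize (H2 q ltac:(lia) Hqp); specialize (Hq1 q ltac:(lia) Hqp).
    apply Rabs_le_between in A1; apply Rabs_le_between in A2; apply Rabs_le_between in H2; apply Rabs_le_between in Hq1.
    apply Rabs_le; lra.
  - intros eps He; destruct (HI eps He) as [N HN]; exists (INR N); intros a b Ha Hb.
    exists (RInt (fun u => Phi u * mu u) a b); split; [|auto].
    apply (RInt_correct (V := R_CompleteNormedModule)), ex_RInt_cont, HPm.
Qed.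

(** The list behind the sum over [X'] is an unspecified choice; it agrees up to permutation with the
    filtered list of [X q], which is all that a finite sum sees. *)
Lemma average_eq sigma Phi q : prime (Z.of_nat q) -> (3 <= q)%nat ->
  average sigma Phi q = (AvgG sigma (fun x => Re (Phi x)) q, AvgG sigma (fun x => Im (Phi x)) q).
Proof.
  intros Hq Hq3; unfold average.
  set (F := fun chi => Phi (2 * ln (Cmod (dirichlet_L chi (RtoC sigma))))).
  set (dec := fun chi : Z -> C => if excluded_middle_informative (G chi (RtoC sigma)) then true else false).
  assert (HX := X_enumerates q Hq).
  assert (HX' : enumerates (X' q (RtoC sigma)) (filter dec (enum (X q)))).
  { split; [apply NoDup_filter, HX|]; intros chi; rewrite filter_In; unfold X', dec; rewrite (proj2 HX chi).
    destruct (excluded_middle_informative _); split; intuition discriminate. }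
  assert (HX2 : enumerates (X' q (RtoC sigma)) (enum (X' q (RtoC sigma)))).
  { unfold enum at 1; apply epsilon_spec; eexists; exact HX'. }
  assert (E : Csum_over (X' q (RtoC sigma)) F = csum (enum (X' q (RtoC sigma))) F).
  { unfold Csum_over; generalize (enum (X' q (RtoC sigma))); intros l; induction l as [|x l IH]; simpl; congruence. }
  rewrite E, (csum_perm _ _ _ (enumerates_perm _ _ _ HX2 HX')), csum_filter.
  unfold card; rewrite X_length by trivial.
  assert (Hq2 : 0 < INR (q - 2)) by (apply lt_0_INR; lia).
  set (S := csum _ _).
  assert (E2 : (S / RtoC (INR (q - 2)))%C = (/ INR (q - 2) * Re S, / INR (q - 2) * Im S)).
  { unfold Cdiv; rewrite <- RtoC_inv by lra; apply injective_projections; unfold Re, Im; simpl; ring. }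
  rewrite E2; unfold AvgG, Avg, S; rewrite Re_csum, Im_csum.
  apply injective_projections; unfold fst, snd; f_equal; apply rsum_ext; intros chi _; unfold dec, indic, F, log_L;
    destruct (excluded_middle_informative _); unfold Re, Im; simpl; ring.
Qed.

Lemma converges_complex sigma mu Phi I1 I2 :
  converges_to_integral sigma mu (fun x => Re (Phi x)) I1 ->
  converges_to_integral sigma mu (fun x => Im (Phi x)) I2 ->
  is_integral_against (fun u => sqrt (2 * PI) * mu u) Phi (I1, I2) /\
  filterlim (average sigma Phi) along_primes (locally ((I1, I2) : C)).
Proof.
  intros [P1 Q1] [P2 Q2]; split.
  - intros P [eps HP]; assert (He := cond_pos eps).
    destruct (Q1 (eps / 2)) as [N1 HN1]; [lra|]; destruct (Q2 (eps / 2)) as [N2 HN2]; [lra|].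
    set (N := Rmax N1 N2); assert (M1 := Rmax_l N1 N2); assert (M2 := Rmax_r N1 N2); fold N in M1, M2.
    apply (Filter_prod _ _ _ (fun a => a < - N) (fun b => N < b)).
    + exists (- N); trivial.
    + exists N; trivial.
    + intros a b Ha Hb; simpl.
      destruct (HN1 a b ltac:(lra) ltac:(lra)) as [y1 [U1 V1]]; destruct (HN2 a b ltac:(lra) ltac:(lra)) as [y2 [U2 V2]].
      exists (y1, y2); split.
      (* The factor [sqrt (2 * PI)] in the density cancels the normalisation of the measure, leaving
         [mu]. *)
      * assert (Hs2 : sqrt (2 * PI) <> 0) by (apply Rgt_not_eq, sqrt_lt_R0; assert (HP' := PI_RGT_0); lra).
        apply (is_RInt_ext (fun u => (Re (Phi u) * mu u, Im (Phi u) * mu u) : C)).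
        { intros u _; apply injective_projections; unfold Re, Im; simpl; field; trivial. }
        apply (is_RInt_fct_extend_pair (U := R_NormedModule) (V := R_NormedModule)); trivial.
      * apply HP; split; simpl.
        -- change (Rabs (y1 - I1) < eps); lra.
        -- change (Rabs (y2 - I2) < eps); lra.
  - intros P [eps HP]; assert (He := cond_pos eps).
    destruct (P1 (eps / 2)) as [q1 Hq1]; [lra|]; destruct (P2 (eps / 2)) as [q2 Hq2]; [lra|].
    exists (q1 + q2 + 3)%nat; intros q Hq Hqp; rewrite average_eq by (trivial; lia).
    specialize (Hq1 q ltac:(lia) Hqp); specialize (Hq2 q ltac:(lia) Hqp).
    apply HP; split; simpl.
    + change (Rabs (AvgG sigma (fun x => Re (Phi x)) q - I1) < eps); lra.
    + change (Rabs (AvgG sigma (fun x => Im (Phi x)) q - I2) < eps); lra.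
Qed.

Theorem theorem1p1 (sigma : R) (Hsigma : 1 / 2 < sigma) :
  exists M : R -> R,
    (forall u : R, continuous M u) /\
    (forall u : R, 0 <= M u) /\
    forall Phi : R -> C, test_function Phi ->
      exists I : C,
        is_integral_against M Phi I /\
        filterlim (average sigma Phi) along_primes (locally I).
Proof.
  destruct (limit_density sigma Hsigma) as [mu [Hc [H0 [[B HB] Hl]]]].
  assert (Hmu : limit_law sigma mu) by (split; auto).
  exists (fun u => sqrt (2 * PI) * mu u); split; [|split].
  - intros u; apply cont_mult; [apply continuous_const|apply Hc].
  - intros u; apply Rmult_le_pos; [apply sqrt_pos|apply H0].
  - assert (Hconv : forall Phi : R -> C,
      (exists I, converges_to_integral sigma mu (fun x => Re (Phi x)) I) ->
      (exists I, converges_to_integral sigma mu (fun x => Im (Phi x)) I) ->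
      exists I : C, is_integral_against (fun u => sqrt (2 * PI) * mu u) Phi I /\
        filterlim (average sigma Phi) along_primes (locally I)).
    { intros Phi [I1 H1] [I2 H2]; exists (I1, I2); apply converges_complex; trivial. }
    intros Phi [[HPc [K HK]]|[a [b [Hab [HP0 HPi]]]]]; apply Hconv.
    + apply (bounded_continuous_converges sigma mu _ K); trivial.
      * intros x; apply (continuous_comp Phi (fun z : C => fst z)); [apply HPc|apply continuous_fst].
      * intros x; eapply Rle_trans; [|apply (HK x)]; eapply Rle_trans; [|apply Rmax_Cmod]; apply Rmax_l.
    + apply (bounded_continuous_converges sigma mu _ K); trivial.
      * intros x; apply (continuous_comp Phi (fun z : C => snd z)); [apply HPc|apply continuous_snd].
      * intros x; eapply Rle_trans; [|apply (HK x)]; eapply Rle_trans; [|apply Rmax_Cmod]; apply Rmax_r.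
    + eexists; apply (good_test_converges sigma mu (a - 1) (b + 1)); [lra|].
      apply (good_test_Riemann sigma mu a b B); trivial.
      * intros x Hx; rewrite HP0 by trivial; trivial.
      * apply (ex_RInt_fct_extend_fst (U := R_NormedModule) (V := R_NormedModule) Phi); trivial.
    + eexists; apply (good_test_converges sigma mu (a - 1) (b + 1)); [lra|].
      apply (good_test_Riemann sigma mu a b B); trivial.
      * intros x Hx; rewrite HP0 by trivial; trivial.
      * apply (ex_RInt_fct_extend_snd (U := R_NormedModule) (V := R_NormedModule) Phi); trivial.
Qed.
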